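(* Let $d\ge2$, let $k\ge\max\{d,3\}$ be an integer, let $K\subset\mathbb R^d$ be a nondegenerate $d$-simplex, and let $$V^-(\operatorname{div}\operatorname{div}^+;\mathbb S):=\mathbb P_k(K;\mathbb S)\oplus\boldsymbol x\boldsymbol x^{\intercal}\mathbb H_{k-1}(K).$$ Then the degrees of freedom $$\boldsymbol\tau(\delta)\quad\forall\,\delta\in\mathcal V(K),$$ $$(\boldsymbol n_i^{\intercal}\boldsymbol\tau\boldsymbol n_j,q)_F\quad\forall\,q\in\mathbb P_{k+r-d-1}(F),\ F\in\mathcal F^r(K),\ i,j=1,\dots,r,\ r=1,\dots,d-1,$$ $$(\Pi_F\boldsymbol\tau\boldsymbol n,\boldsymbol q)_F\quad\forall\,\boldsymbol q\in \mathrm{ND}_{k-2}(F),\ F\in\mathcal F^1(K),$$ $$(\boldsymbol n^{\intercal}\operatorname{div}\boldsymbol\tau,p)_F\quad\forall\,p\in\mathbb P_{k-1}(F),\ F\in\mathcal F^1(K),$$ $$(\operatorname{div}\operatorname{div}\boldsymbol\tau,q)_K\quad\forall\,q\in\mathbb P_{k-1}(K)/\mathbb P_1(K),$$ $$(\operatorname{div}\boldsymbol\tau,\boldsymbol q)_K\quad\forall\,\boldsymbol q\in\big(\mathbb P_{k-3}(K;\mathbb K)/\mathbb P_0(K;\mathbb K)\big)\boldsymbol x,$$ $$(\boldsymbol\tau,\boldsymbol q)_K\quad\forall\,\boldsymbol q\in\ker(\cdot\boldsymbol x)\cap\mathbb P_{k-2}(K;\mathbb S)$$ are uni-solvent for $V^-(\operatorname{div}\operatorname{div}^+;\mathbb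 S)$.
   Context: Coordinates $\boldsymbol x$ on $\mathbb R^d$ are chosen with the origin in $K$. $\mathcal F^r(K)$ is the set of $(d-r)$-dimensional faces of $K$, and $\mathcal V(K)=\mathcal F^d(K)$ is the set of vertices. For $F\in\mathcal F^r(K)$ with $1\le r\le d-1$, $\boldsymbol n_1,\dots,\boldsymbol n_r$ (depending on $F$) are mutually orthogonal unit vectors spanning the orthogonal complement of the tangent space of $F$; for $r=1$ write $\boldsymbol n=\boldsymbol n_1$ and $\Pi_F\boldsymbol v=(\boldsymbol I-\boldsymbol n\boldsymbol n^{\intercal})\boldsymbol v$. $(\cdot,\cdot)_F$, $(\cdot,\cdot)_K$ are $L^2$ inner products. $\mathbb S$ (resp. $\mathbb K$) is the space of symmetric (resp. skew-symmetric) real matrices of the appropriate size ($d\times d$ on $K$). $\mathbb P_m(D)$ is the space of polynomials on $D$ of total degree $\le m$ ($\{0\}$ if $m<0$), $\mathbb H_m(D)$ is the space of homogeneous polynomials of degree $m$, and $\mathbb P_m(D;X)$, $\mathbb H_m(D;X)$ are the $X$-valued versions. For a simplex $D$ of dimension $s$ (a face being identified with a simplex in $\mathbb R^{s}$ through Cartesian coordinates $\boldsymbol x$ of its affine hull, tangential vectors being identified with $\mathbb R^s$), $\mathrm{ND}_m(D)=\mathbb P_m(D;\mathbb R^s)\oplus\mathbb H_m(D;\mathbb K)\boldsymbol x$ ($\{\boldsymbol 0\}$ if $m<0$). $\operatorname{div}$ of a matrix field is taken row-wise, and $\operatorname{div}\operatorname{div}\boldsymbol\tau=\operatorname{div}(\operatorname{div}\boldsymbol\tau)$.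 $\ker(\cdot\boldsymbol x)$ denotes matrix fields $\boldsymbol\tau$ with $\boldsymbol\tau\boldsymbol x=\boldsymbol 0$. $\mathbb P_{k-1}(K)/\mathbb P_1(K)$ is the $L^2(K)$-orthogonal complement of $\mathbb P_1(K)$ in $\mathbb P_{k-1}(K)$, and $(\mathbb P_{k-3}(K;\mathbb K)/\mathbb P_0(K;\mathbb K))\boldsymbol x$ is the $L^2(K)$-orthogonal complement of $\mathbb P_0(K;\mathbb K)\boldsymbol x$ in $\mathbb P_{k-3}(K;\mathbb K)\boldsymbol x$. Uni-solvent for a finite-dimensional space $V$ means: (a) the only $\boldsymbol\tau\in V$ for which all listed quantities vanish is $\boldsymbol\tau=\boldsymbol 0$; and (b) the number of degrees of freedom equals $\dim V$, where one counts $d(d+1)/2$ for each vertex value $\boldsymbol\tau(\delta)$, only pairs $i\le j$ in the families with $\boldsymbol n_i^{\intercal}\boldsymbol\tau\boldsymbol n_j$ (by symmetry), and for each family tested against $q$ in a space $Q$ the number $\dim Q$. *)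

(* Defs.v *)
From mathcomp Require Import all_boot all_order all_algebra.
From mathcomp Require Import all_classical all_reals all_analysis.
(* The notations of mpoly clash with those of MathComp-Analysis.              *)
From mathcomp.multinomials Require mpoly.
Export -(notations) mpoly.

Set Implicit Arguments.
Unset Strict Implicit.
Unset Printing Implicit Defensive.

Import Order.TTheory GRing.Theory Num.Theory.
Local Open Scope classical_set_scope.
Local Open Scope ring_scope.

Notation "{ 'mpoly' T [ n ] }" := (mpoly n T) : type_scope.

Section Polynomials.
Variables (R : realType) (n : nat).

Definition ev (p : {mpoly R[n]}) (x : 'cV[R]_n) : R :=
  meval (fun i => x i 0) p.

Definition evmx m l (A : 'M[{mpoly R[n]}]_(m, l)) (x : 'cV[R]_n) : 'M[R]_(m, l) :=
  map_mx (fun p => ev p x) A.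

Definition xvec : 'cV[{mpoly R[n]}]_n := \col_i mpolyX R (mnm1 i).

(* msize is 1 + the total degree, and 0 on the zero polynomial *)
Definition Ppoly (m : nat) : set {mpoly R[n]} := [set p | (msize p <= m.+1)%N].

Definition Hpoly (m : nat) : set {mpoly R[n]} :=
  [set p | p \is ishomog1 m (mdeg (n := n))].

Definition Pmx (m a b : nat) : set 'M[{mpoly R[n]}]_(a, b) :=
  [set A | forall i j, Ppoly m (A i j)].

Definition Hmx (m a b : nat) : set 'M[{mpoly R[n]}]_(a, b) :=
  [set A | forall i j, Hpoly m (A i j)].

Definition symmx (a : nat) : set 'M[{mpoly R[n]}]_a := [set A | A^T = A].

Definition skewmx (a : nat) : set 'M[{mpoly R[n]}]_a := [set A | A^T = - A].

Definition div (q : 'cV[{mpoly R[n]}]_n) : {mpoly R[n]} :=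
  \sum_i mderiv i (q i 0).

Definition divmx (A : 'M[{mpoly R[n]}]_n) : 'cV[{mpoly R[n]}]_n :=
  \col_i div (row i A)^T.

Definition ND (m : nat) : set 'cV[{mpoly R[n]}]_n :=
  [set q | exists a B, [/\ Pmx m a, Hmx m B, skewmx B & q = a + B *m xvec]].

(* P_k(K; sym) + x x^T H_(k-1); the sum is direct, by degree *)
Definition Vminus (k : nat) : set 'M[{mpoly R[n]}]_n :=
  [set tau | exists A h, [/\ Pmx k A, symmx A, Hpoly (k - 1) h &
                          tau = A + h *: (xvec *m xvec^T)]].

(* Dimensions are over R, which acts on {mpoly R[n]}-modules through the      *)
(* constant polynomials.                                                      *)
Definition has_dim (U : lmodType {mpoly R[n]}) (Q : set U) (m : nat) : Prop :=
  exists b : 'I_m -> U,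
    (forall c : 'I_m -> R,
        \sum_i mpolyC n (c i) *: b i = 0 -> forall i, c i = 0) /\
    (forall u, Q u <-> exists c : 'I_m -> R, u = \sum_i mpolyC n (c i) *: b i).

(* 0 when Q is not a finite-dimensional real vector space *)
Definition rdim (U : lmodType {mpoly R[n]}) (Q : set U) : nat :=
  xget 0%N [set m | has_dim Q m].

Definition dimP (Q : set {mpoly R[n]}) : nat := rdim (U := {mpoly R[n]}^o) Q.

End Polynomials.

Section Simplices.
Variables (R : realType) (d : nat).

(* Lebesgue integral over {t in R^s | t_i >= 0, t_1 + ... + t_s <= a}, as an  *)
(* iterated integral                                                          *)
Fixpoint std_int (s : nat) : R -> ('cV[R]_s -> R) -> R :=
  match s with
  | 0 => fun _ f => f 0
  | s'.+1 => fun a f =>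
      \int[lebesgue_measure]_(t in `[0, a])
        std_int (a - t) (fun y : 'cV[R]_s' => f (col_mx (t%:M : 'M[R]_1) y))
  end.

Definition edges (s : nat) (w : 'I_s.+1 -> 'cV[R]_d) : 'M[R]_(d, s) :=
  \matrix_(i, j) (w (lift ord0 j) i 0 - w ord0 i 0).

(* Integral over the s-simplex with vertices w for the s-dimensional surface  *)
(* measure: pull-back to the standard simplex by an affine map, whose         *)
(* Jacobian is the square root of the Gram determinant of the edges.          *)
Definition simplex_int (s : nat) (w : 'I_s.+1 -> 'cV[R]_d) (f : 'cV[R]_d -> R) : R :=
  Num.sqrt (\det ((edges w)^T *m edges w)) *
  std_int 1 (fun t => f (w ord0 + edges w *m t)).

Definition conv_hull (s : nat) (w : 'I_s.+1 -> 'cV[R]_d) : set 'cV[R]_d :=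
  [set x | exists l : 'I_s.+1 -> R,
      [/\ forall i, 0 <= l i, \sum_i l i = 1 & x = \sum_i l i *: w i]].

(* A face of the simplex with vertices v is given by the indices of its       *)
(* vertices.                                                                  *)
Definition is_face (r : nat) (S : {set 'I_d.+1}) : bool := #|S| == (d - r).+1.

Definition face (v : 'I_d.+1 -> 'cV[R]_d) (r : nat) (S : {set 'I_d.+1}) :
    'I_(d - r).+1 -> 'cV[R]_d :=
  fun i => v (nth ord0 (enum S) i).

(* The columns of N are an orthonormal basis of the orthogonal complement of  *)
(* the tangent space of the simplex with vertices w.                          *)
Definition normal_frame (s r : nat) (w : 'I_s.+1 -> 'cV[R]_d) (N : 'M[R]_(d, r)) :
    Prop :=
  N^T *m N = 1%:M /\
  forall u : 'cV[R]_d,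
    (edges w)^T *m u = 0 <-> exists c : 'cV[R]_r, u = N *m c.

(* y |-> o + T y is an isometry of R^s onto the affine hull of w.             *)
Definition cartesian_frame (s : nat) (w : 'I_s.+1 -> 'cV[R]_d)
    (o : 'cV[R]_d) (T : 'M[R]_(d, s)) : Prop :=
  [/\ T^T *m T = 1%:M,
      forall u : 'cV[R]_d,
        (exists c : 'cV[R]_s, u = edges w *m c) <->
        (exists c : 'cV[R]_s, u = T *m c)
    & exists c : 'cV[R]_s, o = w ord0 + edges w *m c].

(* the Cartesian coordinates of x in the frame (o, T) *)
Definition coords (s : nat) (o : 'cV[R]_d) (T : 'M[R]_(d, s)) (x : 'cV[R]_d) :
    'cV[R]_s :=
  T^T *m (x - o).

Definition frobdot (m l : nat) (A B : 'M[R]_(m, l)) : R := \tr (A^T *m B).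

Variable v : 'I_d.+1 -> 'cV[R]_d.

Definition inK (p q : {mpoly R[d]}) : R := simplex_int v (fun x => ev p x * ev q x).

Definition inKmx (m l : nat) (A B : 'M[{mpoly R[d]}]_(m, l)) : R :=
  simplex_int v (fun x => frobdot (evmx A x) (evmx B x)).

(* P_m / P_1, as an L^2(K)-orthogonal complement *)
Definition Pquot (m : nat) : set {mpoly R[d]} :=
  [set q | Ppoly m q /\ forall p, Ppoly 1 p -> inK q p = 0].

(* (P_m(K; skew) / P_0(K; skew)) x, likewise *)
Definition PKxquot (m : nat) : set 'cV[{mpoly R[d]}]_d :=
  [set q | (exists B, [/\ Pmx m B, skewmx B & q = B *m xvec R d]) /\
           forall C, Pmx 0 C -> skewmx C -> inKmx q (C *m xvec R d) = 0].

Definition kerx (m : nat) : set 'M[{mpoly R[d]}]_d :=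
  [set q | [/\ Pmx m q, symmx q & q *m xvec R d = 0]].

End Simplices.

Arguments face [R d] v r S _.

(* Main.v *)
From HB Require Import structures.
Require Import Defs.
From mathcomp Require Import all_boot all_order all_algebra.
From mathcomp Require Import all_classical all_reals all_analysis.
From mathcomp Require Import ring lra zify.
From mathcomp.multinomials Require ssrcomplements.
Import Order.TTheory GRing.Theory Num.Theory.

Set Implicit Arguments.
Unset Strict Implicit.
Unset Printing Implicit Defensive.

Local Open Scope classical_set_scope.
Local Open Scope ring_scope.

(** Dimension count: the element and all the spaces of test functions are
    kernels or images of a few linear maps between polynomial spaces (exactness
    of the Koszul complex, and u |-> symgrad u x), and the count reduces
    to Vandermonde's convolution.

    Vanishing: by induction on the dimension of a face e, [n_i^T tau n_j] vanishes
    on e, because it vanishes on the boundary of e, is therefore a multiple of the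
    product of the barycentric coordinates, and can be tested against the cofactor
    (on e the factor [x x^T] costs no degree, as [n . x] is constant there).  On a
    facet the field [Pi_F tau n] thus has vanishing normal component on the
    boundary; it is orthogonal to gradients of polynomials, hence divergence free,
    hence orthogonal to all gradients, and with the remaining moments to all of
    P_(k-1): it vanishes.  The same argument in K, applied to [div tau], shows
    first [div div tau = 0], which kills the [x x^T] part, and then [div tau = 0].
    Finally tau is orthogonal to symmetric gradients and to [ker (. x)], which
    together span P_(k-2)(K; S), and as [tau n = 0] on the boundary the mixed
    components of tau in the barycentric frame are divisible by products of two
    barycentric coordinates, so that tau = 0.

    Integrals of polynomials over the standard simplex are given by Dirichlet's
    formula, which makes integration by parts a purely algebraic identity. *)

(** * Polynomials: degrees, diagonal operators, the Euler operator *)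

Local Notation "''Y_' i" := (mpolyX _ (mnm1 i)) (at level 8, i at level 2).

(** The quotients in the two interior families lose no information. The omitted tests of div div tau
    are the p in P_1, and (div div tau, p) = -(div tau, grad p) with grad p constant; the omitted
    tests of div tau are P_0(K; skew) x. Both lead to fields in [ND 0], the infinitesimal rigid
    motions, which form the kernel of [symgrad]. Once tau n = 0 on the boundary, Green's formula
    turns (div tau, u) into -(tau, symgrad u), which is zero for such u. The degrees fit for the
    following reason. The normal components of a field of degree m + 1 are divisible by barycentric
    coordinates, so the natural test field has degree m, and P_m splits as grad P_(m+1) +
    P_(m-1)(skew) x. On a facet the trace has degree k: ND_(k-2) contains the gradient of its
    divergence and all of P_(k-2)(skew) x, which is what remains to be tested. The field x x^T h is
    seen by div div alone: it contributes a nonzero multiple of h, of degree k - 1, while P_k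
    contributes only degree k - 2. *)

Section Poly.
Variables (R : realType) (n : nat).
Implicit Types (p q : {mpoly R[n]}) (m : multinom n).

Lemma eq_on_monomials (V : lmodType R) (f g : {mpoly R[n]} -> V) : linear f -> linear g ->
  (forall m, f (mpolyX R m) = g (mpolyX R m)) -> f =1 g.
Proof.
move=> fl gl e.
have z (h : {mpoly R[n]} -> V) : linear h -> h 0 = 0.
  by move=> hl; have := hl (-1) 0 0; rewrite scaler0 addr0 scaleN1r addNr.
by elim/mpolyind => [|c m p _ _ IH]; rewrite ?z // fl gl e IH.
Qed.

Lemma eq_on_monomials_scalar (f g : {mpoly R[n]} -> R) : scalar f -> scalar g ->
  (forall m, f (mpolyX R m) = g (mpolyX R m)) -> f =1 g.
Proof. exact: (@eq_on_monomials R^o). Qed.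

Lemma msizeM_bound p q a b :
  (msize p <= a.+1)%N -> (msize q <= b.+1)%N -> (msize (p * q) <= (a + b).+1)%N.
Proof.
have [->|p0] := eqVneq p 0; first by rewrite mul0r mmeasure0.
have [->|q0] := eqVneq q 0; first by rewrite mulr0 mmeasure0.
move=> pa qb; rewrite msizeM // -subn1 leq_subLR; apply: leq_trans (leq_add pa qb) _.
by rewrite addSn addnS.
Qed.

Lemma msizeD_bound p q a :
  (msize p <= a)%N -> (msize q <= a)%N -> (msize (p + q) <= a)%N.
Proof. by move=> pa qa; apply: leq_trans (mmeasureD_le _ _ _) _; rewrite geq_max pa. Qed.

Lemma msizeB_bound p q a :
  (msize p <= a)%N -> (msize q <= a)%N -> (msize (p - q) <= a)%N.
Proof. by move=> pa qa; apply: msizeD_bound => //; rewrite mmeasureN. Qed.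

Lemma msize_sum_bound I (r : seq I) (P : pred I) (F : I -> {mpoly R[n]}) a :
  (forall i, P i -> (msize (F i) <= a)%N) -> (msize (\sum_(i <- r | P i) F i) <= a)%N.
Proof.
move=> H; elim/big_ind: _ => [|x y|//]; first by rewrite mmeasure0.
exact: msizeD_bound.
Qed.

Lemma msizeZ_bound c p a : (msize p <= a)%N -> (msize (c *: p) <= a)%N.
Proof. by move=> h; apply: leq_trans h; apply: msizeZ_le. Qed.

Lemma msizeC_bound (c : R) a : (msize (mpolyC n c) <= a.+1)%N.
Proof. by rewrite mmeasureC; case: (c != 0). Qed.

Lemma msizeXU i : msize ('Y_i : {mpoly R[n]}) = 2.
Proof. by rewrite msizeX mdeg1. Qed.

Lemma msizeXM i p a : (msize p <= a)%N -> (msize ('Y_i * p) <= a.+1)%N.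
Proof.
case: a => [|a]; last by move=> h; rewrite -[a.+1]add1n; apply: msizeM_bound; rewrite ?msizeXU.
by rewrite leqn0 msize_poly_eq0 => /eqP ->; rewrite mulr0 mmeasure0.
Qed.

Lemma msize_leP p a : reflect (forall m, (a <= mdeg m)%N -> mcoeff m p = 0) (msize p <= a)%N.
Proof.
apply: (iffP idP) => [h m am|h].
  by apply: memN_msupp_eq0; apply: msize_mdeg_ge; apply: leq_trans am.
rewrite msizeE; apply/bigmax_leqP_seq => m mp _.
rewrite ltnNge; apply/negP => /h e; by move: mp; rewrite mcoeff_msupp e eqxx.
Qed.

Lemma msize_mderiv i p a : (msize p <= a.+1)%N -> (msize (mderiv i p) <= a)%N.
Proof.
move=> /msize_leP h; apply/msize_leP => m am.
by rewrite mcoeff_deriv h ?mul0rn // mdegD mdeg1 addn1.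
Qed.

(** Integrals over the simplex and over its slanted facet are functionals of this kind, given by
    their values on monomials. *)
Definition plin (w : multinom n -> R) p : R := \sum_(m <- msupp p) w m * mcoeff m p.

Lemma plinE w p a : (msize p <= a)%N -> plin w p = \sum_(m : bmultinom n a) w m * mcoeff m p.
Proof.
move=> h; set I : subFinType _ := bmultinom n a.
rewrite /plin (ssrcomplements.big_mksub I) ?msupp_uniq //=; last first.
  by move=> x /msize_mdeg_lt /leq_trans; apply.
by rewrite big_rmcond //= => j /memN_msupp_eq0 ->; rewrite mulr0.
Qed.

Fact plin_is_scalar w : scalar (plin w).
Proof.
move=> c p q; set a := maxn (maxn (msize p) (msize q)) (msize (c *: p + q)).
rewrite !(@plinE _ _ a) ?leq_max ?leqnn ?orbT //.
rewrite mulr_sumr -big_split; apply: eq_bigr => m _ /=.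
by rewrite mcoeffD mcoeffZ; ring.
Qed.
HB.instance Definition _ w :=
  GRing.isLinear.Build R {mpoly R[n]} R _ (plin w) (plin_is_scalar w).

Lemma plinX w m : plin w (mpolyX R m) = w m.
Proof. by rewrite /plin msuppX big_seq1 mcoeffX eqxx mulr1. Qed.

Definition pdiag (w : multinom n -> R) p : {mpoly R[n]} :=
  \sum_(m <- msupp p) (w m * mcoeff m p) *: mpolyX R m.

Lemma mcoeff_pdiag w p m : mcoeff m (pdiag w p) = w m * mcoeff m p.
Proof.
rewrite /pdiag raddf_sum /=.
under eq_bigr do rewrite mcoeffZ mcoeffX.
have [mp|mp] := boolP (m \in msupp p).
  rewrite (bigD1_seq m) ?msupp_uniq //= eqxx mulr1 big1 ?addr0 // => k /negPf ->.
  by rewrite mulr0.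
rewrite (memN_msupp_eq0 mp) mulr0 big_seq big1 // => k kp.
by case: eqP => [e|_]; rewrite ?mulr0 //; rewrite -e kp in mp.
Qed.

Fact pdiag_is_linear w : linear (pdiag w).
Proof.
by move=> c p q; apply/mpolyP => m; rewrite mcoeffD mcoeffZ !mcoeff_pdiag mcoeffD mcoeffZ; ring.
Qed.
HB.instance Definition _ w :=
  GRing.isLinear.Build R {mpoly R[n]} {mpoly R[n]} _ (pdiag w) (pdiag_is_linear w).

Lemma pdiagX w m : pdiag w (mpolyX R m) = w m *: mpolyX R m.
Proof. by rewrite /pdiag msuppX big_seq1 mcoeffX eqxx mulr1. Qed.

Lemma msize_pdiag w p a : (msize p <= a)%N -> (msize (pdiag w p) <= a)%N.
Proof. by move=> /msize_leP h; apply/msize_leP => m am; rewrite mcoeff_pdiag h ?mulr0. Qed.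

Definition euler p : {mpoly R[n]} := \sum_i 'Y_i * mderiv i p.
(** The inverse of [euler] + c for c > 0, since [euler] multiplies the part of degree j by j. *)
Definition einv (c : nat) := pdiag (fun m => (mdeg m + c)%:R^-1).
HB.instance Definition _ c := GRing.Linear.on (einv c).

Lemma mulX_mderivX i m : 'Y_i * mderiv i (mpolyX R m) = (m i)%:R *: mpolyX R m.
Proof.
rewrite mderivX -scalerAr -mpolyXD.
have [->|mi] := eqVneq (m i) 0%N; first by rewrite !scale0r.
by rewrite addmC submK // lep1mP.
Qed.

Lemma eulerE : euler =1 pdiag (fun m => (mdeg m)%:R).
Proof.
move=> p; pose f : mpoly n R -> mpoly n R := @euler.
have fl : linear f.
  move=> c a b; rewrite /f /euler scaler_sumr -big_split; apply: eq_bigr => i _ /=.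
  by rewrite linearP mulrDr scalerAr.
apply: (eq_on_monomials fl (linearP (pdiag _))) => m /=.
rewrite /f /euler pdiagX mdegE natr_sum scaler_suml; apply: eq_bigr => i _.
by rewrite mulX_mderivX.
Qed.

Lemma mcoeff_euler m p : mcoeff m (euler p) = (mdeg m)%:R * mcoeff m p.
Proof. by rewrite eulerE mcoeff_pdiag. Qed.

Lemma eulerM p q : euler (p * q) = euler p * q + p * euler q.
Proof.
rewrite /euler mulr_suml mulr_sumr -big_split; apply: eq_bigr => i _ /=.
by rewrite mderivM; ring.
Qed.

Lemma euler_sum I (r : seq I) (P : pred I) (F : I -> {mpoly R[n]}) :
  euler (\sum_(i <- r | P i) F i) = \sum_(i <- r | P i) euler (F i).
Proof. by rewrite eulerE raddf_sum; apply: eq_bigr => i _; rewrite /= -eulerE. Qed.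

Lemma mderivXU i j : mderiv i ('Y_j : {mpoly R[n]}) = (i == j)%:R.
Proof.
rewrite mderivX mnm1E eq_sym; case: eqP => [->|_]; last by rewrite scale0r.
rewrite scale1r (_ : mnm_sub _ _ = mnm0) ?mpolyX0 //.
by apply/mnmP => k; rewrite mnmBE mnm0E subnn.
Qed.

Lemma eulerX i : euler 'Y_i = 'Y_i.
Proof.
rewrite /euler (bigD1 i) //= mderivXU eqxx mulr1 big1 ?addr0 // => j /negPf e.
by rewrite mderivXU e mulr0.
Qed.

Lemma euler_einv c p : (0 < c)%N -> euler (einv c p) + c%:R *: einv c p = p.
Proof.
move=> c0; apply/mpolyP => m.
rewrite mcoeffD mcoeffZ mcoeff_euler mcoeff_pdiag -mulrDl -natrD mulrA mulfV ?mul1r //.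
by rewrite pnatr_eq0; lia.
Qed.

Lemma euler_eq0 p : euler p = 0 -> p = mpolyC n (mcoeff mnm0 p).
Proof.
move=> e; apply/mpolyP => m; rewrite mcoeffC.
have [->|m0] := eqVneq m mnm0; first by rewrite mulr1.
rewrite mulr0; move/(congr1 (mcoeff m)): e.
rewrite mcoeff_euler mcoeff0 => /eqP; rewrite mulf_eq0 pnatr_eq0 mdeg_eq0 (negPf m0) /=.
by move/eqP.
Qed.

(** Taylor's formula along rays, p(x) - p(0) = int_0^1 x . (grad p)(t x) dt: on the part of degree j
    the integral in t divides by j + 1, which is [einv 1]. *)
Lemma sum_mulX_einv_mderiv p :
  \sum_i 'Y_i * einv 1 (mderiv i p) = p - mpolyC n (mcoeff mnm0 p).
Proof.
pose f p : {mpoly R[n]} := \sum_i 'Y_i * einv 1 (mderiv i p).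
have fl : linear f.
  move=> c a b; rewrite /f scaler_sumr -big_split; apply: eq_bigr => i _ /=.
  by rewrite !linearP mulrDr scalerAr.
pose g p : {mpoly R[n]} := p - mpolyC n (mcoeff mnm0 p).
have gl : linear g.
  move=> c a b; rewrite /g mcoeffD mcoeffZ mpolyCD mpolyCM mul_mpolyC scalerBr.
  by rewrite opprD addrACA.
apply: (eq_on_monomials fl gl) => m.
rewrite /f /g mcoeffX; have [->|m0] := eqVneq m mnm0.
  rewrite mpolyX0 mpolyC1 subrr big1 // => i _.
  by rewrite -mpolyC1 mderivC raddf0 mulr0.
rewrite mpolyC0 subr0; have d0 : (mdeg m)%:R != 0 :> R by rewrite pnatr_eq0 mdeg_eq0.
apply: (scalerI d0); rewrite scaler_sumr [in RHS]mdegE natr_sum scaler_suml.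
apply: eq_bigr => i _; rewrite mderivX linearZ /= /einv pdiagX -!scalerAr -mpolyXD.
have [->|mi] := eqVneq (m i) 0%N; first by rewrite !scale0r scaler0.
rewrite addmC submK ?lep1mP // !scalerA; congr (_ *: _).
have -> : (mdeg (mnm_sub m (mnm1 i)) + 1)%N = mdeg m.
  by rewrite -(mdeg1 i) -mdegD submK ?lep1mP.
by field.
Qed.

End Poly.

(** * Integration over the standard simplex *)

Section PolyInt.
Import numFieldNormedType.Exports.
Variable R : realType.
Implicit Types (G H : {poly R}) (a : R).

Lemma Rintegral_horner_deriv H a : 0 <= a ->
  \int[lebesgue_measure]_(t in `[0, a]) H^`().[t] = H.[a] - H.[0].
Proof.
rewrite le_eqVlt => /predU1P[<-|a0]; first by rewrite set_itv1 Rintegral_set1 subrr.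
have cH (P : {poly R}) : continuous (horner P).
  by move=> x; apply/differentiable_continuous/derivable1_diffP/derivable_horner.
rewrite /Rintegral (@continuous_FTC2 _ (horner H^`()) (horner H)) //.
- by apply: continuous_subspaceT; exact: cH.
- split; first by move=> x _; exact: derivable_horner.
  + by apply: cvg_at_right_filter; exact: cH.
  + by apply: cvg_at_left_filter; exact: cH.
- by move=> x _; rewrite derivE.
Qed.

Definition antideriv G : {poly R} := \poly_(i < (size G).+1) (G`_i.-1 / i%:R *+ (i != 0%N)).

Lemma antiderivK G : (antideriv G)^`() = G.
Proof.
apply/polyP => i; rewrite coef_deriv coef_poly ltnS.
case: ltnP => [iG|Gi]; last by rewrite mul0rn nth_default.
by rewrite /= mulr1n -[_ *+ i.+1]mulr_natr -mulrA mulVf ?mulr1 // pnatr_eq0.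
Qed.

Lemma Rintegral_horner G a : 0 <= a ->
  \int[lebesgue_measure]_(t in `[0, a]) G.[t] = (antideriv G).[a] - (antideriv G).[0].
Proof. by move=> a0; rewrite -[in LHS](antiderivK G) Rintegral_horner_deriv. Qed.

Lemma poly_eq0_on_itv G a : 0 < a -> (forall t, 0 <= t < a -> G.[t] = 0) -> G = 0.
Proof.
move=> a0 G0; apply/eqP; apply/negPn/negP => Gn0.
(* [size G] equally spaced roots in [0, a), one more than the degree of a nonzero G allows. *)
pose s := [seq a * (i%:R / (size G).+1%:R) | i <- iota 0 (size G)].
have us : uniq s.
  rewrite map_inj_uniq ?iota_uniq // => i j /(mulfI (lt0r_neq0 a0)).
  move=> /(mulIf _) /eqP; rewrite invr_eq0 pnatr_eq0 eqr_nat => /(_ isT) /eqP //.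
have rs : all (root G) s.
  apply/allP => x /mapP[i]; rewrite mem_iota /= add0n => iG ->.
  apply/rootP/G0; rewrite mulr_ge0 ?divr_ge0 ?ler0n ?(ltW a0) //=.
  by rewrite gtr_pMr // ltr_pdivrMr ?ltr0n // mul1r ltr_nat ltnS ltnW.
by have := max_poly_roots Gn0 rs us; rewrite size_map size_iota ltnn.
Qed.

(** An antiderivative is nondecreasing on [0, a] with equal end values, hence constant. *)
Lemma Rintegral_horner_eq0 G a : 0 < a -> (forall t, 0 <= t <= a -> 0 <= G.[t]) ->
  \int[lebesgue_measure]_(t in `[0, a]) G.[t] = 0 -> G = 0.
Proof.
move=> a0 Gge0; rewrite Rintegral_horner ?ltW // => /eqP; rewrite subr_eq0 => /eqP Ha0.
set H := antideriv G in Ha0.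
have cH : continuous (horner H).
  by move=> x; apply/differentiable_continuous/derivable1_diffP/derivable_horner.
have dH : forall t, t \in `]0, a[ -> derivable (horner H) t 1.
  by move=> t _; exact: derivable_horner.
have d0 : forall t, t \in `]0, a[ -> 0 <= (horner H)^`()%classic t.
  move=> t; rewrite in_itv /= -derivE antiderivK => /andP[/ltW t0 /ltW ta].
  by apply: Gge0; rewrite t0.
have Hmono := ger0_derive1_ndecr dH d0 (continuous_subspaceT cH).
have : H - H.[0]%:P = 0.
  apply: (poly_eq0_on_itv a0) => t /andP[t0 /ltW ta].
  rewrite !hornerE; apply/eqP; rewrite subr_eq0 eq_le [X in _ && X]Hmono // andbT.
  by rewrite -Ha0 Hmono.
by move/(congr1 deriv); rewrite derivB derivC subr0 deriv0 antiderivK.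
Qed.

(** Euler's Beta integral. The induction integrates by parts: X^(m+1) (a - X)^(n+1) vanishes at both
    ends, so the integral of its derivative is zero. *)
Lemma Rintegral_beta a m n : 0 <= a ->
  \int[lebesgue_measure]_(t in `[0, a]) ('X^m * (a%:P - 'X) ^+ n).[t] =
  a ^+ (m + n).+1 * (m`! * n`!)%:R / (m + n).+1`!%:R.
Proof.
move=> a0; elim: m n => [|m IH] n.
  rewrite expr0 mul1r fact0 mul1n add0n.
  have -> : (a%:P - 'X) ^+ n = (- (n.+1%:R^-1 *: (a%:P - 'X) ^+ n.+1))^`().
    rewrite derivN derivZ deriv_exp derivB derivC derivX sub0r mulN1r /=.
    by rewrite mulNrn scalerN opprK -[X in _ *: X]scaler_nat scalerA mulVf ?scale1r // pnatr_eq0.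
  rewrite Rintegral_horner_deriv // !hornerE subrr subr0 expr0n /= mulr0 oppr0 sub0r opprK.
  rewrite factS natrM; field.
  by rewrite nat1r !pnatr_eq0 -!lt0n fact_gt0.
set P1 : {poly R} := 'X^(m.+1) * (a%:P - 'X) ^+ n; set P2 : {poly R} := 'X^m * (a%:P - 'X) ^+ n.+1.
have e : ('X^(m.+1) * (a%:P - 'X) ^+ n.+1)^`() = m.+1%:R *: P2 - n.+1%:R *: P1.
  rewrite derivM derivXn deriv_exp derivB derivC derivX sub0r mulN1r /= mulNrn mulrN.
  by rewrite !scaler_nat mulrnAl mulrnAr.
have := Rintegral_horner_deriv ('X^(m.+1) * (a%:P - 'X) ^+ n.+1) a0.
rewrite e -{1}[P2]antiderivK -{1}[P1]antiderivK -!derivZ -derivB Rintegral_horner_deriv //.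
rewrite !hornerE subrr !expr0n /= mulr0 mul0r subr0 => e2.
have := IH n.+1; rewrite !Rintegral_horner // -/P2 => IH2.
have n0 : n.+1%:R != 0 :> R by rewrite pnatr_eq0.
apply: (mulfI n0).
transitivity (m.+1%:R * ((antideriv P2).[a] - (antideriv P2).[0])); first by lra.
rewrite IH2 -addSnnS; set N := (m.+1 + n).+1.
have : N`!%:R != 0 :> R by rewrite pnatr_eq0 -lt0n fact_gt0.
by move: N (N`!%:R) => N f f0; rewrite !factS !natrM; field.
Qed.

End PolyInt.

(** * Dirichlet's formula and the divergence theorem on the standard simplex *)

Section StdInt.
Variable R : realType.

Lemma Rintegral_horner_sum I (r : seq I) (c : I -> R) (G : I -> {poly R}) a : 0 <= a ->
  \int[lebesgue_measure]_(t in `[0, a]) (\sum_(i <- r) c i *: G i).[t] =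
  \sum_(i <- r) c i * \int[lebesgue_measure]_(t in `[0, a]) (G i).[t].
Proof.
move=> a0; pose H := \sum_(i <- r) c i *: antideriv (G i).
have <- : H^`() = \sum_(i <- r) c i *: G i.
  by rewrite /H raddf_sum; apply: eq_bigr => i _ /=; rewrite derivZ antiderivK.
rewrite Rintegral_horner_deriv // /H !horner_sum -sumrB; apply: eq_bigr => i _.
by rewrite Rintegral_horner // !hornerZ mulrBr.
Qed.

Definition mtail s (m : multinom s.+1) : multinom s := Multinom [tuple m (lift ord0 i) | i < s].

Lemma mdeg_mtail s (m : multinom s.+1) : mdeg m = (m ord0 + mdeg (mtail m))%N.
Proof.
rewrite !mdegE big_ord_recl; congr addn; apply: eq_bigr => i _.
by rewrite multinomE tnth_mktuple.
Qed.

Lemma mtail_inj s (m m' : multinom s.+1) : m ord0 = m' ord0 -> mtail m = mtail m' -> m = m'.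
Proof.
move=> e0 e; apply/mnmP => i; case: (unliftP ord0 i) => [j|] -> //.
by move/mnmP: e => /(_ j); rewrite !multinomE !tnth_mktuple.
Qed.

Lemma col_mx_hd s (t : R) (y : 'cV[R]_s) : col_mx (t%:M : 'M[R]_1) y (ord0 : 'I_s.+1) 0 = t.
Proof.
by rewrite (_ : (ord0 : 'I_s.+1) = lshift s (ord0 : 'I_1)) ?col_mxEu ?mxE //; apply/val_inj.
Qed.

Lemma col_mx_tl s (t : R) (y : 'cV[R]_s) i :
  col_mx (t%:M : 'M[R]_1) y (lift ord0 i : 'I_s.+1) 0 = y i 0.
Proof. by rewrite (_ : lift ord0 i = rshift 1 i) ?col_mxEd //; apply/val_inj. Qed.

Definition slice s (t : R) (p : {mpoly R[s.+1]}) : {mpoly R[s]} :=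
  \sum_(m <- msupp p) (mcoeff m p * t ^+ m ord0) *: mpolyX R (mtail m).

Lemma ev_slice s t (p : {mpoly R[s.+1]}) y :
  ev (slice t p) y = ev p (col_mx (t%:M : 'M[R]_1) y).
Proof.
rewrite /ev [RHS]mevalE /slice raddf_sum /=; apply: eq_bigr => m _.
rewrite mevalZ mevalX -mulrA; congr (_ * _); rewrite big_ord_recl; congr (_ * _).
  by rewrite col_mx_hd.
by apply: eq_bigr => i _; rewrite multinomE tnth_mktuple col_mx_tl.
Qed.

(** Dirichlet's value for the integral of the monomial m over the standard simplex of size 1. *)
Definition dirichlet s (m : multinom s) : R := (\prod_i (m i)`!)%:R / (s + mdeg m)`!%:R.

(** The slice at height t is a simplex of size a - t, where homogeneity gives the power (a - t)^(s +
    |tail|); a Beta integral in t then adds one dimension. *)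
Lemma dirichletS s (m : multinom s.+1) a : 0 <= a ->
  \int[lebesgue_measure]_(t in `[0, a])
     ('X^(m ord0) * (a%:P - 'X) ^+ (s + mdeg (mtail m))).[t] * dirichlet (mtail m) =
  a ^+ (s.+1 + mdeg m) * dirichlet m.
Proof.
move=> a0; rewrite Rintegral_beta // /dirichlet mdeg_mtail big_ord_recl.
have -> : (s.+1 + (m ord0 + mdeg (mtail m)) = (m ord0 + (s + mdeg (mtail m))).+1)%N by lia.
under [in RHS]eq_bigr do rewrite -[m _](tnth_mktuple (fun i => m (lift ord0 i))) -multinomE.
rewrite -/(mtail m) !natrM.
have : (s + mdeg (mtail m))`!%:R != 0 :> R by rewrite pnatr_eq0 -lt0n fact_gt0.
have aux (b P Q F G : R) : F != 0 -> b * (P * F) / G * (Q / F) = b * (P * Q / G).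
  by move=> F0; rewrite -!mulrA [F * _]mulrC -!mulrA mulVf // mulr1 [G^-1 * _]mulrC.
by apply: aux; rewrite pnatr_eq0 -lt0n fact_gt0.
Qed.

Lemma std_int_ev s a (p : {mpoly R[s]}) : 0 <= a ->
  std_int a (ev p) = plin (fun m => a ^+ (s + mdeg m) * dirichlet m) p.
Proof.
elim: s a p => [|s IH] a p a0 /=.
  rewrite {2}(nvar0_mpolyC p) -alg_mpolyC -mpolyX0 linearZ /= plinX mdeg0 expr0 /dirichlet big_ord0.
  rewrite mdeg0 fact0 divr1 mul1r mulr1.
  by rewrite {1}(nvar0_mpolyC p) /ev mevalC.
pose G : {poly R} := \sum_(m <- msupp p)
  (mcoeff m p * dirichlet (mtail m)) *: ('X^(m ord0) * (a%:P - 'X) ^+ (s + mdeg (mtail m))).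
transitivity (\int[lebesgue_measure]_(t in `[0, a]) G.[t]).
  apply: eq_Rintegral => t; rewrite inE /= in_itv /= => /andP[t0 ta].
  under (eq_fun) do rewrite -ev_slice.
  rewrite -/(ev _) IH ?subr_ge0 // /slice raddf_sum /G horner_sum; apply: eq_bigr => m _ /=.
  by rewrite linearZ /= plinX !(hornerZ, hornerM, hornerXn, horner_exp, hornerD, hornerN, hornerC, hornerX); ring.
rewrite Rintegral_horner_sum // /plin; apply: eq_bigr => m _.
by rewrite -dirichletS //; ring.
Qed.

Definition std_pts s (a : R) (y : 'cV[R]_s) := (forall i, 0 <= y i 0) /\ \sum_i y i 0 <= a.

(** Collecting the terms with a given tail gives a univariate polynomial in t that vanishes on an
    interval. *)
Lemma slice_eq0 s (p : {mpoly R[s.+1]}) a : 0 < a ->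
  (forall t, 0 <= t < a -> slice t p = 0) -> p = 0.
Proof.
move=> a0 H; apply/mpolyP => m; rewrite mcoeff0.
pose c : {poly R} := \sum_(k <- msupp p | mtail k == mtail m) mcoeff k p *: 'X^(k ord0).
have c0 : c = 0.
  apply: (poly_eq0_on_itv a0) => t /H /(congr1 (mcoeff (mtail m))).
  rewrite mcoeff0 /slice raddf_sum /= /c horner_sum => {2}<-; rewrite [LHS]big_mkcond.
  apply: eq_bigr => k _; rewrite mcoeffZ mcoeffX.
  by case: eqP => _; rewrite ?mulr0 ?mulr1 // hornerZ hornerXn.
have [mp|] := boolP (m \in msupp p); last exact: memN_msupp_eq0.
move: c0 => /(congr1 (fun q : {poly R} => q`_(m ord0))); rewrite coef0 /c coef_sum.
rewrite big_mkcond (bigD1_seq m) ?msupp_uniq //= eqxx big1 ?addr0.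
  by rewrite coefZ coefXn eqxx mulr1.
move=> k km; case: eqP => // e; rewrite coefZ coefXn.
case: eqP => [e0|_]; last by rewrite mulr0.
by rewrite (mtail_inj (esym e0) e) eqxx in km.
Qed.

Lemma std_pts_col s a t (y : 'cV[R]_s) : 0 <= t -> std_pts (a - t) y ->
  std_pts a (col_mx (t%:M : 'M[R]_1) y).
Proof.
move=> t0 [y0 ys]; split=> [i|].
  by case: (unliftP ord0 i) => [j|] ->; rewrite ?col_mx_tl ?col_mx_hd.
rewrite big_ord_recl col_mx_hd -lerBrDl; apply: le_trans ys.
by under eq_bigr do rewrite col_mx_tl.
Qed.

Lemma std_int_ge0 s a (p : {mpoly R[s]}) : 0 <= a ->
  (forall y, std_pts a y -> 0 <= ev p y) -> 0 <= std_int a (ev p).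
Proof.
elim: s a p => [|s IH] a p a0 H /=.
  by apply: H; split=> [i|]; rewrite ?mxE // big_ord0.
apply: Rintegral_ge0 => t /=; rewrite in_itv /= => /andP[t0 ta].
under (eq_fun) do rewrite -ev_slice.
apply: IH => [|y yt]; first by rewrite subr_ge0.
by rewrite ev_slice; apply/H/std_pts_col.
Qed.

(** Positivity is carried through the iterated integral: the inner integral is itself a nonnegative
    polynomial G in t, so G = 0, and the induction hypothesis annihilates every slice. *)
Lemma std_int_eq0 s a (p : {mpoly R[s]}) : 0 < a ->
  (forall y, std_pts a y -> 0 <= ev p y) -> std_int a (ev p) = 0 -> p = 0.
Proof.
elim: s a p => [|s IH] a p a0 H /=.
  by rewrite (nvar0_mpolyC p) /ev mevalC => ->; rewrite mpolyC0.
pose G : {poly R} := \sum_(m <- msupp p)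
  (mcoeff m p * dirichlet (mtail m)) *: ('X^(m ord0) * (a%:P - 'X) ^+ (s + mdeg (mtail m))).
have GE t : 0 <= t <= a -> G.[t] = std_int (a - t) (ev (slice t p)).
  move=> /andP[t0 ta].
  rewrite std_int_ev ?subr_ge0 // /slice raddf_sum /G horner_sum; apply: eq_bigr => m _ /=.
  by rewrite linearZ /= plinX !(hornerZ, hornerM, hornerXn, horner_exp, hornerD, hornerN, hornerC, hornerX); ring.
move=> e; apply: (slice_eq0 a0) => t /andP[t0 ta].
have S0 u : 0 <= u -> forall y, std_pts (a - u) y -> 0 <= ev (slice u p) y.
  by move=> u0 y yu; rewrite ev_slice; apply/H/std_pts_col.
apply: (IH (a - t)); rewrite ?subr_gt0 //; first exact: S0.
rewrite -GE ?t0 ?ltW // (_ : G = 0) ?horner0 //.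
apply: (Rintegral_horner_eq0 a0) => [u /andP[u0 ua]|].
  by rewrite GE ?u0 //; apply: std_int_ge0; [rewrite subr_ge0|exact: S0].
rewrite -[RHS]e; apply: eq_Rintegral => u; rewrite inE /= in_itv /= => /GE ->.
by congr std_int; apply/funext => y; rewrite ev_slice.
Qed.

Lemma ev_inj s (p q : {mpoly R[s]}) : (forall x, ev p x = ev q x) -> p = q.
Proof.
move=> e; apply/eqP; rewrite -subr_eq0; apply/eqP; have e0 y : ev (p - q) y = 0.
  by rewrite /ev mevalB -/(ev p y) -/(ev q y) e subrr.
apply: (@std_int_eq0 s 1) => // [y _|]; first by rewrite e0.
have -> : ev (p - q) = ev 0 by apply/funext => y; rewrite e0 /ev meval0.
by rewrite std_int_ev // raddf0.
Qed.

Definition Int s (p : {mpoly R[s]}) : R := std_int 1 (ev p).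

Lemma IntE s : @Int s =1 plin (@dirichlet s).
Proof.
move=> p; rewrite /Int std_int_ev // /plin; apply: eq_bigr => m _.
by rewrite expr1n mul1r.
Qed.

Fact Int_is_scalar s : scalar (@Int s).
Proof. by move=> c p q; rewrite !IntE linearP. Qed.
HB.instance Definition _ s :=
  GRing.isLinear.Build R {mpoly R[s]} R _ (@Int s) (@Int_is_scalar s).

(* [facet] is the integral over the facet t_1 + ... + t_s = 1, up to a factor
   independent of the integrand. *)
Definition facet_weight s (m : multinom s) : R := (\prod_i (m i)`!)%:R / (s + mdeg m).-1`!%:R.
Definition facet s : {mpoly R[s]} -> R := plin (@facet_weight s).
HB.instance Definition _ s := GRing.Linear.on (@facet s).

Lemma prod_fact_add1 s (m : multinom s) i :
  (\prod_j (mnm_add m (mnm1 i) j)`! = (m i).+1 * \prod_j (m j)`!)%N.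
Proof.
rewrite (bigD1 i) //= mnmDE mnm1E eqxx addn1 factS -mulnA; congr muln.
rewrite [RHS](bigD1 i) //=; congr muln; apply: eq_bigr => j ji.
by rewrite mnmDE mnm1E eq_sym (negPf ji) addn0.
Qed.

(** The factor Y_i kills the flux through the facet t_i = 0, so only the slanted facet
    contributes. *)
Lemma Int_mderivXM s i (p : {mpoly R[s]}) : Int (mderiv i ('Y_i * p)) = facet ('Y_i * p).
Proof.
have fl : scalar (fun p => Int (mderiv i ('Y_i * p))).
  by move=> c a b; rewrite mulrDr -scalerAr !linearP.
have gl : scalar (fun p => facet ('Y_i * p)).
  by move=> c a b; rewrite mulrDr -scalerAr /facet !linearP.
apply: (eq_on_monomials_scalar fl gl) => m /=.
rewrite -mpolyXD addmC mderivX mnmDE mnm1E eqxx addn1 addmK linearZ /= IntE /facet !plinX.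
rewrite /dirichlet /facet_weight prod_fact_add1 mdegD mdeg1 addnA addn1 /= natrM.
by rewrite mulrA.
Qed.

(** On a monomial m the factors m_i + 1 add up to s + |m|, which is the ratio of the two factorials
    involved. *)
Lemma facet_vanish s (p : {mpoly R[s]}) : (0 < s)%N -> facet ((1 - \sum_i 'Y_i) * p) = 0.
Proof.
move=> s0; have gl : scalar (fun p : {mpoly R[s]} => facet ((1 - \sum_i 'Y_i) * p)).
  by move=> c a b; rewrite mulrDr -scalerAr /facet !linearP.
have zl : scalar (fun _ : {mpoly R[s]} => 0 : R) by move=> c a b; rewrite mulr0 addr0.
apply: (eq_on_monomials_scalar gl zl) => m /=.
have E i : facet ('Y_i * mpolyX R m) =
    (m i).+1%:R * ((\prod_j (m j)`!)%:R / (s + mdeg m)`!%:R).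
  by rewrite -mpolyXD addmC /facet plinX /facet_weight prod_fact_add1 mdegD mdeg1 addnA addn1 /= natrM mulrA.
transitivity (facet (mpolyX R m) - \sum_i facet ('Y_i * mpolyX R m)).
  by rewrite mulrBl mul1r mulr_suml [LHS]raddfB; congr (_ - _); exact: raddf_sum.
rewrite (eq_bigr _ (fun i _ => E i)).
rewrite -mulr_suml /facet /= plinX.
have -> : \sum_(i < s) (m i).+1%:R = (s + mdeg m)%:R :> R.
  rewrite -natr_sum mdegE; congr _%:R.
  by under eq_bigr do rewrite -addn1; rewrite big_split /= sum1_card card_ord addnC.
rewrite /facet_weight; have -> : (s + mdeg m = (s + mdeg m).-1.+1)%N by lia.
rewrite factS natrM /=.
have aux (A N F : R) : N != 0 -> A / F - N * (A / (N * F)) = 0.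
  by move=> N0; rewrite invfM [N * _]mulrCA [N * _]mulrA mulfV // mul1r subrr.
by apply: aux; rewrite pnatr_eq0.
Qed.

(** Divergence theorem without boundary term: the first hypothesis removes the flux through the
    coordinate facets, the second the flux through the slanted one. *)
Lemma Int_div_bubble s (v : 'cV[{mpoly R[s]}]_s) (g : 'I_s -> {mpoly R[s]}) (g0 : {mpoly R[s]}) :
  (forall i, v i 0 = 'Y_i * g i) -> \sum_i v i 0 = (1 - \sum_i 'Y_i) * g0 -> Int (div v) = 0.
Proof.
case: s v g g0 => [|s] v g g0 vE v0; first by rewrite /div big_ord0 raddf0.
rewrite /div raddf_sum /=.
under eq_bigr do rewrite vE Int_mderivXM -vE.
transitivity (facet (\sum_i v i 0)); first exact/esym/raddf_sum.
by rewrite v0 facet_vanish.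
Qed.

End StdInt.

(** * Evaluation, affine substitutions, affine factors *)

Section Ev.
Variables (R : realType) (n : nat).
Implicit Types (p q : {mpoly R[n]}) (x : 'cV[R]_n).

Lemma ev0 x : ev 0 x = 0. Proof. exact: meval0. Qed.
Lemma evC c x : ev (mpolyC n c) x = c. Proof. exact: mevalC. Qed.
Lemma ev1 x : ev 1 x = 1. Proof. exact: meval1. Qed.
Lemma evD p q x : ev (p + q) x = ev p x + ev q x. Proof. exact: mevalD. Qed.
Lemma evB p q x : ev (p - q) x = ev p x - ev q x. Proof. exact: mevalB. Qed.
Lemma evM p q x : ev (p * q) x = ev p x * ev q x. Proof. exact: mevalM. Qed.
Lemma evZ c p x : ev (c *: p) x = c * ev p x. Proof. exact: mevalZ. Qed.
Lemma evX i x : ev 'Y_i x = x i 0. Proof. exact: mevalXU. Qed.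
Lemma ev_sum I (r : seq I) (P : pred I) (F : I -> {mpoly R[n]}) x :
  ev (\sum_(i <- r | P i) F i) x = \sum_(i <- r | P i) ev (F i) x.
Proof. exact: (raddf_sum (meval _)). Qed.
Lemma ev_prod I (r : seq I) (P : pred I) (F : I -> {mpoly R[n]}) x :
  ev (\prod_(i <- r | P i) F i) x = \prod_(i <- r | P i) ev (F i) x.
Proof. exact: (rmorph_prod (meval _)). Qed.

Lemma mpoly_gen_ind (P : {mpoly R[n]} -> Prop) :
  (forall c, P (mpolyC n c)) -> (forall p q, P p -> P q -> P (p + q)) ->
  (forall i p, P p -> P ('Y_i * p)) -> forall p, P p.
Proof.
move=> PC PD PX.
have Pm (m : multinom n) : forall c, P (c *: mpolyX R m).
  elim: {m}(mdeg m) {1 3}m (erefl (mdeg m)) => [|k IH] m mk c.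
    move/eqP: mk; rewrite mdeg_eq0 => /eqP ->.
    by rewrite mpolyX0 alg_mpolyC; exact: PC.
  have [i mi] : exists i, m i != 0%N.
    apply/existsP; apply: contraTT (erefl true) => /existsPn H.
    have : mdeg m = 0%N by rewrite mdegE big1 // => i _; apply/eqP/negPn/H.
    by rewrite mk.
  rewrite -(@submK _ (mnm1 i) m) ?lep1mP // addmC mpolyXD scalerAr; apply: PX; apply: IH.
  by apply/eqP; rewrite -eqSS -mk -addn1 -(mdeg1 i) -mdegD submK // lep1mP.
elim/mpolyind => [|c m p _ _ IH]; first by rewrite -mpolyC0; exact: PC.
by apply: PD => //; exact: Pm.
Qed.

Lemma msize_prod_bound I (r : seq I) (P : pred I) (F : I -> {mpoly R[n]}) (a : I -> nat) :
  (forall i, P i -> (msize (F i) <= (a i).+1)%N) ->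
  (msize (\prod_(i <- r | P i) F i) <= (\sum_(i <- r | P i) a i).+1)%N.
Proof.
move=> H; elim/big_rec2: _ => [|i b p Pi pb]; first by rewrite mmeasure1.
by apply: msizeM_bound => //; exact: H.
Qed.

Lemma msize_exp_bound p k : (msize p <= 2)%N -> (msize (p ^+ k) <= k.+1)%N.
Proof.
move=> p2; elim: k => [|k IH]; first by rewrite expr0 mmeasure1.
by rewrite exprS -[k.+1]add1n; apply: msizeM_bound.
Qed.

End Ev.

Section Pull.
Variable R : realType.

Definition affine_tuple d s (E : 'M[R]_(d, s)) (b : 'cV[R]_d) : d.-tuple {mpoly R[s]} :=
  [tuple (mpolyC s (b i 0) + \sum_j E i j *: 'Y_j) | i < d].

Definition pull d s (E : 'M[R]_(d, s)) (b : 'cV[R]_d) : {mpoly R[d]} -> {mpoly R[s]} :=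
  comp_mpoly (affine_tuple E b).
HB.instance Definition _ d s (E : 'M[R]_(d, s)) b := GRing.Linear.on (pull E b).
HB.instance Definition _ d s (E : 'M[R]_(d, s)) b := GRing.RMorphism.on (pull E b).

Variables (d s : nat) (E : 'M[R]_(d, s)) (b : 'cV[R]_d).

Lemma ev_pull p t : ev (pull E b p) t = ev p (b + E *m t).
Proof.
rewrite /ev /pull comp_mpoly_meval; apply: meval_eq => i.
rewrite tnth_mktuple -/(ev _ t) evD evC ev_sum !mxE; congr (_ + _).
by apply: eq_bigr => j _; rewrite evZ evX.
Qed.

Lemma pullD p q : pull E b (p + q) = pull E b p + pull E b q. Proof. exact: raddfD. Qed.
Lemma pullM p q : pull E b (p * q) = pull E b p * pull E b q. Proof. exact: rmorphM. Qed.
Lemma pullZ c p : pull E b (c *: p) = c *: pull E b p. Proof. exact: linearZ. Qed.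
Lemma pull0 : pull E b 0 = 0. Proof. exact: raddf0. Qed.
Lemma pull1 : pull E b 1 = 1. Proof. exact: rmorph1. Qed.
Lemma pull_sum I (r : seq I) (P : pred I) F :
  pull E b (\sum_(i <- r | P i) F i) = \sum_(i <- r | P i) pull E b (F i).
Proof. exact: raddf_sum. Qed.
Lemma pullC c : pull E b (mpolyC d c) = mpolyC s c.
Proof. exact: comp_mpolyC. Qed.

Lemma pullX i : pull E b 'Y_i = mpolyC s (b i 0) + \sum_j E i j *: 'Y_j.
Proof. by rewrite /pull comp_mpolyXU -tnth_nth tnth_mktuple. Qed.

Lemma mderiv_pull j p : mderiv j (pull E b p) = \sum_i E i j *: pull E b (mderiv i p).
Proof.
elim/mpoly_gen_ind: p => [c|p q IHp IHq|i p IH].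
- by rewrite pullC mderivC big1 // => i _; rewrite mderivC pull0 scaler0.
- rewrite pullD mderivD IHp IHq -big_split; apply: eq_bigr => i _ /=.
  by rewrite mderivD pullD scalerDr.
transitivity (mderiv j (pull E b 'Y_i) * pull E b p + pull E b 'Y_i * mderiv j (pull E b p)).
  by rewrite pullM mderivM.
transitivity (\sum_k (E k j *: ((k == i)%:R * pull E b p) +
                     E k j *: (pull E b 'Y_i * pull E b (mderiv k p)))); last first.
  apply: eq_bigr => k _; rewrite -scalerDr mderivM mderivXU pullD !pullM.
  by case: eqP; rewrite ?pull1 ?pull0.
rewrite big_split /=; congr (_ + _); last first.
  by rewrite IH mulr_sumr; apply: eq_bigr => k _; rewrite -scalerAr.
rewrite (bigD1 i) //= eqxx mul1r big1 ?addr0; last first.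
  by move=> k /negPf ->; rewrite mul0r scaler0.
rewrite pullX mderivD mderivC add0r linear_sum (bigD1 j) //= linearZ /= mderivXU eqxx.
rewrite big1 ?addr0; first by rewrite -scalerAl mul1r.
by move=> k; rewrite eq_sym linearZ /= mderivXU => /negPf ->; rewrite scaler0.
Qed.

Lemma msize_pull p a : (msize p <= a)%N -> (msize (pull E b p) <= a)%N.
Proof.
move=> pa; rewrite /pull comp_mpolyE big_seq; apply: msize_sum_bound => m mp.
apply: msizeZ_bound; apply: leq_trans (leq_trans (msize_mdeg_lt mp) pa).
rewrite mdegE; apply: msize_prod_bound => i _; apply: msize_exp_bound.
rewrite tnth_mktuple; apply: msizeD_bound; first exact: msizeC_bound.
by apply: msize_sum_bound => j _; apply: msizeZ_bound; rewrite msizeXU.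
Qed.

End Pull.

Section PullComp.
Variable R : realType.

Lemma pull_comp d s s' (E : 'M[R]_(d, s)) b (F : 'M[R]_(s, s')) c p :
  pull F c (pull E b p) = pull (E *m F) (b + E *m c) p.
Proof. by apply: ev_inj => x; rewrite !ev_pull mulmxDr mulmxA addrA. Qed.

Lemma pull_id d (p : {mpoly R[d]}) : pull 1%:M 0 p = p.
Proof. by apply: ev_inj => x; rewrite ev_pull mul1mx add0r. Qed.

Lemma pullK d (E : 'M[R]_d) b : E \in unitmx ->
  cancel (pull E b) (pull (invmx E) (- (invmx E *m b))).
Proof.
by move=> Eu p; rewrite pull_comp mulmxV // mulmxN mulmxA mulmxV // mul1mx subrr pull_id.
Qed.

End PullComp.

(** * Divisibility by affine functions *)

Section Affine.
Variables (R : realType) (n : nat).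
Implicit Types (p q : {mpoly R[n]}) (x g : 'cV[R]_n) (c : R).

Definition aff g c : {mpoly R[n]} := mpolyC n c + \sum_i g i 0 *: 'Y_i.

Lemma ev_aff g c x : ev (aff g c) x = c + (g^T *m x) 0 0.
Proof.
rewrite evD evC ev_sum mxE; congr (_ + _); apply: eq_bigr => i _.
by rewrite evZ evX mxE.
Qed.

Definition vanishes (l p : {mpoly R[n]}) := forall x, ev l x = 0 -> ev p x = 0.

Section Proj.
Variables (g : 'cV[R]_n) (c : R) (i : 'I_n).
Hypothesis gi : g i 0 != 0.
Let l := aff g c.

(* substitution along the projection onto the hyperplane [l = 0] in the direction e_i *)
Let sg : {mpoly R[n]} -> {mpoly R[n]} :=
  comp_mpoly [tuple 'Y_j - (j == i)%:R *: ((g i 0)^-1 *: l) | j < n].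

Let sgX j : sg 'Y_j = 'Y_j - (j == i)%:R *: ((g i 0)^-1 *: l).
Proof. by rewrite /sg comp_mpolyXU -tnth_nth tnth_mktuple. Qed.

Let sgM p q : sg (p * q) = sg p * sg q.
Proof. exact: rmorphM. Qed.

Let sg_mod p : exists q, p - sg p = l * q.
Proof.
elim/mpoly_gen_ind: p => [a|p q [p' ep] [q' eq]|j p [p' ep]].
- by exists 0; rewrite /sg comp_mpolyC subrr mulr0.
- exists (p' + q'); rewrite mulrDr -ep -eq /sg comp_mpolyD; ring.
- exists ('Y_j * p' + (j == i)%:R *: ((g i 0)^-1 *: sg p)).
  rewrite sgM sgX mulrDr mulrCA -ep -!scalerAr mulrBl -!scalerAl; ring.
Qed.

Let ev_sg p x : exists2 y, ev l y = 0 & ev (sg p) x = ev p y.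
Proof.
exists (x - (ev l x / g i 0) *: delta_mx i 0).
  rewrite {1}/l ev_aff mulmxBr -scalemxAr mxE addrA -ev_aff -/l.
  rewrite 3!mxE (bigD1 i) //= big1 ?addr0; last first.
    by move=> j /negPf ji; rewrite !mxE ji mulr0.
  by rewrite !mxE !eqxx mulr1 divfK ?subrr.
rewrite /ev /sg comp_mpoly_meval; apply: meval_eq => j.
rewrite tnth_mktuple -!/(ev _ _) evB evX !evZ !mxE eqxx andbT; congr (_ - _); ring.
Qed.

Let sg_vanishes p : vanishes l p <-> sg p = 0.
Proof.
split=> [lp|sp x lx]; first by apply: ev_inj => x; have [y ly ->] := ev_sg p x; rewrite ev0 lp.
by have [q] := sg_mod p; rewrite sp subr0 => ->; rewrite evM lx mul0r.
Qed.

Lemma aff_factor_coord p : vanishes l p -> exists q, p = l * q.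
Proof. by move=> /sg_vanishes sp; have [q] := sg_mod p; rewrite sp subr0; exists q. Qed.

(** Vanishing on the hyperplane means lying in the kernel of [sg], a ring morphism into an integral
    domain, and such a kernel is prime. *)
Lemma aff_prime_coord p q : vanishes l (p * q) -> ~ vanishes l p -> vanishes l q.
Proof.
move=> /sg_vanishes; rewrite sgM => /eqP; rewrite mulf_eq0 => /orP[] /eqP /sg_vanishes //.
Qed.
End Proj.

Lemma aff_factor g c p : g != 0 -> vanishes (aff g c) p -> exists q, p = aff g c * q.
Proof.
move=> /matrix0Pn[i [j]]; rewrite (ord1 j) => gi; exact: (aff_factor_coord gi).
Qed.

Lemma aff_prime g c p q : g != 0 -> vanishes (aff g c) (p * q) ->
  ~ vanishes (aff g c) p -> vanishes (aff g c) q.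
Proof.
move=> /matrix0Pn[i [j]]; rewrite (ord1 j) => gi; exact: (aff_prime_coord gi).
Qed.

(** Divide by one affine function at a time; primality passes the vanishing on the other hyperplanes
    to the quotient. *)
Lemma aff_prod_factor (I : eqType) (r : seq I) (g : I -> 'cV[R]_n) (c : I -> R) p :
  uniq r -> (forall i, i \in r -> g i != 0) ->
  (forall i j, i \in r -> j \in r -> i != j -> ~ vanishes (aff (g j) (c j)) (aff (g i) (c i))) ->
  (forall i, i \in r -> vanishes (aff (g i) (c i)) p) ->
  exists q, p = (\prod_(i <- r) aff (g i) (c i)) * q.
Proof.
elim: r p => [|i r IH] p /=; first by exists p; rewrite big_nil mul1r.
move=> /andP[ir ur] g0 H V.
have [|q pq] := @aff_factor (g i) (c i) p (g0 i (mem_head _ _)); first exact: V (mem_head _ _).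
have [||j jr|q' qq'] := IH q ur.
- by move=> j jr; apply: g0; rewrite inE jr orbT.
- by move=> j k jr kr; apply: H; rewrite inE ?jr ?kr orbT.
- have jr' : j \in i :: r by rewrite inE jr orbT.
  apply: (@aff_prime _ _ (aff (g i) (c i))); first exact: g0.
    by rewrite -pq; exact: V.
  apply: H => //; first exact: mem_head.
  by apply: contraNneq ir => ->.
by exists q'; rewrite big_cons pq qq' mulrA.
Qed.

End Affine.

(** * Barycentric coordinates and integration by parts *)

Definition dotv (R : realType) n l (g : 'cV[R]_n) (v : 'cV[{mpoly R[l]}]_n) : {mpoly R[l]} :=
  \sum_a g a 0 *: v a 0.

Section Barycentric.
Variables (R : realType) (s : nat) (w : 'I_s.+1 -> 'cV[R]_s).

(** The gradients of the barycentric coordinates: those of vertices 1, ..., s are the rows of the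
    inverse edge matrix, and all of them sum to zero. *)
Definition glam (i : 'I_s.+1) : 'cV[R]_s :=
  if unlift ord0 i is Some j then (row j (invmx (edges w)))^T
  else - \sum_j (row j (invmx (edges w)))^T.

Definition lam i : {mpoly R[s]} := aff (glam i) ((i == ord0)%:R - ((glam i)^T *m w ord0) 0 0).

Lemma glam_sum : \sum_i glam i = 0.
Proof.
rewrite big_ord_recl {1}/glam unlift_none /=.
by rewrite addrC; apply/eqP; rewrite subr_eq0; apply/eqP; apply: eq_bigr => j _; rewrite /glam liftK.
Qed.

Lemma ev_lam i x : ev (lam i) x = (i == ord0)%:R + ((glam i)^T *m (x - w ord0)) 0 0.
Proof. by rewrite ev_aff mulmxBr [in RHS]mxE [X in _ + (_ + X)]mxE addrAC addrA. Qed.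

Lemma lam_sum : \sum_i lam i = 1.
Proof.
apply: ev_inj => x; rewrite ev_sum ev1; under eq_bigr do rewrite ev_lam.
rewrite big_split /= (bigD1 ord0) //= big1 ?addr0; last by move=> i /negPf ->.
rewrite -[RHS]addr0; congr (_ + _).
transitivity (((\sum_i glam i)^T *m (x - w ord0)) 0 0).
  by rewrite raddf_sum mulmx_suml summxE.
by rewrite glam_sum trmx0 mul0mx mxE.
Qed.

Lemma mulmx_col m n l (A : 'M[R]_(m, n)) (B : 'M[R]_(n, l)) j : A *m col j B = col j (A *m B).
Proof. by apply/matrixP => a b; rewrite !mxE; apply: eq_bigr => k _; rewrite mxE. Qed.

Lemma edges_col j : col j (edges w) = w (lift ord0 j) - w ord0.
Proof. by apply/matrixP => a b; rewrite !mxE (ord1 b). Qed.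

Lemma ev_lam_lift j x : ev (lam (lift ord0 j)) x = (invmx (edges w) *m (x - w ord0)) j 0.
Proof.
rewrite ev_lam eq_sym (negPf (neq_lift _ _)) add0r /glam liftK trmxK -row_mul mxE //.
Qed.

Lemma ev_lam0 x : ev (lam ord0) x = 1 - \sum_j ev (lam (lift ord0 j)) x.
Proof.
have := congr1 (fun p => ev p x) lam_sum; rewrite ev_sum ev1 big_ord_recl => <-.
by rewrite addrK.
Qed.

Hypothesis wu : edges w \in unitmx.

Lemma ev_lam_vertex i j : ev (lam i) (w j) = (i == j)%:R.
Proof.
have L i' : ev (lam (lift ord0 i')) (w j) = (lift ord0 i' == j)%:R.
  rewrite ev_lam_lift; case: (unliftP ord0 j) => [j'|] ->.
    by rewrite -edges_col mulmx_col mulVmx // !mxE (inj_eq (@lift_inj _ _)).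
  by rewrite subrr mulmx0 mxE eq_sym (negPf (neq_lift _ _)).
case: (unliftP ord0 i) => [i'|] -> //.
rewrite ev_lam0; under eq_bigr do rewrite L.
case: (unliftP ord0 j) => [j'|] ->.
  rewrite (bigD1 j') //= eqxx big1 ?addr0 ?subrr ?(negPf (neq_lift _ _)) //.
  by move=> k kj; rewrite (inj_eq (@lift_inj _ _)) (negPf kj).
by rewrite big1 ?subr0 ?eqxx // => k _; rewrite eq_sym (negPf (neq_lift _ _)).
Qed.

Lemma barycentric x : x = \sum_i ev (lam i) x *: w i.
Proof.
rewrite big_ord_recl ev_lam0 scalerBl scale1r scaler_suml addrAC -addrA -sumrB.
under eq_bigr do rewrite -scalerBr -edges_col ev_lam_lift.
apply/eqP; rewrite addrC -subr_eq; apply/eqP.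
rewrite -[LHS]mul1mx -(mulmxV wu) -mulmxA; apply/matrixP => a b.
rewrite !mxE summxE; apply: eq_bigr => j _.
by rewrite [RHS]mxE [col _ _ _ _]mxE (ord1 b) mulrC.
Qed.

Lemma glam_neq0 i : (0 < s)%N -> glam i != 0.
Proof.
move=> s0; apply/eqP => g0.
have [j ji] : exists j : 'I_s.+1, j != i.
  have [->|i0] := eqVneq i ord0; last by exists ord0; rewrite eq_sym.
  by exists (lift ord0 (Ordinal s0)); rewrite eq_sym neq_lift.
have : ev (lam i) (w i) = ev (lam i) (w j) by rewrite !ev_lam g0 trmx0 !mul0mx.
rewrite !ev_lam_vertex eqxx eq_sym (negPf ji) => /esym /eqP.
by rewrite eq_sym oner_eq0.
Qed.

Lemma lam_not_vanishes i j : i != j -> ~ vanishes (lam i) (lam j).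
Proof.
move=> ij /(_ (w j)); rewrite !ev_lam_vertex (negPf ij) eqxx => /(_ erefl) /eqP.
by rewrite oner_eq0.
Qed.

Lemma lam_factor i p : (0 < s)%N -> vanishes (lam i) p -> exists q, p = lam i * q.
Proof. by move=> s0; apply: aff_factor; exact: glam_neq0. Qed.

Lemma lam_prime i p q : (0 < s)%N ->
  vanishes (lam i) (p * q) -> ~ vanishes (lam i) p -> vanishes (lam i) q.
Proof. by move=> s0; apply: aff_prime; exact: glam_neq0. Qed.

Lemma lam_prod_factor p : (0 < s)%N -> (forall i, vanishes (lam i) p) ->
  exists q, p = (\prod_i lam i) * q.
Proof.
move=> s0 V; apply: aff_prod_factor => [|i _|i j _ _ ij|i _]; first exact: index_enum_uniq.
- exact: glam_neq0.
- by apply: lam_not_vanishes; rewrite eq_sym.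
- exact: V.
Qed.

Lemma pull_lam_lift j : pull (edges w) (w ord0) (lam (lift ord0 j)) = 'Y_j.
Proof.
by apply: ev_inj => t; rewrite ev_pull ev_lam_lift addrC addKr mulmxA mulVmx // mul1mx evX.
Qed.

Lemma pull_lam0 : pull (edges w) (w ord0) (lam ord0) = 1 - \sum_j 'Y_j.
Proof.
apply: ev_inj => t; rewrite ev_pull ev_lam0 evB ev1 ev_sum; congr (_ - _).
by apply: eq_bigr => j _; rewrite -ev_pull pull_lam_lift.
Qed.

(** The integral over the simplex w without its Jacobian factor; the arguments below only ask
    whether integrals vanish. *)
Definition SInt (p : {mpoly R[s]}) : R := Int (pull (edges w) (w ord0) p).

Fact SInt_is_scalar : scalar SInt.
Proof. by move=> c p q; rewrite /SInt linearP /= linearP. Qed.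
HB.instance Definition _ := GRing.isLinear.Build R {mpoly R[s]} R _ SInt SInt_is_scalar.

Lemma SInt_eq0 p : (forall x, (forall i, 0 <= ev (lam i) x) -> 0 <= ev p x) ->
  SInt p = 0 -> p = 0.
Proof.
move=> pos; rewrite /SInt /Int => e.
apply: (can_inj (pullK (w ord0) wu)); rewrite pull0; apply: (std_int_eq0 ltr01 _ e) => t [t0 t1].
rewrite ev_pull; apply: pos => i; rewrite -ev_pull; case: (unliftP ord0 i) => [j|] ->.
  by rewrite pull_lam_lift evX.
rewrite pull_lam0 evB ev1 ev_sum subr_ge0.
by under eq_bigr do rewrite evX.
Qed.

(** Piola transform: multiplying the pulled-back field by the inverse edge matrix gives a field on
    the standard simplex whose divergence is the pull-back of div v and whose components are the
    products glam_i . v. *)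
Lemma SInt_div v (g : 'I_s.+1 -> {mpoly R[s]}) :
  (forall i, dotv (glam i) v = lam i * g i) -> SInt (div v) = 0.
Proof.
move=> vg; set E := edges w; set F := invmx E; set P := pull E (w ord0).
pose v' : 'cV[{mpoly R[s]}]_s := \col_j \sum_a F j a *: P (v a 0).
have v'E j : v' j 0 = P (dotv (glam (lift ord0 j)) v).
  rewrite mxE /dotv /P pull_sum; apply: eq_bigr => a _.
  by rewrite pullZ /glam liftK !mxE.
have -> : SInt (div v) = Int (div v').
  congr Int; rewrite /div -/E -/P /P pull_sum.
  transitivity (\sum_i \sum_a (E *m F) i a *: P (mderiv i (v a 0))).
    apply: eq_bigr => i _; rewrite mulmxV // (bigD1 i) //= big1 ?addr0 => [|a /negPf ai].
      by rewrite mxE eqxx scale1r.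
    by rewrite mxE eq_sym ai scale0r.
  transitivity (\sum_j \sum_a \sum_i (F j a * E i j) *: P (mderiv i (v a 0))).
    rewrite exchange_big [RHS]exchange_big; apply: eq_bigr => a _.
    rewrite [RHS]exchange_big; apply: eq_bigr => i _.
    by rewrite mxE scaler_suml; apply: eq_bigr => j _; rewrite mulrC.
  apply: eq_bigr => j _; rewrite mxE linear_sum; apply: eq_bigr => a _.
  by rewrite linearZ /= /P mderiv_pull scaler_sumr; apply: eq_bigr => i _; rewrite scalerA.
(* The components of v' add up to minus the pull-back of glam_0 . v, whence the sign in front of
   [g ord0]. *)
apply: (@Int_div_bubble _ _ _ (fun j => P (g (lift ord0 j))) (- P (g ord0))).
  by move=> j; rewrite v'E vg /P pullM pull_lam_lift.
under eq_bigr do rewrite v'E.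
rewrite -pull_sum -pull_lam0 mulrN -pullM -vg -/P.
apply/eqP; rewrite -addr_eq0 /P -pullD; apply/eqP; rewrite addrC.
have -> : dotv (glam ord0) v + \sum_j dotv (glam (lift ord0 j)) v = 0; last exact: pull0.
transitivity (\sum_i dotv (glam i) v); first by rewrite big_ord_recl.
rewrite /dotv exchange_big /= big1 // => a _.
by rewrite -scaler_suml -summxE glam_sum mxE scale0r.
Qed.

End Barycentric.

(** * Polynomial decompositions *)

Section VectorCalculus.
Variables (R : realType) (n : nat).
Local Notation A := {mpoly R[n]}.
Local Notation x := (xvec R n).
Implicit Types (p : A) (u v : 'cV[A]_n) (B q : 'M[A]_n).

Definition grad p : 'cV[A]_n := \col_i mderiv i p.
Definition dotx v : A := \sum_i 'Y_i * v i 0.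
Definition curl u : 'M[A]_n := \matrix_(i, j) (mderiv j (u i 0) - mderiv i (u j 0)).
Definition symgrad u : 'M[A]_n :=
  \matrix_(i, j) (2^-1 *: (mderiv j (u i 0) + mderiv i (u j 0))).

Lemma mulmx_xvec m (B : 'M[A]_(m, n)) i : (B *m x) i 0 = \sum_j 'Y_j * B i j.
Proof. by rewrite mxE; apply: eq_bigr => j _; rewrite mxE mulrC. Qed.

Lemma dotxE v : dotx v = (x^T *m v) 0 0.
Proof. by rewrite mxE; apply: eq_bigr => i _; rewrite !mxE. Qed.

Lemma dotxD u v : dotx (u + v) = dotx u + dotx v.
Proof. by rewrite !dotxE mulmxDr mxE. Qed.

Lemma dotxB u v : dotx (u - v) = dotx u - dotx v.
Proof. by rewrite !dotxE mulmxBr mxE [X in _ + X]mxE. Qed.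

Lemma eq_neg_eq0 p : p = - p -> p = 0.
Proof.
move=> e; have : p *+ 2 = 0 by rewrite mulr2n {1}e addNr.
by move/eqP; rewrite -mulr_natr -(@mpolyC_nat n R) mulrC mul_mpolyC mscalerI pnatr_eq0 /= => /eqP.
Qed.

Lemma dotx_skew B : Defs.skewmx B -> dotx (B *m x) = 0.
Proof.
move=> skB; apply: eq_neg_eq0; rewrite dotxE.
transitivity ((x^T *m (B *m x))^T 0 0); first by rewrite [RHS]mxE.
by rewrite !trmx_mul trmxK skB mulmxN mulNmx mulmxA mxE.
Qed.

Lemma curl_skew u : Defs.skewmx (curl u).
Proof. by apply/matrixP => i j; rewrite !mxE opprB. Qed.

Lemma mderiv_dotx i u : mderiv i (dotx u) = u i 0 + \sum_j 'Y_j * mderiv i (u j 0).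
Proof.
rewrite /dotx raddf_sum /=; under eq_bigr do rewrite mderivM mderivXU.
rewrite big_split /=; congr (_ + _); rewrite (bigD1 i) //= eqxx mul1r big1 ?addr0 //.
by move=> j; rewrite eq_sym => /negPf ->; rewrite mul0r.
Qed.

Lemma euler_dotx u : euler (dotx u) = dotx u + dotx (map_mx (@euler R n) u).
Proof.
rewrite /dotx euler_sum -big_split; apply: eq_bigr => i _ /=.
by rewrite eulerM eulerX !mxE.
Qed.

(** Cartan's formula for the Lie derivative of the 1-form u along the field x: the left side is that
    derivative, the right side d(i_x u) + i_x(du). *)
Lemma curl_identity u :
  map_mx (@euler R n) u + u = grad (dotx u) + curl u *m x.
Proof.
apply/matrixP => i j; rewrite (ord1 j) {j} mxE [RHS]mxE mulmx_xvec !mxE mderiv_dotx.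
rewrite -addrA addrC; congr (_ + _); rewrite /euler -big_split; apply: eq_bigr => j _ /=.
by rewrite mxE mulrBr addrC subrK.
Qed.

Definition vinv v : 'cV[A]_n := map_mx (@einv R n 1) v.

Lemma vinvK v : map_mx (@euler R n) (vinv v) + vinv v = v.
Proof.
apply/matrixP => i j; rewrite !mxE -[RHS](@euler_einv _ _ 1) // scale1r //.
Qed.

Lemma grad_decomp_eq v : v = grad (dotx (vinv v)) + curl (vinv v) *m x.
Proof. by rewrite -curl_identity vinvK. Qed.

(** Exactness of the Koszul complex: [euler] of x . [vinv] v is x . v = 0, so x . [vinv] v is
    constant and the gradient part of the decomposition disappears. *)
Lemma dotx_eq0_curl v : dotx v = 0 -> v = curl (vinv v) *m x.
Proof.
move=> v0; rewrite {1}[v]grad_decomp_eq.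
suff /euler_eq0 -> : euler (dotx (vinv v)) = 0.
  rewrite -[RHS]add0r; congr (_ + _); apply/matrixP => i j.
  by rewrite !mxE mderivC.
by rewrite euler_dotx addrC -dotxD vinvK.
Qed.

Lemma Pmx_vinv m v : Pmx m v -> Pmx m (vinv v).
Proof. by move=> vm i j; rewrite /Ppoly /= mxE; apply/msize_pdiag/vm. Qed.

Lemma msize_dotx m v : Pmx m v -> (msize (dotx v) <= m.+2)%N.
Proof. by move=> vm; apply: msize_sum_bound => i _; apply/msizeXM/vm. Qed.

Lemma Pmx_curl m u : Pmx m.+1 u -> Pmx m (curl u).
Proof. by move=> um i j; rewrite /Ppoly /= mxE; apply: msizeB_bound; apply/msize_mderiv/um. Qed.

Lemma Pmx_curl_pred m u : Pmx m u -> Pmx (m - 1) (curl u).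
Proof.
case: m => [|m] um; last by rewrite subn1; exact: Pmx_curl.
by move=> i j; rewrite /Ppoly /= mxE; apply: msizeB_bound; apply: leqW; apply/msize_mderiv/um.
Qed.

Lemma grad_decomp m v : Pmx m v ->
  exists p B, [/\ Ppoly m.+1 p, Pmx (m - 1) B, Defs.skewmx B & v = grad p + B *m x].
Proof.
move=> vm; exists (dotx (vinv v)), (curl (vinv v)); split.
- exact/msize_dotx/Pmx_vinv.
- exact/Pmx_curl_pred/Pmx_vinv.
- exact: curl_skew.
- exact: grad_decomp_eq.
Qed.

Lemma HpolyP m p : Hpoly m p <-> forall k, mdeg k != m -> mcoeff k p = 0.
Proof.
split=> [/dhomogP H k km|H].
  by apply: memN_msupp_eq0; apply: contra km => /H /eqP.
apply/dhomogP => k; apply: contraTeq => /H e; by rewrite mcoeff_msupp e eqxx.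
Qed.

Lemma Hpoly_msize m p : Hpoly m p -> Ppoly m p.
Proof. by move=> /HpolyP H; apply/msize_leP => k mk; apply: H; rewrite gtn_eqF. Qed.

Lemma Hmx_curl_vinv m v : Hmx m.+1 v -> Hmx m (curl (vinv v)).
Proof.
move=> vm i j; apply/HpolyP => k km; rewrite mxE mcoeffB !mcoeff_deriv !mxE !mcoeff_pdiag.
by rewrite !(HpolyP m.+1 _).1 ?mulr0 ?mul0rn ?subrr // mdegD mdeg1 addn1 eqSS.
Qed.

Lemma mcoeff_pihomog m p k : mcoeff k (pihomog mdeg m p) = mcoeff k p *+ (mdeg k == m).
Proof.
have fl : scalar (fun p => mcoeff k (pihomog mdeg m p)) by move=> c a b; rewrite !linearP.
have gl : scalar (fun p : A => mcoeff k p *+ (mdeg k == m)).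
  by move=> c a b; rewrite linearP mulrnDl mulrnAr.
apply: (eq_on_monomials_scalar fl gl) => l /=; rewrite pihomogX mcoeffX.
have [->|lk] := eqVneq l k; first by case: ifP => _; rewrite ?mcoeff0 // mcoeffX eqxx.
by case: ifP => _; rewrite ?mcoeff0 ?mul0rn // mcoeffX (negPf lk).
Qed.

Lemma Hpoly_pihomog m p : Hpoly m (pihomog mdeg m p).
Proof. by apply/HpolyP => k /negPf e; rewrite mcoeff_pihomog e. Qed.

Lemma msize_sub_pihomog m p : Ppoly m.+1 p -> Ppoly m (p - pihomog mdeg m.+1 p).
Proof.
move=> /msize_leP pm; apply/msize_leP => k mk; rewrite mcoeffB mcoeff_pihomog.
by case: eqP => [_|/eqP e]; rewrite ?subrr // pm ?subrr // ltn_neqAle eq_sym e.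
Qed.

Lemma Hpoly_Ppoly_eq0 m p : Hpoly m.+1 p -> Ppoly m p -> p = 0.
Proof.
move=> /HpolyP H /msize_leP P; apply/mpolyP => k; rewrite mcoeff0.
by have [km|/H] := eqVneq (mdeg k) m.+1; [rewrite P ?km|].
Qed.

Lemma mcoeffXM i p k :
  mcoeff k ('Y_i * p) = if (k i == 0)%N then 0 else mcoeff (mnm_sub k (mnm1 i)) p.
Proof.
case: eqP => [ki|/eqP ki]; last first.
  by rewrite -{1}(@submK _ (mnm1 i) k) ?lep1mP // addmC mulrC mcoeffMX.
apply/eqP; rewrite mcoeff_eq0; apply/negP => /msuppM_le /allpairsP[[a b] /= [ai _ e]].
move: ai ki; rewrite e msuppX inE => /eqP ->.
by rewrite mnmDE mnm1E eqxx.
Qed.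

Lemma Hpoly_dotx m v : Hmx m v -> Hpoly m.+1 (dotx v).
Proof.
move=> vm; apply/HpolyP => k km; rewrite /dotx raddf_sum big1 //= => i _.
rewrite mcoeffXM; case: eqP => // /eqP ki; apply: (HpolyP m _).1; first exact: vm.
by apply: contra km => /eqP <-; rewrite -addn1 -(mdeg1 i) -mdegD submK // lep1mP.
Qed.

Lemma Hmx_mulx m B i : Hmx m B -> Hpoly m.+1 ((B *m x) i 0).
Proof.
move=> Bm; rewrite mulmx_xvec.
have -> : \sum_j 'Y_j * B i j = dotx (row i B)^T by apply: eq_bigr => j _; rewrite !mxE.
by apply: Hpoly_dotx => j l; rewrite !mxE; exact: Bm.
Qed.

(** ND_m consists of the fields of degree m + 1 for which multiplication by x gains no degree. The
    top part h has x . h homogeneous of degree m + 2 and of degree at most m + 1, hence zero, and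
    Koszul exactness makes h a skew matrix times x. *)
Lemma NDE m v : ND m v <-> Pmx m.+1 v /\ Ppoly m.+1 (dotx v).
Proof.
split=> [[a [B [am Bm skB ->]]]|[vm xvm]].
  split=> [i j|].
    rewrite (ord1 j) mxE; apply: msizeD_bound; first exact/leqW/am.
    exact/Hpoly_msize/Hmx_mulx.
  by rewrite /Ppoly /= dotxD dotx_skew // addr0; exact: msize_dotx.
pose h : 'cV[A]_n := map_mx (pihomog mdeg m.+1) v.
have hH : Hmx m.+1 h by move=> i j; rewrite mxE; exact: Hpoly_pihomog.
have am : Pmx m (v - h) by move=> i j; rewrite !mxE; exact/msize_sub_pihomog/vm.
have h0 : dotx h = 0.
  apply: (@Hpoly_Ppoly_eq0 m.+1); first exact: Hpoly_dotx.
  have -> : dotx h = dotx v - dotx (v - h) by rewrite dotxB subKr.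
  by apply: msizeB_bound => //; exact: msize_dotx.
exists (v - h), (curl (vinv h)); split=> //; first exact: Hmx_curl_vinv.
  exact: curl_skew.
by rewrite -dotx_eq0_curl // subrK.
Qed.

End VectorCalculus.

(** * Symmetric gradients and infinitesimal rigid motions *)

Section SymmetricGradient.
Variables (R : realType) (n : nat).
Local Notation A := {mpoly R[n]}.
Local Notation x := (xvec R n).
Implicit Types (p : A) (u v : 'cV[A]_n) (B q Q : 'M[A]_n).

Lemma scale_half p : (2^-1 : R) *: (p + p) = p.
Proof. by rewrite -mulr2n -[X in _ *: X]scaler_nat scalerA mulVf ?scale1r // pnatr_eq0. Qed.

Lemma symgrad_mulx u i :
  (symgrad u *m x) i 0 = 2^-1 *: (euler (u i 0) - u i 0 + mderiv i (dotx u)).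
Proof.
rewrite mulmx_xvec mderiv_dotx addrA subrK /euler -big_split scaler_sumr.
by apply: eq_bigr => j _; rewrite mxE -scalerAr mulrDr.
Qed.

Lemma symgrad_sym u : symmx (symgrad u).
Proof. by apply/matrixP => i j; rewrite !mxE addrC. Qed.

Lemma euler_mulx Q i : euler ((Q *m x) i 0) = (map_mx (@euler R n) Q *m x) i 0 + (Q *m x) i 0.
Proof.
rewrite !mulmx_xvec euler_sum -big_split; apply: eq_bigr => j _ /=.
by rewrite eulerM eulerX mxE addrC.
Qed.

Lemma mderiv_quad i Q : symmx Q ->
  mderiv i (dotx (Q *m x)) = (Q *m x) i 0 *+ 2 + dotx (map_mx (mderiv i) Q *m x).
Proof.
move=> sQ; rewrite mderiv_dotx mulr2n -addrA; congr (_ + _).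
have E j : mderiv i ((Q *m x) j 0) = Q j i + (map_mx (mderiv i) Q *m x) j 0.
  rewrite !mulmx_xvec raddf_sum /=; under eq_bigr do rewrite mderivM mderivXU.
  rewrite big_split /=; congr (_ + _).
    rewrite (bigD1 i) //= eqxx mul1r big1 ?addr0 // => k; rewrite eq_sym => /negPf ->.
    by rewrite mul0r.
  by apply: eq_bigr => k _; rewrite mxE.
under eq_bigr do rewrite E mulrDr.
rewrite big_split /=; congr (_ + _); rewrite mulmx_xvec; apply: eq_bigr => j _.
by rewrite -{1}sQ mxE.
Qed.

Section Decomp.
Variable q : 'M[A]_n.
Hypothesis sq : symmx q.

Let Q := map_mx (@einv R n 1) q.
Let Q0 : 'M[A]_n := map_mx (fun p => mpolyC n (mcoeff mnm0 p)) Q.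
Let Z i : 'M[A]_n := map_mx (@einv R n 1) (map_mx (mderiv i) Q).
Let z : 'cV[A]_n := \col_i dotx (Z i *m x).

(* With E the Euler operator and (E + 1) Q = q, the field u = symgrad_potential solves
   (E - 1) u + grad (u . x) = 2 q x, and the left-hand side is 2 (symgrad u) x. *)
Definition symgrad_potential : 'cV[A]_n := (Q *m x) *+ 2 - Q0 *m x - z.

Let QK : map_mx (@euler R n) Q + Q = q.
Proof. by apply/matrixP => i j; rewrite !mxE -[RHS](@euler_einv _ _ 1) // scale1r. Qed.

Let sQ : symmx Q.
Proof. by apply/matrixP => a b; rewrite !mxE -{1}sq mxE. Qed.

Let euler_z i : euler (z i 0) = z i 0 + dotx (map_mx (mderiv i) Q *m x).
Proof.
rewrite mxE euler_dotx; congr (_ + _); rewrite /dotx; apply: eq_bigr => a _; congr (_ * _).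
rewrite mxE euler_mulx !mulmx_xvec -big_split; apply: eq_bigr => b _ /=.
by rewrite -mulrDr !mxE -[in RHS](@euler_einv _ _ 1 (mderiv i _)) // scale1r.
Qed.

(** The sum of the x_i Z_i is Q - Q0, by integration along rays, so u . x = 2 Qx . x - Q0 x . x - (Q
    - Q0) x . x. The term with Q0 is in the potential to compensate the constant lost by [einv 1] of
    derivatives; as Q0 x is of degree 1, E - 1 does not see it. *)
Let dotx_u : dotx symgrad_potential = dotx (Q *m x).
Proof.
rewrite /symgrad_potential !dotxB mulr2n dotxD.
suff -> : dotx z = dotx (Q *m x) - dotx (Q0 *m x) by ring.
rewrite -dotxB -mulmxBl /dotx.
under [LHS]eq_bigr do rewrite mxE /dotx mulr_sumr.
rewrite exchange_big; apply: eq_bigr => a _ /=.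
under eq_bigr do rewrite mulrCA; rewrite -mulr_sumr; congr (_ * _).
under eq_bigr do rewrite mulmx_xvec mulr_sumr; rewrite exchange_big mulmx_xvec.
apply: eq_bigr => b _; under eq_bigr do rewrite mulrCA; rewrite -mulr_sumr; congr (_ * _).
under eq_bigr do rewrite /Z mxE [X in einv _ X]mxE.
by rewrite sum_mulX_einv_mderiv !mxE.
Qed.

Lemma symgrad_potential_mulx : symgrad symgrad_potential *m x = q *m x.
Proof.
apply/matrixP => i j; rewrite (ord1 j) {j} symgrad_mulx dotx_u mderiv_quad //.
have E0 : euler ((Q0 *m x) i 0) = (Q0 *m x) i 0.
  rewrite euler_mulx (_ : map_mx _ _ = 0) ?mul0mx ?mxE ?add0r //.
  by apply/matrixP => a b; rewrite !mxE /euler big1 // => k _; rewrite mderivC mulr0.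
have -> : euler (symgrad_potential i 0) - symgrad_potential i 0 =
    (map_mx (@euler R n) Q *m x) i 0 *+ 2 - dotx (map_mx (mderiv i) Q *m x).
  have -> : symgrad_potential i 0 = (Q *m x) i 0 *+ 2 - (Q0 *m x) i 0 - z i 0.
    by rewrite /symgrad_potential !mulr2n !mxE.
  rewrite !eulerE !raddfB raddfMn /= -!eulerE E0 euler_z euler_mulx; ring.
set D := dotx _; set P := (_ *m x) i 0; set S := (Q *m x) i 0.
have -> : P *+ 2 - D + (S *+ 2 + D) = (P + S) + (P + S) by rewrite !mulr2n; ring.
by rewrite scale_half -[in RHS]QK mulmxDl mxE.
Qed.

Lemma Pmx_symgrad_potential m : Pmx m q -> Pmx m.+1 symgrad_potential.
Proof.
move=> qm.
have Qm : Pmx m Q by move=> a b; rewrite /Ppoly /= mxE; apply/msize_pdiag/qm.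
have mulx_bound k (M : 'M[A]_n) : (forall a b, msize (M a b) <= k)%N ->
    forall i, (msize ((M *m x) i 0%R) <= k.+1)%N.
  by move=> Mk i; rewrite mulmx_xvec; apply: msize_sum_bound => j _; exact/msizeXM/Mk.
move=> i j; rewrite (ord1 j) /Ppoly /=.
have -> : symgrad_potential i 0 = (Q *m x) i 0 *+ 2 - (Q0 *m x) i 0 - z i 0.
  by rewrite /symgrad_potential !mulr2n !mxE.
apply: msizeB_bound; first apply: msizeB_bound.
- by rewrite mulr2n; apply: msizeD_bound; apply: mulx_bound.
- by apply: leq_trans (mulx_bound 1%N _ _ _) _ => // a b; rewrite mxE; exact: msizeC_bound.
rewrite mxE; apply: msize_sum_bound => a _; apply/msizeXM/mulx_bound => b c.
by rewrite /Z mxE; apply: msize_pdiag; rewrite mxE; exact/msize_mderiv/Qm.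
Qed.

End Decomp.

Lemma Pmx_symgrad m u : Pmx m.+1 u -> Pmx m (symgrad u).
Proof.
move=> um i j; rewrite /Ppoly /= mxE; apply/msizeZ_bound/msizeD_bound; exact/msize_mderiv/um.
Qed.

Lemma symgrad_decomp m q : Pmx m q -> symmx q ->
  exists u k, [/\ Pmx m.+1 u, kerx m k & q = symgrad u + k].
Proof.
move=> qm sq; have um := Pmx_symgrad_potential qm.
exists (symgrad_potential q), (q - symgrad (symgrad_potential q)); split=> //; last first.
  by rewrite addrC subrK.
split.
- move=> i j; rewrite mxE [X in _ + X]mxE; apply: msizeB_bound; first exact: qm.
  exact: Pmx_symgrad.
- by rewrite /symmx /= linearB /= sq symgrad_sym.
- by rewrite mulmxBl symgrad_potential_mulx // subrr.
Qed.

Lemma symgrad_ND0 u : ND 0 u -> symgrad u = 0.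
Proof.
move=> [a [B [am Bm skB ->]]]; apply/matrixP => i j; rewrite [RHS]mxE mxE.
have Pc p k : (msize p <= 1)%N -> mderiv k p = 0.
  by move=> /msize1_polyC ->; rewrite mderivC.
have E l k : mderiv l ((a + B *m x) k 0) = B k l.
  rewrite mxE mulmx_xvec mderivD Pc ?add0r; last exact: am.
  rewrite raddf_sum /=; under eq_bigr do rewrite mderivM mderivXU (Pc _ _ (Hpoly_msize (Bm _ _))) mulr0 addr0.
  by rewrite (bigD1 l) //= eqxx mul1r big1 ?addr0 // => b; rewrite eq_sym => /negPf ->; rewrite mul0r.
have sk := congr1 (fun M : 'M[A]_n => M i j) skB; rewrite !mxE in sk.
by rewrite !E sk addrN scaler0.
Qed.

(** The hypothesis reads (E - 1) u + grad phi = 0 with phi = u . x. Multiplying by x gives 2 (E - 1)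
    phi = 0, so phi is linear, grad phi is constant, and u has degree at most 1; [NDE] concludes. *)
Lemma symgrad_mulx_eq0 u : symgrad u *m x = 0 <-> ND 0 u.
Proof.
split=> [e|/symgrad_ND0 ->]; last by rewrite mul0mx.
have half0 p : (2^-1 : R) *: p = 0 -> p = 0.
  by move/eqP; rewrite mscalerI invr_eq0 pnatr_eq0 /= => /eqP.
have Eu i : euler (u i 0) - u i 0 + mderiv i (dotx u) = 0.
  by apply: half0; rewrite -symgrad_mulx e mxE.
have Ephi : euler (dotx u) - dotx u = 0.
  have : \sum_i 'Y_i * (euler (u i 0) - u i 0 + mderiv i (dotx u)) = 0.
    by rewrite big1 // => i _; rewrite Eu mulr0.
  under eq_bigr do rewrite mulrDr mulrBr; rewrite big_split sumrB /= -/(dotx u) -/(euler (dotx u)).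
  have -> : \sum_i 'Y_i * euler (u i 0) = euler (dotx u) - dotx u.
    by rewrite euler_dotx addrC addKr; apply: eq_bigr => i _; rewrite mxE.
  by move=> e2; rewrite -[LHS]scale_half (_ : _ + _ = 0) ?scaler0 // -[RHS]e2; ring.
have deg1 p k : mcoeff k (euler p - p) = 0 -> mdeg k != 1%N -> mcoeff k p = 0.
  rewrite mcoeffB mcoeff_euler -{2}[mcoeff k p]mul1r -mulrBl => /eqP.
  by rewrite mulf_eq0 subr_eq0 pnatr_eq1 => /orP[->|/eqP].
have phi1 : Hpoly 1 (dotx u) by apply/HpolyP => k; apply: deg1; rewrite Ephi mcoeff0.
apply/NDE; split; last exact: Hpoly_msize.
move=> i j; rewrite (ord1 j) {j}; apply/msize_leP => k k2.
apply: deg1; last by rewrite gtn_eqF.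
have /eqP := Eu i; rewrite addr_eq0 => /eqP ->; rewrite mcoeffN.
have /msize_leP -> := msize_mderiv i (Hpoly_msize phi1); rewrite ?oppr0 //.
exact: leq_trans k2.
Qed.

End SymmetricGradient.

(** * Bubble fields *)

Section Bubbles.
Variables (R : realType) (s : nat) (w : 'I_s.+1 -> 'cV[R]_s).
Hypotheses (s0 : (0 < s)%N) (wu : edges w \in unitmx).
Local Notation A := {mpoly R[s]}.
Local Notation x := (xvec R s).
Local Notation lam := (lam w).
Local Notation glam := (glam w).
Local Notation SInt := (SInt w).
Implicit Types (p : A) (u v : 'cV[A]_s) (tau q : 'M[A]_s).

Definition pdot u v : A := \sum_a u a 0 * v a 0.
Definition mdot tau q : A := \sum_a \sum_b tau a b * q a b.

(** Zero normal component on every facet, as [glam i] is normal to the facet where [lam i] vanishes;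
    [tbubble] asks the same of each row. *)
Definition bubble v := forall i, vanishes (lam i) (dotv (glam i) v).
Definition tbubble tau := forall i a, vanishes (lam i) (dotv (glam i) (row a tau)^T).

Lemma vanishes_mull l p p' : vanishes l p -> vanishes l (p' * p).
Proof. by move=> V y ly; rewrite evM V // mulr0. Qed.

Lemma vanishes_sum l I (r : seq I) (P : pred I) (F : I -> A) :
  (forall i, P i -> vanishes l (F i)) -> vanishes l (\sum_(i <- r | P i) F i).
Proof. by move=> V y ly; rewrite ev_sum big1 // => i Pi; rewrite V. Qed.

Lemma SInt_ge0 p : (forall y, (forall i, 0 <= ev (lam i) y) -> 0 <= ev p y) -> 0 <= SInt p.
Proof.
move=> pos; apply: std_int_ge0 => // t [t0 t1].
rewrite ev_pull; apply: pos => i; rewrite -ev_pull; case: (unliftP ord0 i) => [j|] ->.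
  by rewrite pull_lam_lift // evX.
rewrite pull_lam0 // evB ev1 ev_sum subr_ge0.
by under eq_bigr do rewrite evX.
Qed.

Lemma SInt_sum_eq0 (I : finType) (P : pred I) (F : I -> A) :
  (forall i, P i -> forall y, (forall i, 0 <= ev (lam i) y) -> 0 <= ev (F i) y) ->
  SInt (\sum_(i | P i) F i) = 0 -> forall i, P i -> F i = 0.
Proof.
move=> pos e i Pi; apply: (SInt_eq0 wu (pos i Pi)).
move/eqP: e; rewrite raddf_sum psumr_eq0 /= => [|j Pj]; last exact/SInt_ge0/pos.
by move=> /allP /(_ i (mem_index_enum _)); rewrite Pi => /eqP.
Qed.

Lemma SInt_sq_eq0 p : SInt (p * p) = 0 -> p = 0.
Proof.
move=> e; have /eqP : p * p = 0.
  by apply: (SInt_eq0 wu _ e) => y _; rewrite evM -expr2 sqr_ge0.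
by rewrite mulf_eq0 orbb => /eqP.
Qed.

Lemma lam_neq0 i : lam i != 0.
Proof.
apply/eqP => e; have := ev_lam_vertex wu i i; rewrite e ev0 eqxx => /eqP.
by rewrite eq_sym oner_eq0.
Qed.

(** [lam i] is 1 at one vertex and 0 at another, so it is not constant and removing it lowers the
    degree. *)
Lemma msize_lam_factor i p m : (msize (lam i * p) <= m.+1)%N -> (msize p <= m)%N.
Proof.
have [->|p0] := eqVneq p 0; first by rewrite mmeasure0.
suff l2 : (1 < msize (lam i))%N.
  rewrite msizeM // ?lam_neq0 //; case: (msize (lam i)) l2 => [|[|a]] //= _.
  by rewrite !addSn ltnS; apply: leq_trans; exact: leq_addl.
rewrite ltnNge; apply/negP => /msize1_polyC lC.
have [j ji] : exists j : 'I_s.+1, i != j.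
  have [->|i0] := eqVneq i ord0; last by exists ord0.
  by exists (lift ord0 (Ordinal s0)); rewrite neq_lift.
have := ev_lam_vertex wu i i; have := ev_lam_vertex wu i j.
by rewrite lC !evC eqxx (negPf ji) => -> /eqP; rewrite eq_sym oner_eq0.
Qed.

Lemma SInt_div_bubble v : bubble v -> SInt (div v) = 0.
Proof.
move=> V; have /fin_all_exists[g gE] := fun i => lam_factor wu s0 (V i).
exact: SInt_div gE.
Qed.

Lemma dotv_glam_eq0 v : (forall i, dotv (glam i) v = 0) -> v = 0.
Proof.
move=> H; apply/matrixP => a b; rewrite (ord1 b) mxE.
transitivity (\sum_j edges w a j *: dotv (glam (lift ord0 j)) v); last first.
  by rewrite big1 // => j _; rewrite H scaler0.
rewrite /dotv; under eq_bigr do rewrite scaler_sumr.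
rewrite exchange_big /=.
transitivity (\sum_c (edges w *m invmx (edges w)) a c *: v c 0).
  rewrite mulmxV // (bigD1 a) //= mxE eqxx scale1r big1 ?addr0 // => c.
  by rewrite mxE eq_sym => /negPf ->; rewrite scale0r.
apply: eq_bigr => c _; rewrite mxE scaler_suml; apply: eq_bigr => j _.
by rewrite scalerA /glam liftK !mxE.
Qed.

Lemma div_scale p v : div (p *: v) = p * div v + pdot v (grad p).
Proof.
rewrite /div mulr_sumr -big_split; apply: eq_bigr => i _ /=.
by rewrite !mxE mderivM addrC mulrC [X in _ + X]mulrC.
Qed.

Lemma bubble_scale p v : bubble v -> bubble (p *: v).
Proof.
move=> V i; have -> : dotv (glam i) (p *: v) = p * dotv (glam i) v.
  by rewrite /dotv mulr_sumr; apply: eq_bigr => a _; rewrite mxE scalerAr.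
exact: vanishes_mull.
Qed.

Lemma SInt_grad p v : bubble v -> SInt (pdot v (grad p)) = - SInt (p * div v).
Proof.
move=> V; apply/eqP; rewrite -addr_eq0 addrC -raddfD -div_scale.
by rewrite /= SInt_div_bubble //; exact: bubble_scale.
Qed.

(** Writing glam_i . v = lam_i g_i, the test field is the sum of the g_i glam_i: its pairing with v
    is the sum of the lam_i g_i^2, nonnegative on the simplex. *)
Lemma bubble_eq0 m v : Pmx m.+1 v -> bubble v ->
  (forall q : 'cV[A]_s, Pmx m q -> SInt (pdot v q) = 0) -> v = 0.
Proof.
move=> vm V H; have /fin_all_exists[g gE] := fun i => lam_factor wu s0 (V i).
have gm i : (msize (g i) <= m.+1)%N.
  apply: (@msize_lam_factor i); rewrite -gE /dotv; apply: msize_sum_bound => a _.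
  exact/msizeZ_bound/vm.
pose q : 'cV[A]_s := \col_a \sum_i glam i a 0 *: g i.
have qm : Pmx m q.
  by move=> a b; rewrite /Ppoly /= mxE; apply: msize_sum_bound => i _; exact/msizeZ_bound/gm.
have vq : pdot v q = \sum_i lam i * (g i * g i).
  transitivity (\sum_i dotv (glam i) v * g i); last first.
    by apply: eq_bigr => i _; rewrite gE mulrA.
  rewrite /pdot; under eq_bigr do rewrite mxE mulr_sumr.
  rewrite exchange_big; apply: eq_bigr => i _ /=; rewrite /dotv mulr_suml.
  by apply: eq_bigr => a _; rewrite -scalerAr -scalerAl.
apply: dotv_glam_eq0 => i; rewrite gE.
have /eqP : lam i * (g i * g i) = 0.
  apply: (SInt_sum_eq0 (P := xpredT) (F := fun i => lam i * (g i * g i))) => //; last first.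
    by rewrite -vq; exact: H.
  by move=> j _ y y0; rewrite !evM mulr_ge0 // -expr2 sqr_ge0.
by rewrite !mulf_eq0 orbb => /orP[] /eqP ->; rewrite ?mul0r ?mulr0.
Qed.

Lemma bubble_divfree_eq0 m v : Pmx m.+1 v -> bubble v -> div v = 0 ->
  (forall B, Pmx (m - 1) B -> Defs.skewmx B -> SInt (pdot v (B *m x)) = 0) -> v = 0.
Proof.
move=> vm V dv H; apply: (bubble_eq0 vm V) => q qm.
have [p [B [pm Bm skB ->]]] := grad_decomp qm.
have -> : pdot v (grad p + B *m x) = pdot v (grad p) + pdot v (B *m x).
  by rewrite /pdot -big_split; apply: eq_bigr => a _; rewrite mxE mulrDr.
have E1 : SInt (pdot v (grad p)) = 0 by rewrite SInt_grad // dv mulr0 raddf0 oppr0.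
have E2 := H B Bm skB.
by rewrite [LHS]raddfD /= E1 E2 addr0.
Qed.

(** Integration by parts turns the hypothesis into the vanishing of the integral of (div v)^2. *)
Lemma div_eq0 v : bubble v -> SInt (pdot v (grad (div v))) = 0 -> div v = 0.
Proof.
by move=> V; rewrite SInt_grad // => /eqP; rewrite oppr_eq0 => /eqP /SInt_sq_eq0.
Qed.

Lemma bubble_mulmx tau u : symmx tau -> tbubble tau -> bubble (tau *m u).
Proof.
move=> st V i.
have -> : dotv (glam i) (tau *m u) = \sum_a u a 0 * dotv (glam i) (row a tau)^T.
  rewrite /dotv; under eq_bigr do rewrite mxE scaler_sumr.
  rewrite exchange_big; apply: eq_bigr => a _ /=; rewrite mulr_sumr.
  by apply: eq_bigr => b _; rewrite -{1}st !mxE mulrC scalerAr.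
by apply: vanishes_sum => a _; apply: vanishes_mull.
Qed.

Lemma div_mulmx tau u : symmx tau ->
  div (tau *m u) = pdot (divmx tau) u + mdot tau (symgrad u).
Proof.
move=> st.
have -> : mdot tau (symgrad u) = \sum_a \sum_b tau a b * mderiv b (u a 0).
  have E : \sum_a \sum_b tau a b * mderiv b (u a 0) = \sum_a \sum_b tau a b * mderiv a (u b 0).
    rewrite exchange_big; apply: eq_bigr => a _; apply: eq_bigr => b _.
    by rewrite -{1}st mxE.
  rewrite -[RHS]scale_half {2}E -big_split scaler_sumr; apply: eq_bigr => a _ /=.
  rewrite -big_split scaler_sumr; apply: eq_bigr => b _ /=.
  by rewrite mxE -scalerAr mulrDr.
rewrite /div /pdot; under eq_bigr do rewrite mxE raddf_sum /=.
rewrite exchange_big -big_split; apply: eq_bigr => a _ /=.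
rewrite mxE /div mulr_suml -big_split; apply: eq_bigr => b _ /=.
have e : tau b a = tau a b by rewrite -{1}st mxE.
by rewrite !mxE e mderivM.
Qed.

Lemma SInt_symgrad tau u : symmx tau -> tbubble tau ->
  SInt (mdot tau (symgrad u)) = - SInt (pdot (divmx tau) u).
Proof.
move=> st V; apply/eqP; rewrite -addr_eq0 addrC -raddfD -div_mulmx //=.
by rewrite SInt_div_bubble //; exact: bubble_mulmx.
Qed.

Let gg i j tau : A := \sum_a \sum_b (glam i a 0 * glam j b 0) *: tau a b.

Let ggE i j tau : gg i j tau = dotv (glam i) (\col_a dotv (glam j) (row a tau)^T).
Proof.
rewrite /gg /dotv; apply: eq_bigr => a _; rewrite mxE scaler_sumr; apply: eq_bigr => b _.
by rewrite scalerA !mxE.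
Qed.

Let gg_sym i j tau : symmx tau -> gg i j tau = gg j i tau.
Proof.
move=> st; rewrite /gg exchange_big; apply: eq_bigr => a _; apply: eq_bigr => b _.
by rewrite -{1}st mxE mulrC.
Qed.

(* tau is tested against the sum over i != j of p_ij glam_i glam_j^T, where
   glam_i^T tau glam_j = lam_i lam_j p_ij. *)
Lemma tbubble_eq0 m tau : Pmx m.+2 tau -> symmx tau -> tbubble tau ->
  (forall q, Pmx m q -> symmx q -> SInt (mdot tau q) = 0) -> tau = 0.
Proof.
move=> tm st V H.
have Vr i j : vanishes (lam j) (gg i j tau).
  rewrite ggE; apply: vanishes_sum => a _ y ly; rewrite evZ mxE V ?mulr0 //.
have ex (ij : 'I_s.+1 * 'I_s.+1) : exists p, ij.1 != ij.2 -> gg ij.1 ij.2 tau = lam ij.1 * (lam ij.2 * p).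
  case: ij => i j /=; have [->|ij] := eqVneq i j; first by exists 0.
  have Vl : vanishes (lam i) (gg i j tau) by rewrite gg_sym.
  have [p' e'] := lam_factor wu s0 Vl.
  have Vp : vanishes (lam j) p'.
    apply: (lam_prime wu s0 (p := lam i)); first by rewrite -e'.
    by apply: lam_not_vanishes => //; rewrite eq_sym.
  by have [p'' e''] := lam_factor wu s0 Vp; exists p'' => _; rewrite e' e''.
have /fin_all_exists[P PE] := ex.
have {}PE i j : i != j -> gg i j tau = lam i * (lam j * P (i, j)) by exact: (PE (i, j)).
pose T (ij : 'I_s.+1 * 'I_s.+1) := ij.1 != ij.2.
pose q : 'M[A]_s := \matrix_(a, b) \sum_(ij | T ij) (glam ij.1 a 0 * glam ij.2 b 0) *: P ij.
have Psym i j : i != j -> P (i, j) = P (j, i).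
  move=> ij; apply: (mulfI (lam_neq0 j)); apply: (mulfI (lam_neq0 i)).
  by rewrite -PE // mulrCA -PE 1?eq_sym // gg_sym.
have sq : symmx q.
  apply/matrixP => a b; rewrite !mxE.
  have swapK : involutive (fun z : 'I_s.+1 * 'I_s.+1 => (z.2, z.1)) by case.
  rewrite (reindex_inj (inv_inj swapK)) /=; apply: eq_big => [[i j]|[i j] ij] /=.
    by rewrite /T /= eq_sym.
  by rewrite mulrC Psym // eq_sym.
have qm : Pmx m q.
  move=> a b; rewrite /Ppoly /= mxE; apply: msize_sum_bound => -[i j] ij.
  apply/msizeZ_bound/(@msize_lam_factor j)/(@msize_lam_factor i); rewrite -PE //.
  by apply: msize_sum_bound => c _; apply: msize_sum_bound => e _; exact/msizeZ_bound/tm.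
have tq : mdot tau q = \sum_(ij | T ij) lam ij.1 * (lam ij.2 * (P ij * P ij)).
  transitivity (\sum_(ij | T ij) gg ij.1 ij.2 tau * P ij); last first.
    by apply: eq_bigr => -[i j] ij; rewrite PE //= !mulrA.
  rewrite /mdot; under eq_bigr do under eq_bigr do rewrite mxE mulr_sumr.
  under eq_bigr do rewrite exchange_big.
  rewrite exchange_big; apply: eq_bigr => ij _ /=; rewrite /gg mulr_suml.
  apply: eq_bigr => a _; rewrite mulr_suml.
  by apply: eq_bigr => b _; rewrite -scalerAr -scalerAl.
have gg0 i j : i != j -> gg i j tau = 0.
  move=> ij; rewrite PE //.
  have /eqP : lam i * (lam j * (P (i, j) * P (i, j))) = 0.
    apply: (SInt_sum_eq0 (P := T) (F := fun ij => lam ij.1 * (lam ij.2 * (P ij * P ij))) _ _ (i := (i, j))) => //.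
      move=> z _ y y0; rewrite !evM; apply: mulr_ge0; first exact: y0.
      by apply: mulr_ge0; [exact: y0|rewrite -expr2 sqr_ge0].
    by rewrite -tq H.
  by rewrite !mulf_eq0 orbb => /or3P[] /eqP ->; rewrite ?mul0r ?mulr0.
(* The diagonal components follow from the mixed ones, as the [glam k] sum to zero. *)
have {gg0} gg0 i j : gg i j tau = 0.
  have [->|] := eqVneq i j; last exact: gg0.
  have : \sum_k gg k j tau = 0.
    rewrite /gg exchange_big big1 // => a _; rewrite exchange_big big1 // => b _ /=.
    by rewrite -scaler_suml -mulr_suml -summxE glam_sum mxE mul0r scale0r.
  by rewrite (bigD1 j) //= [X in _ + X]big1 ?addr0 // => k /gg0.
have C0 j : \col_a dotv (glam j) (row a tau)^T = 0.
  by apply: dotv_glam_eq0 => i; rewrite -ggE.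
apply/matrixP => a b; rewrite mxE.
have R0 : (row a tau)^T = 0.
  apply: dotv_glam_eq0 => j; have := congr1 (fun v : 'cV[A]_s => v a 0) (C0 j).
  by rewrite !mxE.
by have := congr1 (fun v : 'cV[A]_s => v b 0) R0; rewrite !mxE.
Qed.

Lemma tbubble_divfree_eq0 m tau : Pmx m.+2 tau -> symmx tau -> tbubble tau -> divmx tau = 0 ->
  (forall q, kerx m q -> SInt (mdot tau q) = 0) -> tau = 0.
Proof.
move=> tm st V dt H; apply: (tbubble_eq0 tm st V) => q qm sq.
have [u [k [um km ->]]] := symgrad_decomp qm sq.
have -> : mdot tau (symgrad u + k) = mdot tau (symgrad u) + mdot tau k.
  rewrite /mdot -big_split; apply: eq_bigr => a _; rewrite -big_split.
  by apply: eq_bigr => b _; rewrite [X in _ * X]mxE mulrDr.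
have E1 : SInt (mdot tau (symgrad u)) = 0.
  rewrite SInt_symgrad // dt /pdot big1 ?raddf0 ?oppr0 // => a _.
  by rewrite mxE mul0r.
by rewrite [LHS]raddfD /= E1 H // addr0.
Qed.

End Bubbles.

(** * Real subspaces of polynomial modules *)

Lemma sub_row_base (F : fieldType) l m k (M : 'M[F]_(l, m)) (B : 'M[F]_(k, m)) :
  (B <= row_base M)%MS = (B <= M)%MS.
Proof. by rewrite eq_row_base. Qed.

Section RealSubspaces.
Variables (R : realType) (n : nat).
Local Notation A := {mpoly R[n]}.

Definition rscale (U : lmodType A) (c : R) (u : U) : U := mpolyC n c *: u.

Definition rsubspace (U : lmodType A) (Q : set U) :=
  Q 0 /\ forall c u v, Q u -> Q v -> Q (rscale c u + v).

Definition rlinear (U V : lmodType A) (f : U -> V) :=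
  forall c u v, f (rscale c u + v) = rscale c (f u) + f v.

Definition lincomb (U : lmodType A) m (b : 'I_m -> U) (c : 'rV[R]_m) : U :=
  \sum_i rscale (c 0 i) (b i).

Section Lincomb.
Variables (U : lmodType A).

Lemma rscale1 (u : U) : rscale 1 u = u. Proof. by rewrite /rscale mpolyC1 scale1r. Qed.
Lemma rscale0 (u : U) : rscale 0 u = 0. Proof. by rewrite /rscale mpolyC0 scale0r. Qed.

Lemma lincombD m (b : 'I_m -> U) a (c c' : 'rV[R]_m) :
  lincomb b (a *: c + c') = rscale a (lincomb b c) + lincomb b c'.
Proof.
rewrite /lincomb /rscale scaler_sumr -big_split; apply: eq_bigr => i _ /=.
by rewrite !mxE mpolyCD mpolyCM scalerDl scalerA.
Qed.

Lemma lincomb0 m (b : 'I_m -> U) : lincomb b 0 = 0.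
Proof. by rewrite /lincomb big1 // => i _; rewrite mxE rscale0. Qed.

Lemma lincomb_delta m (b : 'I_m -> U) i : lincomb b (delta_mx 0 i) = b i.
Proof.
rewrite /lincomb (bigD1 i) //= mxE !eqxx rscale1 big1 ?addr0 // => j /negPf ji.
by rewrite mxE ji andbF rscale0.
Qed.

Lemma lincomb_mul m l (b : 'I_m -> U) (M : 'M[R]_(l, m)) c :
  lincomb (fun i => lincomb b (row i M)) c = lincomb b (c *m M).
Proof.
rewrite /lincomb; under eq_bigr do rewrite /rscale scaler_sumr.
rewrite exchange_big; apply: eq_bigr => j _ /=.
rewrite [in RHS]/rscale mxE raddf_sum scaler_suml; apply: eq_bigr => i _.
by rewrite /rscale scalerA -mpolyCM mxE.
Qed.

End Lincomb.

Section Subspace.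
Variables (U V : lmodType A).
Implicit Types (Q P : set U) (f : U -> V).

Lemma rlinear0 f : rlinear f -> f 0 = 0.
Proof.
move=> fl; have := fl (-1) 0 0; rewrite /rscale scaler0 addr0 => ->.
by rewrite mpolyCN mpolyC1 scaleN1r addNr.
Qed.

Lemma rlinearD f u v : rlinear f -> f (u + v) = f u + f v.
Proof. by move=> fl; have := fl 1 u v; rewrite !rscale1. Qed.

Lemma rlinearZ f c u : rlinear f -> f (rscale c u) = rscale c (f u).
Proof. by move=> fl; have := fl c u 0; rewrite !addr0 rlinear0 // addr0. Qed.

Lemma rlinear_lincomb f m (b : 'I_m -> U) c :
  rlinear f -> f (lincomb b c) = lincomb (f \o b) c.
Proof.
move=> fl; rewrite /lincomb; elim/big_ind2: _ => [|x x' y y' ex ey|i _]; first exact: rlinear0.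
  by rewrite rlinearD // ex ey.
exact: rlinearZ.
Qed.

Lemma rsubspaceB Q u v : rsubspace Q -> Q u -> Q v -> Q (u - v).
Proof.
by move=> [_ QD] Qu /(QD (-1) v u) /(_ Qu); rewrite /rscale mpolyCN mpolyC1 scaleN1r addrC.
Qed.

Lemma has_dimP Q m : has_dim Q m <-> exists b : 'I_m -> U,
  (forall c, lincomb b c = 0 -> c = 0) /\ (forall u, Q u <-> exists c, u = lincomb b c).
Proof.
have rowE (c : 'I_m -> R) (b : 'I_m -> U) : \sum_i mpolyC n (c i) *: b i = lincomb b (\row_i c i).
  by apply: eq_bigr => i _; rewrite mxE.
split=> -[b [li sp]]; exists b; split.
- move=> c c0; apply/rowP => i; rewrite mxE; apply: (li (fun i => c 0 i)).
  by rewrite rowE -[RHS]c0; congr lincomb; apply/rowP => j; rewrite mxE.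
- move=> u; split=> [/sp[c ->]|[c ->]]; first by exists (\row_i c i); rewrite rowE.
  by apply/sp; exists (fun i => c 0 i).
- move=> c; rewrite rowE => /li c0 i; have := congr1 (fun r : 'rV_m => r 0 i) c0.
  by rewrite !mxE.
- move=> u; split=> [/sp[c ->]|[c ->]]; last by apply/sp; exists (\row_i c i); rewrite rowE.
  by exists (fun i => c 0 i).
Qed.

Lemma has_dim_rsubspace Q m : has_dim Q m -> rsubspace Q.
Proof.
move=> /has_dimP[b [_ sp]]; split; first by apply/sp; exists 0; rewrite lincomb0.
move=> c u v /sp[cu ->] /sp[cv ->]; apply/sp; exists (c *: cu + cv); by rewrite lincombD.
Qed.

Lemma has_dim_le Q P m l : has_dim Q m -> has_dim P l -> P `<=` Q -> (l <= m)%N.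
Proof.
move=> /has_dimP[b [_ sp]] /has_dimP[b' [li' sp']] PQ.
have H i : exists c, b' i = lincomb b c.
  by apply/sp/PQ/sp'; exists (delta_mx 0 i); rewrite lincomb_delta.
have [c cE] := choice H; pose M : 'M[R]_(l, m) := \matrix_i c i.
have kM (r : 'rV_l) : r *m M = 0 -> r = 0.
  move=> rM; apply: li'; rewrite -[RHS](lincomb0 b) -rM -lincomb_mul.
  by apply: eq_bigr => i _; rewrite rowK cE.
have : row_free M.
  rewrite -kermx_eq0; apply/eqP/row_matrixP => i; rewrite row0; apply: kM.
  by rewrite -row_mul mulmx_ker row0.
by move=> /eqP <-; exact: rank_leq_col.
Qed.

Lemma has_dim_ext Q P m : has_dim Q m -> (forall u, Q u <-> P u) -> has_dim P m.
Proof.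
move=> [b [li sp]] QP; exists b; split=> // u.
by split=> [/QP /sp|/sp /QP].
Qed.

Lemma has_dim_uniq Q m l : has_dim Q m -> has_dim Q l -> m = l.
Proof.
by move=> Qm Ql; apply/eqP; rewrite eqn_leq (has_dim_le Ql Qm) // (has_dim_le Qm Ql).
Qed.

Lemma rdimE Q m : has_dim Q m -> rdim Q = m.
Proof.
move=> Qm; rewrite /rdim; have := @xgetPex _ 0%N _ (ex_intro (has_dim Q) m Qm).
by move=> /has_dim_uniq; exact.
Qed.

(* M has maximal rank among the matrices with rows in P. *)
Lemma rV_subspace m (P : set 'rV[R]_m) : P 0 ->
  (forall a c c', P c -> P c' -> P (a *: c + c')) ->
  exists M : 'M[R]_m, forall c, P c <-> (c <= M)%MS.
Proof.
move=> P0 PD.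
have Psub l (M : 'M[R]_(l, m)) : (forall i, P (row i M)) -> forall c, (c <= M)%MS -> P c.
  move=> MP c /submxP[D ->]; rewrite mulmx_sum_row.
  elim/big_ind: _ => // [x y Px Py|i _]; first by rewrite -[x]scale1r; exact: PD.
  by rewrite -[_ *: _]addr0; apply: PD.
pose good r := `[< exists M : 'M[R]_m, (forall i, P (row i M)) /\ \rank M = r >].
have g0 : exists r, good r.
  by exists 0%N; apply/asboolP; exists 0; split=> [i|]; rewrite ?row0 ?mxrank0.
have gm r : good r -> (r <= m)%N by move=> /asboolP[M [_ <-]]; exact: rank_leq_row.
case: (ex_maxnP g0 gm) => r /asboolP[M [MP rM]] rmax.
exists M => c; split=> [Pc|]; last exact: Psub.
have MS : forall u, (u <= M + c)%MS -> P u.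
  move=> u /sub_addsmxP[[u1 u2] /= ->]; rewrite addrC.
  rewrite (mx11_scalar u2) mul_scalar_mx; apply: PD => //.
  by apply: (Psub _ M) => //; exact: submxMl.
have : (\rank (M + c)%MS <= \rank M)%N.
  rewrite rM; apply: rmax; apply/asboolP; exists (M + c)%MS; split=> // i.
  by apply: MS; exact: row_sub.
rewrite (geq_leqif (mxrank_leqif_sup (addsmxSl M c))).
by apply: submx_trans; exact: addsmxSr.
Qed.

Lemma rsubspace_has_dim Q P m : has_dim Q m -> rsubspace P -> P `<=` Q -> exists l, has_dim P l.
Proof.
move=> /has_dimP[b [li sp]] Psub PQ.
have [|a c c'|M ME] := @rV_subspace m [set c | P (lincomb b c)].
- by rewrite /= lincomb0; exact: Psub.1.
- by rewrite /= lincombD => *; exact: Psub.2.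
exists (\rank M); apply/has_dimP; exists (fun i => lincomb b (row i (row_base M))); split=> [c|u].
  rewrite lincomb_mul => /li /eqP; rewrite mulmx_free_eq0 ?row_base_free // => /eqP //.
split=> [Pu|[c ->]]; last first.
  by rewrite lincomb_mul; apply/ME; rewrite -sub_row_base submxMl.
have /sp[c uc] := PQ _ Pu.
have : (c <= M)%MS by apply/ME; rewrite /= -uc.
rewrite -sub_row_base => /submxP[c' cc']; exists c'.
by rewrite lincomb_mul -cc'.
Qed.

End Subspace.
Section RankNullity.
Variables (U V : lmodType A) (f : U -> V) (Q : set U).
Hypothesis fl : rlinear f.

(** In coordinates the kernel is the row space of M, and f is injective on the complement [M^C]. *)
Lemma rank_nullity m : has_dim Q m -> exists a b,
  [/\ has_dim [set u | Q u /\ f u = 0] a, has_dim (f @` Q) b & m = (a + b)%N].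
Proof.
move=> Qm; have [b [li sp]] := (has_dimP Q m).1 Qm.
have [||M ME] := @rV_subspace m [set c | f (lincomb b c) = 0].
- by rewrite /= lincomb0 rlinear0.
- by move=> a c c' /= e e'; rewrite lincombD fl e e' /rscale scaler0 addr0.
pose K := row_base M; pose C := row_base (M^C)%MS.
have E c : f (lincomb b c) = 0 <-> (c <= M)%MS by exact: ME.
exists (\rank M), (\rank (M^C)%MS); split; last first.
- by rewrite mxrank_compl subnKC // rank_leq_row.
- apply/has_dimP; exists (fun i => f (lincomb b (row i C))); split=> [c|v].
    have -> : lincomb (fun i => f (lincomb b (row i C))) c = f (lincomb b (c *m C)).
      by rewrite -lincomb_mul rlinear_lincomb.
    move=> /E cM; have : (c *m C <= M :&: M^C)%MS.
      by rewrite sub_capmx cM -sub_row_base submxMl.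
    by rewrite capmx_compl submx0 mulmx_free_eq0 ?row_base_free // => /eqP.
  split=> [[u /sp[c ->] <-]|[c ->]].
    have : (c <= M + M^C)%MS by apply: submx_full; rewrite addsmx_compl_full.
    move=> /sub_addsmxP[[c1 c2] /= ->].
    have : (c2 *m M^C <= C)%MS by rewrite sub_row_base submxMl.
    move=> /submxP[c' ->]; exists c'.
    rewrite -[c1 *m M]scale1r lincombD rscale1 rlinearD //.
    have /E -> : (c1 *m M <= M)%MS by exact: submxMl.
    by rewrite add0r -lincomb_mul rlinear_lincomb.
  exists (lincomb b (c *m C)); first by apply/sp; exists (c *m C).
  by rewrite -lincomb_mul rlinear_lincomb.
- apply/has_dimP; exists (fun i => lincomb b (row i K)); split=> [c|u].
    by rewrite lincomb_mul => /li /eqP; rewrite mulmx_free_eq0 ?row_base_free // => /eqP.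
  split=> [[/sp[c ->] /E]|[c ->]].
    by rewrite -sub_row_base => /submxP[c' ->]; exists c'; rewrite lincomb_mul.
  rewrite lincomb_mul; split; first by apply/sp; exists (c *m K).
  by apply/E; rewrite -sub_row_base submxMl.
Qed.

End RankNullity.

Lemma has_dim_fin (U : lmodType A) (I : finType) (b : I -> U) (Q : set U) :
  (forall c : I -> R, \sum_i rscale (c i) (b i) = 0 -> forall i, c i = 0) ->
  (forall u, Q u <-> exists c : I -> R, u = \sum_i rscale (c i) (b i)) -> has_dim Q #|I|.
Proof.
move=> li sp; have reidx (c : I -> R) :
    \sum_i rscale (c i) (b i) = \sum_(j < #|I|) rscale (c (enum_val j)) (b (enum_val j)).
  by rewrite (reindex (@enum_val I I)) //; exact/onW_bij/enum_val_bij.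
have idx (c : 'I_#|I| -> R) : \sum_(j < #|I|) rscale (c j) (b (enum_val j)) =
    \sum_i rscale (c (enum_rank i)) (b i).
  by rewrite reidx; apply: eq_bigr => j _; rewrite enum_valK.
exists (fun j : 'I_#|I| => b (enum_val j)); split=> [c|u].
  by rewrite -/(rscale _ _) => e i; have := li (fun i => c (enum_rank i));
    rewrite -idx => /(_ e (enum_val i)); rewrite enum_valK.
split=> [/sp[c ->]|[c ->]]; first by exists (fun j => c (enum_val j)); rewrite reidx.
by apply/sp; exists (fun i => c (enum_rank i)); rewrite -idx.
Qed.

(** * Orthogonal complements for a definite symmetric form *)

Section Orthogonal.
Variables (U : lmodType A) (bf : U -> U -> R) (Q W : set U).
Hypotheses (bfl : forall w, forall c u v, bf (rscale c u + v) w = c * bf u w + bf v w)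
  (bfC : forall u v, bf u v = bf v u) (bf_def : forall u, bf u u = 0 -> u = 0).
Variables (m p : nat).
Hypotheses (Qm : has_dim Q m) (Wp : has_dim W p) (WQ : W `<=` Q).

Let orth : set U := [set q | Q q /\ forall w, W w -> bf q w = 0].

Lemma bf_lincomb l (b : 'I_l -> U) c w : bf (lincomb b c) w = \sum_i c 0 i * bf (b i) w.
Proof.
have bf0 : bf 0 w = 0.
  by have := bfl w (-1) 0 0; rewrite /rscale scaler0 addr0 => ->; rewrite mulN1r addNr.
have bfD : {morph bf^~ w : u v / u + v >-> u + v}.
  by move=> u v; rewrite -{1}[u]rscale1 bfl mul1r.
rewrite /lincomb (big_morph (bf^~ w) bfD bf0); apply: eq_bigr => i _.
by rewrite -[rscale _ _]addr0 bfl bf0 addr0.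
Qed.

(** A vector in the kernel of the Gram matrix is the coordinate vector of a combination orthogonal
    to itself. *)
Lemma gram_unit l (b : 'I_l -> U) : (forall c, lincomb b c = 0 -> c = 0) ->
  (\matrix_(i, j) bf (b i) (b j)) \in unitmx.
Proof.
move=> li; set G := \matrix_(i, j) _.
rewrite -row_free_unit -kermx_eq0; apply/eqP/row_matrixP => i; rewrite row0.
set c := row i _; have cG : c *m G = 0 by rewrite -row_mul mulmx_ker row0.
apply: li; apply: bf_def; rewrite bf_lincomb big1 // => j _.
rewrite bfC bf_lincomb; have := congr1 (fun r : 'rV_l => r 0 j) cG.
rewrite mxE [RHS]mxE => e; apply/eqP; rewrite mulf_eq0; apply/orP; right; apply/eqP.
by rewrite -[RHS]e; apply: eq_bigr => k _; rewrite /G [X in _ = _ * X]mxE.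
Qed.

Lemma orthogonal_proj q : Q q -> exists2 w, W w & orth (q - w).
Proof.
have [b [li sp]] := (has_dimP W p).1 Wp.
pose G : 'M[R]_p := \matrix_(i, j) bf (b i) (b j).
have Gu : G \in unitmx := gram_unit li.
(* The normal equations of the least-squares problem. *)
move=> Qq; pose c := (\row_j bf q (b j)) *m invmx G.
have Ww : W (lincomb b c) by apply/sp; exists c.
exists (lincomb b c) => //; split; first exact: (rsubspaceB (has_dim_rsubspace Qm)) (WQ Ww).
have bfB u v w : bf (u - v) w = bf u w - bf v w.
  have := bfl w (-1) v u; rewrite /rscale mpolyCN mpolyC1 scaleN1r addrC => ->.
  by rewrite mulN1r addrC.
move=> w /sp[c' ->]; rewrite bfB; apply/eqP; rewrite subr_eq0; apply/eqP.
rewrite bfC [RHS]bfC !bf_lincomb; apply: eq_bigr => j _; congr (_ * _).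
rewrite bfC [RHS]bfC bf_lincomb; have : c *m G = \row_j bf q (b j) by rewrite /c mulmxKV.
move/(congr1 (fun r : 'rV_p => r 0 j)); rewrite mxE [RHS]mxE => <-.
by apply: eq_bigr => k _; rewrite /G [X in _ * X = _]mxE.
Qed.

(* [f] below has kernel [orth] and image W. *)
Lemma has_dim_orthogonal : has_dim orth (m - p).
Proof.
have [b [li sp]] := (has_dimP W p).1 Wp.
pose f (q : U) : U := lincomb b (\row_j bf q (b j)).
have fl : rlinear f.
  move=> c u v; rewrite /f -lincombD; congr lincomb; apply/rowP => j.
  by rewrite !mxE bfl.
have f0 q : f q = 0 <-> forall w, W w -> bf q w = 0.
  split=> [/li q0 w /sp[c ->]|H]; last first.
    rewrite /f (_ : \row_j _ = 0) ?lincomb0 //; apply/rowP => j; rewrite !mxE H //.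
    by apply/sp; exists (delta_mx 0 j); rewrite lincomb_delta.
  rewrite bfC bf_lincomb big1 // => j _; rewrite bfC.
  have := congr1 (fun r : 'rV_p => r 0 j) q0; rewrite !mxE => ->; exact: mulr0.
have [a [b' [Ka Ib ->]]] := rank_nullity fl Qm.
have orthE u : orth u <-> Q u /\ f u = 0 by split=> -[Qu] /f0.
have Oa : has_dim orth a.
  by apply: (has_dim_ext Ka) => u; split=> /orthE.
suff -> : p = b' by rewrite addnK.
apply: (has_dim_uniq Wp); apply: (has_dim_ext Ib) => w; split=> [[u Qu <-]|Ww].
  by apply/sp; exists (\row_j bf u (b j)).
have [c ->] := (sp w).1 Ww; exists (lincomb b (c *m invmx (\matrix_(i, j) bf (b i) (b j)))).
  by apply: WQ; apply/sp; eexists.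
rewrite /f; congr lincomb; rewrite -[RHS](mulmxKV (gram_unit li)).
apply/rowP => j; rewrite [LHS]mxE bf_lincomb [RHS]mxE; apply: eq_bigr => k _.
by rewrite [X in _ = _ * X]mxE.
Qed.

End Orthogonal.

End RealSubspaces.

(** * Faces in Cartesian coordinates *)

Section AffineFrame.
Variables (R : realType) (d s : nat) (w : 'I_s.+1 -> 'cV[R]_d) (o : 'cV[R]_d) (T : 'M[R]_(d, s)).
Hypotheses (cf : cartesian_frame w o T) (free : forall c : 'cV[R]_s, edges w *m c = 0 -> c = 0).

Let om i := coords o T (w i).

Let TT1 : T^T *m T = 1%:M. Proof. by case: cf. Qed.

Lemma frame_proj (z : 'cV[R]_d) : (exists c : 'cV[R]_s, z = edges w *m c) -> T *m (T^T *m z) = z.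
Proof.
by case: cf => _ H _ /H[c ->]; rewrite [T^T *m _]mulmxA TT1 mul1mx.
Qed.

Lemma frame_vertex i : T *m om i = w i - o.
Proof.
apply: frame_proj; case: cf => _ _ [c ->].
have [c' ->] : exists c' : 'cV[R]_s, w i = w ord0 + edges w *m c'.
  case: (unliftP ord0 i) => [j|] ->; last by exists (0 : 'cV[R]_s); rewrite mulmx0 addr0.
  exists (delta_mx j 0); rewrite -colE; apply/matrixP => a b.
  by rewrite !mxE (ord1 b) addrC subrK.
by exists (c' - c); rewrite mulmxBr opprD addrACA subrr add0r.
Qed.

Lemma edges_frame : edges om = T^T *m edges w.
Proof.
apply/matrixP => i j; rewrite mxE.
have e : om (lift ord0 j) - om ord0 = T^T *m (w (lift ord0 j) - w ord0).
  by rewrite /om /coords -mulmxBr opprB addrA subrK.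
transitivity ((T^T *m (w (lift ord0 j) - w ord0)) i 0); first by rewrite -e !mxE.
by rewrite !mxE; apply: eq_bigr => k _; rewrite !mxE.
Qed.

Lemma frame_edges (c : 'cV[R]_s) : T *m (T^T *m (edges w *m c)) = edges w *m c.
Proof. by apply: frame_proj; exists c. Qed.

Lemma frame_edgesM : T *m (T^T *m edges w) = edges w.
Proof.
apply/matrixP => i j; have := congr1 (fun z : 'cV[R]_d => z i 0) (frame_edges (delta_mx j 0)).
by rewrite !mulmxA -!colE [LHS]mxE [RHS]mxE => <-.
Qed.

Lemma edges_frame_unit : edges om \in unitmx.
Proof.
rewrite -unitmx_tr -row_free_unit -kermx_eq0; apply/eqP/row_matrixP => i; rewrite row0.
set c := row i _; have : c *m (edges om)^T = 0 by rewrite -row_mul mulmx_ker row0.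
move/(congr1 trmx); rewrite trmx_mul trmxK trmx0 edges_frame -mulmxA => e.
apply: trmx_inj; rewrite trmx0; apply: free.
by rewrite -frame_edges e mulmx0.
Qed.

Lemma frame_barycentric y : o + T *m y = \sum_i ev (lam om i) y *: w i.
Proof.
rewrite {1}(barycentric edges_frame_unit y) mulmx_sumr.
have e1 : \sum_i ev (lam om i) y = 1 by rewrite -ev_sum lam_sum ev1.
rewrite -{1}(scale1r o) -e1 scaler_suml -big_split; apply: eq_bigr => i _ /=.
by rewrite -scalemxAr frame_vertex -scalerDr addrC subrK.
Qed.

Lemma frame_std_pt t : w ord0 + edges w *m t = o + T *m (om ord0 + edges om *m t).
Proof.
by rewrite mulmxDr frame_vertex edges_frame -mulmxA frame_edges addrA (addrC o) subrK.
Qed.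

Lemma coords_frame y : coords o T (o + T *m y) = y.
Proof. by rewrite /coords addrC addKr mulmxA TT1 mul1mx. Qed.

(** T is an isometry, so the Gram determinant is the square of det (edges om). A single nonzero
    constant serves for all integrands, which suffices to move vanishing moments to the face
    coordinates. *)
Lemma simplex_int_frame : exists2 c, c != 0 &
  forall f G, (forall y, f (o + T *m y) = ev G y) -> simplex_int w f = c * SInt om G.
Proof.
exists (Num.sqrt (\det ((edges w)^T *m edges w))) => [|f G fG]; last first.
  rewrite /simplex_int /SInt /Int; congr (_ * std_int _ _); apply/funext => t.
  by rewrite ev_pull frame_std_pt fG.
have -> : (edges w)^T *m edges w = (edges om)^T *m edges om.
  rewrite edges_frame trmx_mul trmxK -mulmxA; congr (_ *m _).
  by rewrite frame_edgesM.
rewrite det_mulmx det_tr -expr2 sqrtr_sqr normr_eq0.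
by have := edges_frame_unit; rewrite unitmxE unitfE.
Qed.

Lemma frame_normal (u : 'cV[R]_d) : (edges w)^T *m u = 0 -> T^T *m u = 0.
Proof.
move=> Eu; apply/matrixP => j b; rewrite (ord1 b) [RHS]mxE.
pose e : 'cV[R]_s := delta_mx j 0.
have [c ec] : exists c : 'cV[R]_s, T *m e = edges w *m c.
  by case: cf => _ H _; apply/H; exists e.
have uE : u^T *m edges w = 0 by rewrite -[LHS]trmxK trmx_mul trmxK Eu trmx0.
transitivity ((u^T *m (T *m e)) 0 0); last by rewrite ec mulmxA uE mul0mx mxE.
by rewrite -colE !mxE; apply: eq_bigr => a _; rewrite !mxE mulrC.
Qed.

Lemma frame_normal_edges (u : 'cV[R]_d) : T^T *m u = 0 -> (edges w)^T *m u = 0.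
Proof. by move=> Tu; rewrite -frame_edgesM trmx_mul -mulmxA Tu mulmx0. Qed.

Lemma pull_frame_normal (u : 'cV[R]_d) : (edges w)^T *m u = 0 ->
  pull T o (dotv u (xvec R d)) = mpolyC s ((u^T *m o) 0 0).
Proof.
move=> /frame_normal Tu; apply: ev_inj => y; rewrite ev_pull evC /dotv ev_sum.
have uT : u^T *m T = 0 by rewrite -[LHS]trmxK trmx_mul trmxK Tu trmx0.
transitivity ((u^T *m (o + T *m y)) 0 0); last by rewrite mulmxDr mulmxA uT mul0mx addr0.
by rewrite [RHS]mxE; apply: eq_bigr => a _; rewrite evZ [xvec _ _ _ _]mxE evX [u^T _ _]mxE.
Qed.

End AffineFrame.

Section Faces.
Variables (R : realType) (d : nat) (v : 'I_d.+1 -> 'cV[R]_d).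
Hypothesis hv : edges v \in unitmx.
Implicit Types (S : {set 'I_d.+1}) (x u z : 'cV[R]_d).

(** Stated on vertex indices, like [aff_hull], so that passing to a subface is inclusion of index
    sets and faces of different dimensions need no change of frame. *)
Definition normal_to S u := forall i j, i \in S -> j \in S -> (u^T *m (v i - v j)) 0 0 = 0.

Definition aff_hull S x := exists l : 'I_d.+1 -> R,
  [/\ forall i, i \notin S -> l i = 0, \sum_i l i = 1 & x = \sum_i l i *: v i].

Lemma normal_to_sub S S' u : S' \subset S -> normal_to S u -> normal_to S' u.
Proof. by move=> /fintype.subsetP sS H i j /sS iS /sS jS; exact: H. Qed.

Lemma glam_diff a i j : ((glam v a)^T *m (v i - v j)) 0 0 = (a == i)%:R - (a == j)%:R.
Proof.
rewrite -!(ev_lam_vertex hv) !ev_lam (_ : v i - v j = (v i - v ord0) - (v j - v ord0)).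
  by rewrite mulmxBr mxE [X in _ + X]mxE opprD addrACA subrr add0r.
by rewrite opprB addrA subrK.
Qed.

Section Face.
Variables (r : nat) (S : {set 'I_d.+1}).
Hypothesis Sr : is_face r S.
Local Notation s := (d - r)%N.
Local Notation w := (face v r S).

Definition face_idx (i : 'I_s.+1) : 'I_d.+1 := nth ord0 (enum S) i.

Let size_enumS : size (enum S) = s.+1.
Proof. by rewrite -cardE; apply/eqP. Qed.

Lemma face_idx_in i : face_idx i \in S.
Proof. by rewrite -mem_enum mem_nth // size_enumS. Qed.

Lemma face_idx_inj : injective face_idx.
Proof.
by move=> i j /eqP; rewrite nth_uniq ?enum_uniq ?size_enumS // => /eqP /val_inj.
Qed.

Lemma face_idx_surj a : a \in S -> exists i, face_idx i = a.
Proof.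
move=> aS; have ia : (index a (enum S) < s.+1)%N by rewrite -size_enumS index_mem mem_enum.
by exists (Ordinal ia); rewrite /face_idx nth_index // mem_enum.
Qed.

(** The gradient of the barycentric coordinate of K at a vertex of the face reads off the
    coefficient of the corresponding edge. *)
Lemma face_free (c : 'cV[R]_s) : edges w *m c = 0 -> c = 0.
Proof.
move=> e; apply/matrixP => j b; rewrite (ord1 b) [RHS]mxE.
pose g := glam v (face_idx (lift ord0 j)).
transitivity ((g^T *m (edges w *m c)) 0 0); last by rewrite e mulmx0 mxE.
have gE k : (g^T *m edges w) 0 k = (j == k)%:R.
  transitivity ((g^T *m (w (lift ord0 k) - w ord0)) 0 0).
    by rewrite !mxE; apply: eq_bigr => a _; rewrite !mxE.
  rewrite /g glam_diff !(inj_eq face_idx_inj) (inj_eq (@lift_inj _ _)).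
  by rewrite [lift ord0 j == _]eq_sym (negPf (neq_lift _ _)) subr0.
rewrite mulmxA mxE (bigD1 j) //= big1 ?addr0 => [|k /negPf kj].
  by rewrite gE eqxx mul1r.
by rewrite gE eq_sym kj mul0r.
Qed.

Lemma face_normal u : (edges w)^T *m u = 0 <-> normal_to S u.
Proof.
have E j : ((edges w)^T *m u) j 0 = (u^T *m (w (lift ord0 j) - w ord0)) 0 0.
  by rewrite !mxE; apply: eq_bigr => a _; rewrite !mxE mulrC.
split=> [e|H]; last first.
  apply/matrixP => j b; rewrite (ord1 b) E [RHS]mxE.
  by apply: H; exact: face_idx_in.
have E0 i : (u^T *m (w i - w ord0)) 0 0 = 0.
  case: (unliftP ord0 i) => [j|] ->; last by rewrite subrr mulmx0 mxE.
  by rewrite -E e mxE.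
move=> a b aS bS; have [i <-] := face_idx_surj aS; have [j <-] := face_idx_surj bS.
have -> : v (face_idx i) - v (face_idx j) = (w i - w ord0) - (w j - w ord0).
  by rewrite opprB addrA subrK.
by rewrite mulmxBr mxE E0 [X in _ + X]mxE E0 subrr.
Qed.

Variables (o : 'cV[R]_d) (T : 'M[R]_(d, s)).
Hypothesis cf : cartesian_frame w o T.
Local Notation om := (fun i => coords o T (w i)).

Let sum_fibers y : \sum_a \sum_(j | face_idx j == a) ev (lam om j) y = 1.
Proof.
transitivity (\sum_j ev (lam om j) y); last by rewrite -ev_sum lam_sum ev1.
by rewrite [RHS](partition_big face_idx xpredT).
Qed.

Lemma frame_aff_hull_lam y i : ev (lam om i) y = 0 -> aff_hull (S :\ face_idx i) (o + T *m y).
Proof.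
move=> yi; exists (fun a => \sum_(j | face_idx j == a) ev (lam om j) y); split=> [a| |].
- rewrite in_setD1 negb_and negbK => aS; rewrite big1 // => j /eqP ja.
  by move: aS; rewrite -ja face_idx_in orbF => /eqP /face_idx_inj ->.
- exact: sum_fibers.
- rewrite (frame_barycentric cf face_free) (partition_big face_idx xpredT) //=.
  apply: eq_bigr => a _; rewrite scaler_suml; apply: eq_bigr => j /eqP <- //.
Qed.

Lemma aff_hull_frame x : aff_hull S x -> exists y, x = o + T *m y.
Proof.
move=> [l [l0 l1 xE]]; exists (T^T *m (x - o)).
apply/eqP; rewrite addrC -subr_eq; apply/eqP.
have -> : x - o = \sum_a l a *: (v a - o).
  by rewrite xE -{1}(scale1r o) -l1 scaler_suml -sumrB; apply: eq_bigr => a _; rewrite scalerBr.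
rewrite !mulmx_sumr; apply: eq_bigr => a _; rewrite -!scalemxAr.
have [aS|/l0 ->] := boolP (a \in S); last by rewrite !scale0r.
have [i <-] := face_idx_surj aS; by rewrite -/(coords o T _) (frame_vertex cf).
Qed.

(** This turns the normal component of a tangential trace, on a facet of the face, into a
    normal-normal component of tau there. *)
Lemma frame_glam_normal i : normal_to (S :\ face_idx i) (T *m glam om i).
Proof.
have omu := edges_frame_unit cf face_free.
move=> a b; rewrite !in_setD1 => /andP[ai aS] /andP[bi bS].
have [a' ea] := face_idx_surj aS; have [b' eb] := face_idx_surj bS.
rewrite trmx_mul -mulmxA -ea -eb.
have -> : T^T *m (v (face_idx a') - v (face_idx b')) = om a' - om b'.
  by rewrite /coords -mulmxBr opprB addrA subrK.
have -> : om a' - om b' = (om a' - om ord0) - (om b' - om ord0) by rewrite opprB addrA subrK.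
have L j : i != j -> ((glam om i)^T *m (om j - om ord0)) 0 0 = - (i == ord0)%:R.
  move=> ij; have := ev_lam_vertex omu i j; rewrite ev_lam (negPf ij) => /eqP.
  by rewrite addrC addr_eq0 => /eqP.
have ne j a'' : face_idx j = a'' -> a'' != face_idx i -> i != j.
  by move=> <-; rewrite (inj_eq face_idx_inj) eq_sym.
by rewrite mulmxBr mxE [X in _ + X]mxE !L ?subrr ?(ne _ _ ea ai) ?(ne _ _ eb bi).
Qed.

End Face.

Lemma aff_hull1 i x : aff_hull [set i] x -> x = v i.
Proof.
move=> [l [l0 l1 ->]]; have l0' j : j != i -> l j = 0 by move=> ji; apply: l0; rewrite finset.in_set1.
rewrite (bigD1 i) //= big1 ?addr0 => [|j /l0' ->]; last by rewrite scale0r.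
by move: l1; rewrite (bigD1 i) //= big1 ?addr0 // => -> ; rewrite scale1r.
Qed.

Lemma lam_aff_hull i x : ev (lam v i) x = 0 -> aff_hull [set~ i] x.
Proof.
move=> xi; exists (fun j => ev (lam v j) x); split.
- by move=> j; rewrite in_setC1 negbK => /eqP ->.
- by rewrite -ev_sum lam_sum ev1.
- exact: barycentric.
Qed.

Lemma glam_normal i : normal_to [set~ i] (glam v i).
Proof.
move=> a b; rewrite !in_setC1 ![_ == i]eq_sym glam_diff => /negPf -> /negPf ->.
by rewrite subrr.
Qed.

Lemma is_face1_setC1 i : (0 < d)%N -> is_face 1 ([set~ i] : {set 'I_d.+1}).
Proof. by move=> d0; rewrite /is_face cardsC1 card_ord subn1 prednK. Qed.

End Faces.

(** * Dimensions of the polynomial spaces *)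

Section Dimensions.
Variables (R : realType) (n : nat).
Local Notation A := {mpoly R[n]}.
Local Notation x := (xvec R n).

Definition ndim (l m : nat) := 'C(m + l, l).

Lemma card_bmultinom m : #|{: bmultinom n m.+1}| = ndim n m.
Proof.
(* The monomials of degree at most m in n variables are the tails of the
   monomials of degree m in n.+1 variables. *)
pose sb := [seq s2m (t : m.-tuple 'I_n.+1) | t <- enum (mpoly.basis n.+1 m)].
have ub : uniq sb by exact: uniq_basis.
have sbE (k : multinom n.+1) : (k \in sb) = (mdeg k == m) by rewrite basis_cover.
pose tb := [seq mtail k | k <- sb].
have ut : uniq tb.
  rewrite map_inj_in_uniq // => k l; rewrite !sbE !mdeg_mtail => /eqP ek /eqP el e.
  by apply: mtail_inj => //; move: el; rewrite -ek e => /eqP; rewrite eqn_add2r => /eqP.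
have tbE k : (k \in tb) = (mdeg k < m.+1)%N.
  apply/mapP/idP => [[l]|km].
    by rewrite sbE mdeg_mtail => /eqP <- ->; rewrite ltnS leq_addl.
  pose l : multinom n.+1 := Multinom [tuple if unlift ord0 i is Some j then k j else (m - mdeg k)%N | i < n.+1].
  have lk : mtail l = k.
    by apply/mnmP => i; rewrite !multinomE !tnth_mktuple multinomE tnth_mktuple liftK.
  exists l => //; rewrite sbE mdeg_mtail lk multinomE tnth_mktuple unlift_none.
  by rewrite subnK.
have -> : ndim n m = size tb.
  by rewrite size_map mpoly.size_basis /ndim -(bin_sub (leq_addr n m)) addKn.
rewrite cardE -(size_map val); apply: perm_size; apply: uniq_perm => //.
  by rewrite map_inj_uniq ?enum_uniq //; exact: val_inj.
move=> k; rewrite tbE; apply/mapP/idP => [[l _ ->]|km]; first exact: bmdeg.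
by exists (BMultinom km); rewrite ?mem_enum.
Qed.

Lemma ndim0 l : ndim l 0 = 1%N. Proof. by rewrite /ndim add0n binn. Qed.

Section Coordinates.
Variables (U : lmodType A) (J : finType) (M : J -> U) (pr : J -> U -> A) (m : nat).
Hypotheses (prD : forall j u v, pr j (u + v) = pr j u + pr j v)
  (prZ : forall j p u, pr j (p *: u) = p * pr j u)
  (prM : forall j i, pr j (M i) = (i == j)%:R).

Let pr_sum j (I : finType) (F : I -> U) : pr j (\sum_i F i) = \sum_i pr j (F i).
Proof.
apply: (big_morph (pr j) (prD j)).
by rewrite -(scale0r (0 : U)) prZ mul0r.
Qed.

(** One count for scalars, matrices and symmetric matrices: [M] is a family with dual coordinates
    [pr], and the equation on u confines it to the span of that family. *)
Lemma has_dim_coordinates :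
  has_dim [set u : U | (forall j, Ppoly m (pr j u)) /\ u = \sum_j pr j u *: M j]
    (#|J| * ndim n m).
Proof.
rewrite -card_bmultinom -card_prod.
pose b (i : J * bmultinom n m.+1) : U := mpolyX R i.2 *: M i.1.
have comb (c : J * bmultinom n m.+1 -> R) :
    \sum_i rscale (c i) (b i) = \sum_j (\sum_k c (j, k) *: mpolyX R k) *: M j.
  transitivity (\sum_j \sum_k rscale (c (j, k)) (b (j, k))).
    by rewrite pair_bigA; apply: eq_bigr => -[].
  apply: eq_bigr => j _; rewrite scaler_suml; apply: eq_bigr => k _.
  by rewrite /rscale /b scalerA mul_mpolyC.
have pr_comb c j : pr j (\sum_i rscale (c i) (b i)) = \sum_k c (j, k) *: mpolyX R k.
  rewrite comb pr_sum (bigD1 j) //= prZ prM eqxx mulr1 [X in _ + X]big1 ?addr0 // => i /negPf ij.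
  by rewrite prZ prM ij mulr0.
apply: (has_dim_fin (b := b)) => [c e [j k]|u].
  have := congr1 (mcoeff k) (pr_comb c j); rewrite e.
  have -> : pr j 0 = 0 by rewrite -(scale0r (0 : U)) prZ mul0r.
  rewrite mcoeff0 raddf_sum (bigD1 k) //= mcoeffZ mcoeffX eqxx mulr1 big1 ?addr0 // => l lk.
  by rewrite mcoeffZ mcoeffX -bmeqP (negPf lk) mulr0.
split=> [[um e]|[c ->]].
  exists (fun i : J * bmultinom n m.+1 => mcoeff i.2 (pr i.1 u)); rewrite comb {1}e; apply: eq_bigr => j _.
  by congr (_ *: _); apply: mpolywE; exact: um.
split=> [j|].
  rewrite /Ppoly /= pr_comb; apply: msize_sum_bound => k _; apply: msizeZ_bound.
  by rewrite msizeX; exact: bmdeg.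
by rewrite {1}comb; apply: eq_bigr => j _; rewrite pr_comb.
Qed.

End Coordinates.

Lemma has_dim_Ppoly m : has_dim (U := A^o) (@Ppoly R n m) (ndim n m).
Proof.
have := @has_dim_coordinates A^o unit (fun=> 1) (fun _ u => u) m.
rewrite card_unit mul1n => H.
apply: (has_dim_ext (H _ _ _)) => [//|//|[] [] //|u].
split=> [[/(_ tt)]|um] //; split=> //.
by rewrite (big_pred1 tt) => [|[]] //; rewrite [RHS]mulr1.
Qed.

Lemma has_dim_Pmx m a b : has_dim (@Pmx R n m a b) (a * b * ndim n m).
Proof.
have := @has_dim_coordinates 'M[A]_(a, b) ('I_a * 'I_b)%type (fun i => delta_mx i.1 i.2)
  (fun i u => u i.1 i.2) m.
rewrite card_prod !card_ord => H.
apply: (has_dim_ext (H _ _ _)) => [j u v|j p u|[i j] [k l]|u]; rewrite ?mxE //.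
  by rewrite xpair_eqE /= [i == _]eq_sym [j == _]eq_sym.
split=> [[um _] i j|um]; first exact: (um (i, j)).
split=> [[i j]|]; first exact: um.
by rewrite {1}[u]matrix_sum_delta pair_bigA; apply: eq_bigr => -[i j].
Qed.

Lemma sum_ordered_pairs l : (\sum_(i < l) \sum_(j < l | (i <= j)%N) 1 = 'C(l.+1, 2))%N.
Proof.
rewrite (exchange_big_dep predT) //= -bin2_sum big_nat_recl // add0n big_mkord.
apply: eq_bigr => j _; rewrite -(big_ord_widen_leq l (fun=> true) (fun=> 1%N)) //.
by rewrite sum1_card card_ord.
Qed.

Lemma card_ordered_pairs l : #|{: {i : 'I_l * 'I_l | (i.1 <= i.2)%N}}| = 'C(l.+1, 2).
Proof.
rewrite card_sig -sum1_card -sum_ordered_pairs pair_big_dep; apply: eq_bigl => i.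
by rewrite inE.
Qed.

Definition symPmx m : set 'M[A]_n := [set u | Pmx m u /\ symmx u].

Lemma has_dim_symPmx m : has_dim (symPmx m) ('C(n.+1, 2) * ndim n m).
Proof.
pose J : finType := {i : 'I_n * 'I_n | (i.1 <= i.2)%N}.
(* [sp a b] is the ordered pair under which the entries (a, b) and (b, a) are stored. *)
have [sp [spC spK]] : exists sp : 'I_n -> 'I_n -> J,
    (forall a b, sp a b = sp b a) /\ (forall j : J, sp (val j).1 (val j).2 = j).
  have le (a b : 'I_n) : let p := if (a <= b)%N then (a, b) else (b, a) in (p.1 <= p.2)%N.
    by case: leqP => //= /ltnW.
  exists (fun a b => exist (fun i : 'I_n * 'I_n => (i.1 <= i.2)%N) _ (le a b)); split=> [a b|[[a b] ab]]; apply/val_inj => /=.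
    by case: ltngtP => // /val_inj ->.
  by rewrite /= in ab; rewrite ab.
pose M (j : J) : 'M[A]_n := \matrix_(a, b) (j == sp a b)%:R.
have := @has_dim_coordinates 'M[A]_n J M (fun j u => u (val j).1 (val j).2) m.
rewrite card_ordered_pairs => H.
have comb (c : J -> A) a b : (\sum_j c j *: M j) a b = c (sp a b).
  rewrite summxE (bigD1 (sp a b)) //= !mxE eqxx mulr1 big1 ?addr0 // => j /negPf e.
  by rewrite !mxE e mulr0.
apply: (has_dim_ext (H _ _ _)) => [j u v|j p u|j i|u]; rewrite ?mxE ?spK //.
split=> [[um e]|[um su]].
  split=> [a b|]; first by rewrite e comb; exact: um.
  by apply/matrixP => a b; rewrite e mxE !comb spC.
split=> [j|]; first exact: um.
apply/matrixP => a b; rewrite comb.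
have [ab|/ltnW ba] := leqP a b.
  by have -> : sp a b = exist (fun i : 'I_n * 'I_n => (i.1 <= i.2)%N) (a, b) ab by rewrite -[RHS]spK.
have -> : sp a b = exist (fun i : 'I_n * 'I_n => (i.1 <= i.2)%N) (b, a) ba by rewrite spC -[RHS]spK.
by rewrite /= -{1}su mxE.
Qed.

Lemma rscale_reg c (p : A^o) : rscale c p = c *: (p : A).
Proof. exact: mul_mpolyC. Qed.

Lemma rscale_mxE a b c (u : 'M[A]_(a, b)) i j : (rscale c u) i j = c *: u i j.
Proof. by rewrite mxE mul_mpolyC. Qed.

Lemma rlinear_pihomog m : @rlinear R n A^o A^o (pihomog mdeg m).
Proof. by move=> c u v; rewrite !rscale_reg linearP. Qed.

Lemma rlinear_dotx : @rlinear R n 'cV[A]_n A^o (@dotx R n).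
Proof.
move=> c u v; rewrite dotxD rscale_reg; congr (_ + _).
by rewrite /dotx scaler_sumr; apply: eq_bigr => i _; rewrite rscale_mxE scalerAr.
Qed.

(** A right inverse of [dotx] up to the constant term. *)
Definition dotx_section (g : A) : 'cV[A]_n := \col_i einv 1 (mderiv i g).

Lemma dotx_sectionK g : dotx (dotx_section g) = g - mpolyC n (mcoeff mnm0 g).
Proof. by rewrite -sum_mulX_einv_mderiv; apply: eq_bigr => i _; rewrite mxE. Qed.

Lemma Pmx_dotx_section m g : Ppoly m.+1 g -> Pmx m (dotx_section g).
Proof. by move=> gm i j; rewrite /Ppoly /= mxE; apply/msize_pdiag/msize_mderiv. Qed.

(** P_m is the kernel of the projection of P_(m+1) to its top degree. Like the counts below, this is
    an additive relation, which keeps truncated subtraction out of the final identity. *)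
Lemma has_dim_Hpoly m : exists2 h,
  has_dim (U := A^o) (@Hpoly R n m.+1) h & (h + ndim n m = ndim n m.+1)%N.
Proof.
have [a [b [Ka Ib e]]] := rank_nullity (rlinear_pihomog m.+1) (has_dim_Ppoly m.+1).
exists b; last first.
  rewrite e addnC; congr addn; apply: (has_dim_uniq (has_dim_Ppoly m)).
  apply: (has_dim_ext Ka) => u; split=> [[um u0]|um].
    by have := msize_sub_pihomog um; rewrite u0 subr0.
  split; first exact: leqW.
  apply/mpolyP => k; rewrite mcoeff_pihomog mcoeff0; case: eqP => // e'.
  by rewrite mulr1n; move/msize_leP: um => ->; rewrite ?e'.
apply: (has_dim_ext Ib) => u; split=> [[v _ <-]|um]; first exact: Hpoly_pihomog.
by exists u; [exact: Hpoly_msize|exact: pihomog_dE].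
Qed.

(** By [NDE], ND_m is the kernel in P_(m+1) of the map sending v to the part of degree m + 2 of x .
    v, and that map is onto H_(m+2). *)
Lemma has_dim_ND m : exists2 a, has_dim (@ND R n m) a &
  (a + ndim n m.+2 = n * ndim n m.+1 + ndim n m.+1)%N.
Proof.
pose f (v : 'cV[A]_n) : A^o := pihomog mdeg m.+2 (dotx v).
have fl : rlinear f.
  by move=> c u v; rewrite /f rlinear_dotx rlinear_pihomog.
have := has_dim_Pmx m.+1 n 1; rewrite muln1 => /(rank_nullity fl)[a [b [Ka Ib e]]].
exists a.
  apply: (has_dim_ext Ka) => u; rewrite NDE; split=> -[um u0]; split=> //.
    by have := msize_sub_pihomog (msize_dotx um); rewrite -/(f u) u0 subr0.
  apply/mpolyP => k; rewrite mcoeff_pihomog mcoeff0; case: eqP => // e'.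
  by rewrite mulr1n; move/msize_leP: u0 => ->; rewrite ?e'.
have [h Hh <-] := has_dim_Hpoly m.+1.
rewrite e -addnA; congr addn; congr addn.
apply: (has_dim_uniq Hh); apply: (has_dim_ext Ib) => u; split=> [[v _ <-]|um].
  exact: Hpoly_pihomog.
exists (dotx_section u); first exact/Pmx_dotx_section/Hpoly_msize.
rewrite /f dotx_sectionK (HpolyP m.+2 u).1 ?mdeg0 // mpolyC0 subr0; exact: pihomog_dE.
Qed.

(* P_m(K; skew) x in the notation of the paper *)
Definition koszul m : set 'cV[A]_n :=
  [set q | exists B, [/\ Pmx m B, Defs.skewmx B & q = B *m x]].

Lemma koszulE m v : koszul m v <-> Pmx m.+1 v /\ dotx v = 0.
Proof.
split=> [[B [Bm skB ->]]|[vm v0]].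
  split; last exact: dotx_skew.
  move=> i j; rewrite (ord1 j) /Ppoly /= mulmx_xvec; apply: msize_sum_bound => l _.
  exact/msizeXM/Bm.
exists (curl (vinv v)); split; last exact: dotx_eq0_curl.
  exact/Pmx_curl/Pmx_vinv.
exact: curl_skew.
Qed.

Lemma has_dim_koszul m : exists2 a, has_dim (koszul m) a &
  (a + ndim n m.+2 = n * ndim n m.+1 + 1)%N.
Proof.
have := has_dim_Pmx m.+1 n 1; rewrite muln1 => /(rank_nullity rlinear_dotx)[a [b [Ka Ib ->]]].
exists a; first by apply: (has_dim_ext Ka) => u; rewrite koszulE; split=> -[].
(* P_(m+2) splits into the polynomials vanishing at the origin, which are the image of [dotx], and
   the constants, which account for the 1. *)
pose c0 (g : A^o) : A^o := mpolyC n (mcoeff mnm0 g).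
have c0l : rlinear c0.
  by move=> c u v; rewrite /c0 !rscale_reg linearP mpolyCD mpolyCM mul_mpolyC.
have [b' [oo [Kb Io e]]] := rank_nullity c0l (has_dim_Ppoly m.+2).
rewrite -addnA e; congr addn; congr addn.
  apply: (has_dim_uniq Kb); apply: (has_dim_ext Ib) => u; split=> [[v vm <-]|[um u0]].
    split; first exact: msize_dotx.
    rewrite /c0 /dotx raddf_sum big1 ?mpolyC0 //= => i _.
    by rewrite mcoeffXM mnm0E.
  exists (dotx_section u); first exact: Pmx_dotx_section.
  by rewrite dotx_sectionK -/(c0 u) u0 subr0.
have P0 := has_dim_Ppoly 0; rewrite ndim0 in P0.
apply: (has_dim_uniq _ P0); apply: (has_dim_ext Io) => u; split=> [[v _ <-]|u0].
  exact: msizeC_bound.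
exists u; last by rewrite /c0 -msize1_polyC.
exact: leq_trans u0 _.
Qed.

Lemma symgradD u v : symgrad (u + v) = symgrad u + symgrad v :> 'M[A]_n.
Proof.
by apply/matrixP => i j; rewrite !mxE !mderivD -scalerDr; congr (_ *: _); rewrite addrACA.
Qed.

Lemma symgradZ c u : symgrad (rscale c u) = rscale c (symgrad u) :> 'M[A]_n.
Proof.
apply/matrixP => i j; rewrite rscale_mxE !mxE !mul_mpolyC !mderivZ -scalerDr.
by rewrite !scalerA mulrC.
Qed.

(** By [symgrad_decomp], q x for q symmetric of degree m and (symgrad u) x for u of degree m + 1
    range over the same space. The two kernels are [kerx] and [ND 0], so rank-nullity applied twice
    eliminates the common rank. *)
Lemma has_dim_kerx m : exists a b, [/\ has_dim (@kerx R n m) a, has_dim (@ND R n 0) b &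
  (a + n * ndim n m.+1 = 'C(n.+1, 2) * ndim n m + b)%N].
Proof.
pose f (q : 'M[A]_n) := q *m x; pose g (u : 'cV[A]_n) := symgrad u *m x.
have fl : rlinear f by move=> c u v; rewrite /f mulmxDl /rscale scalemxAl.
have gl : rlinear g.
  by move=> c u v; rewrite /g symgradD symgradZ mulmxDl /rscale scalemxAl.
have [a [b [Ka Ib ->]]] := rank_nullity fl (has_dim_symPmx m).
have := has_dim_Pmx m.+1 n 1; rewrite muln1 => /(rank_nullity gl)[a' [b' [Ka' Ib' ->]]].
exists a, a'; split.
- by apply: (has_dim_ext Ka) => u; split=> [[[um su] u0]|[um su u0]].
- apply: (has_dim_ext Ka') => u; rewrite -symgrad_mulx_eq0; split=> [[]|u0] //; split=> //.
  by move/symgrad_mulx_eq0: u0 => /NDE[um _] i j; apply: leq_trans (um i j) _.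
rewrite -addnA; congr addn; rewrite addnC; congr addn.
apply: (has_dim_uniq Ib'); apply: (has_dim_ext Ib) => v; split=> [[q [qm sq] <-]|[u um <-]].
  have [u [k [um [_ _ k0] ->]]] := symgrad_decomp qm sq.
  by exists u => //; rewrite /f mulmxDl k0 addr0.
exists (symgrad u) => //; split; last exact: symgrad_sym.
exact: Pmx_symgrad.
Qed.

Lemma Hpoly_xx m h i j : Hpoly m h -> Hpoly m.+2 ((h *: (x *m x^T)) i j).
Proof.
move=> hm; rewrite !mxE big_ord1 !mxE -addn2; apply: dhomogM => //.
by rewrite -mpolyXD dhomogX /= mdegD !mdeg1.
Qed.

(** Rank-nullity for the projection to degree k + 3: the kernel is the symmetric part P_(k+2), the
    image the multiples h x x^T with h of degree k + 1. Inclusion in P_(k+3) first provides a finite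
    dimension to start from. *)
Lemma has_dim_Vminus k : (0 < n)%N ->
  exists2 h, has_dim (@Vminus R n k.+2) ('C(n.+1, 2) * ndim n k.+2 + h) &
  (h + ndim n k = ndim n k.+1)%N.
Proof.
move=> n0; pose P := @Pmx R n k.+3 n n.
pose f : 'M[A]_n -> 'M[A]_n := map_mx (pihomog mdeg k.+3).
have fl : rlinear f.
  by move=> c u v; apply/matrixP => i j; rewrite mxE [RHS]mxE !rscale_mxE mxE rscale_mxE linearP !mxE.
have VE (tau : 'M[A]_n) : Vminus k.+2 tau <-> exists B h,
    [/\ Pmx k.+2 B, symmx B, Hpoly k.+1 h & tau = B + h *: (x *m x^T)].
  by rewrite /Vminus /= subSS subn0.
have VP : @Vminus R n k.+2 `<=` P.
  move=> tau /VE[B [h [Bm sB hm ->]]] i j; rewrite mxE; apply: msizeD_bound.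
    exact/leqW/Bm.
  exact/Hpoly_msize/Hpoly_xx.
have xxs : symmx (x *m x^T) by rewrite /symmx /= trmx_mul trmxK.
have Vsub : rsubspace (@Vminus R n k.+2).
  split.
    apply/VE; exists 0, 0; split; rewrite ?scale0r ?addr0 //.
    - by move=> i j; rewrite mxE /Ppoly /= mmeasure0.
    - by rewrite /symmx /= trmx0.
    - by apply/HpolyP => l _; rewrite mcoeff0.
  move=> c u v /VE[B [h [Bm sB hm ->]]] /VE[B' [h' [Bm' sB' hm' ->]]]; apply/VE.
  exists (rscale c B + B'), (c *: h + h'); split.
  - by move=> i j; rewrite mxE rscale_mxE; apply: msizeD_bound; [exact/msizeZ_bound/Bm|exact: Bm'].
  - by rewrite /symmx /= linearD /= /rscale linearZ /= sB sB'.
  - by apply/HpolyP => l lk; rewrite mcoeffD mcoeffZ !(HpolyP k.+1 _).1 // mulr0 addr0.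
  - by rewrite /rscale scalerDr scalerDl -mul_mpolyC -scalerA addrACA.
have [l Vl] := rsubspace_has_dim (has_dim_Pmx k.+3 n n) Vsub VP.
have [a [b [Ka Ib e]]] := rank_nullity fl Vl.
have [h Hh he] := has_dim_Hpoly k; exists h => //.
have fV B p : Pmx k.+2 B -> Hpoly k.+1 p -> f (B + p *: (x *m x^T)) = p *: (x *m x^T).
  move=> Bm pm; apply/matrixP => i j; rewrite !mxE [LHS]raddfD /= -[RHS]add0r; congr (_ + _).
    apply/mpolyP => q; rewrite mcoeff_pihomog mcoeff0; case: eqP => // qk.
    by have /msize_leP -> := Bm i j; rewrite ?qk.
  by apply: pihomog_dE; have := Hpoly_xx i j pm; rewrite !mxE.
have xx0 p : p *: (x *m x^T) = 0 -> p = 0.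
  move=> /(congr1 (fun M : 'M[A]_n => M (Ordinal n0) (Ordinal n0))).
  rewrite !mxE big_ord1 !mxE => /eqP; rewrite !mulf_eq0 => /or3P[/eqP //| |];
    by rewrite -msize_poly_eq0 msizeXU.
have -> : ('C(n.+1, 2) * ndim n k.+2 = a)%N.
  apply: (has_dim_uniq (has_dim_symPmx k.+2)); apply: (has_dim_ext Ka) => u.
  split=> [[/VE[B [p [Bm sB pm ->]]]]|[um su]].
    by rewrite fV // => /xx0 ->; rewrite scale0r addr0.
  have uE : u = u + 0 *: (x *m x^T) by rewrite scale0r addr0.
  have h00 : Hpoly k.+1 (0 : A) by apply/HpolyP => q _; rewrite mcoeff0.
  split; first by apply/VE; exists u, 0.
  by rewrite uE fV // scale0r.
have -> : h = b; last by rewrite -e.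
pose g (p : A^o) : 'M[A]_n := (p : A) *: (x *m x^T).
have gl : rlinear g by move=> c u v; rewrite /g scalerDl rscale_reg -mul_mpolyC -scalerA.
have [a' [b' [Ka' Ib' ->]]] := rank_nullity gl Hh.
have a0 : a' = 0%N.
  apply: (has_dim_uniq Ka'); exists (fun _ => 0); split=> [c _ []//|u].
  split=> [[_ /xx0 ->]|[c ->]]; first by exists (fun _ => 0); rewrite big_ord0.
  rewrite big_ord0; split; first by apply/HpolyP => q _; rewrite mcoeff0.
  by rewrite /g scale0r.
rewrite a0 add0n; apply: (has_dim_uniq Ib'); apply: (has_dim_ext Ib) => u.
split=> [[v /VE[B [p [Bm sB pm ->]]] <-]|[p pm <-]]; first by exists p; rewrite // fV.
exists (0 + p *: (x *m x^T)); last first.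
  by rewrite fV // => i j; rewrite mxE /Ppoly /= mmeasure0.
apply/VE; exists 0, p; split=> //; first by move=> i j; rewrite mxE /Ppoly /= mmeasure0.
by rewrite /symmx /= trmx0.
Qed.

End Dimensions.

(** * Traces of the fields of the element *)

Section DivergenceXX.
Variables (R : realType) (d : nat).
Local Notation A := {mpoly R[d]}.
Implicit Types (h p : A).

Lemma euler_Hpoly m h : Hpoly m h -> euler h = m%:R *: h.
Proof.
move=> /HpolyP hm; apply/mpolyP => q; rewrite mcoeff_euler mcoeffZ.
by have [->|/hm ->] := eqVneq (mdeg q) m; rewrite ?mulr0.
Qed.

Lemma divD (u v : 'cV[A]_d) : div (u + v) = div u + div v.
Proof. by rewrite /div -big_split; apply: eq_bigr => i _; rewrite mxE mderivD. Qed.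

Lemma divmxD (M M' : 'M[A]_d) : divmx (M + M') = divmx M + divmx M'.
Proof.
apply/matrixP => i j; rewrite !mxE -divD; congr div.
by apply/matrixP => a b; rewrite !mxE.
Qed.

Lemma div_mul_xvec m h : Hpoly m h -> div (h *: xvec R d) = (m + d)%:R *: h.
Proof.
move=> hm; rewrite /div.
under eq_bigr do rewrite !mxE mderivM mderivXU eqxx mulr1 mulrC.
rewrite big_split /= -/(euler h) (euler_Hpoly hm) sumr_const card_ord.
by rewrite natrD scalerDl !scaler_nat.
Qed.

Lemma divmx_mul_xx m h : Hpoly m h ->
  divmx (h *: (xvec R d *m (xvec R d)^T)) = mpolyC d (m + d.+1)%:R *: (h *: xvec R d).
Proof.
move=> hm; apply/matrixP => i j; rewrite (ord1 j) {j} [LHS]mxE.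
have -> : (row i (h *: (xvec R d *m (xvec R d)^T)))^T = ('Y_i * h) *: xvec R d.
  by apply/matrixP => a b; rewrite !mxE big_ord1 !mxE mulrA [h * _]mulrC.
rewrite (@div_mul_xvec m.+1).
  by rewrite !mxE mul_mpolyC addSnnS mulrC.
apply/HpolyP => q qm; rewrite mcoeffXM; case: eqP => // /eqP qi.
apply: (HpolyP m _).1 => //; apply: contra qm => /eqP <-.
by rewrite -addn1 -(mdeg1 i) -mdegD submK // lep1mP.
Qed.

Lemma msize_div m (u : 'cV[A]_d) : Pmx m.+1 u -> (msize (div u) <= m.+1)%N.
Proof. by move=> um; apply: msize_sum_bound => i _; apply/msize_mderiv/um. Qed.

Lemma Pmx_divmx m (M : 'M[A]_d) : Pmx m.+1 M -> Pmx m (divmx M).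
Proof.
by move=> Mm i j; rewrite /Ppoly /= mxE; apply: msize_div => a b; rewrite !mxE; exact: Mm.
Qed.

End DivergenceXX.

Section BilinearForm.
Variables (R : realType) (d : nat).
Local Notation A := {mpoly R[d]}.
Implicit Types (tau : 'M[A]_d) (u z : 'cV[R]_d).

Definition bil tau u z : A := \sum_a \sum_b (u a 0 * z b 0) *: tau a b.

Lemma ev_bil tau u z x : ev (bil tau u z) x = (u^T *m evmx tau x *m z) 0 0.
Proof.
rewrite /bil ev_sum; under eq_bigr do rewrite ev_sum.
rewrite exchange_big mxE; apply: eq_bigr => b _; rewrite mxE mulr_suml; apply: eq_bigr => a _ /=.
by rewrite evZ !mxE mulrAC.
Qed.

Lemma bil_suml tau m (M : 'M[R]_(d, m)) (c : 'cV[R]_m) z :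
  bil tau (M *m c) z = \sum_i c i 0 *: bil tau (col i M) z.
Proof.
apply: ev_inj => x; rewrite ev_bil ev_sum.
under eq_bigr do rewrite evZ ev_bil.
have -> : M *m c = \sum_i c i 0 *: col i M.
  apply/matrixP => a b; rewrite (ord1 b) mxE summxE; apply: eq_bigr => i _.
  by rewrite !mxE mulrC.
rewrite raddf_sum /= !mulmx_suml summxE; apply: eq_bigr => i _.
by rewrite linearZ /= -!scalemxAl mxE.
Qed.

Lemma bil_sym tau u z : symmx tau -> bil tau u z = bil tau z u.
Proof.
move=> st; rewrite /bil exchange_big; apply: eq_bigr => a _; apply: eq_bigr => b _.
by rewrite -{1}st mxE mulrC.
Qed.

Lemma bil_xx tau (h : A) u z :
  bil (tau + h *: (xvec R d *m (xvec R d)^T)) u z =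
  bil tau u z + h * (dotv u (xvec R d) * dotv z (xvec R d)).
Proof.
rewrite /bil /dotv mulr_suml mulr_sumr -big_split; apply: eq_bigr => a _ /=.
rewrite mulr_sumr mulr_sumr -big_split; apply: eq_bigr => b _ /=.
rewrite !mxE big_ord1 !mxE scalerDr; congr (_ + _).
by rewrite -scalerAl -!scalerAr scalerA.
Qed.

End BilinearForm.

Lemma msize_dotv_xvec (R : realType) d (u : 'cV[R]_d) : (msize (dotv u (xvec R d)) <= 2)%N.
Proof. by apply: msize_sum_bound => a _; apply: msizeZ_bound; rewrite mxE msizeXU. Qed.

Lemma msize_lam_prod (R : realType) s (w : 'I_s.+1 -> 'cV[R]_s) (p : {mpoly R[s]}) m :
  (0 < s)%N -> edges w \in unitmx ->
  (msize ((\prod_i lam w i) * p) <= m + s.+1)%N -> (msize p <= m)%N.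
Proof.
move=> s0 wu; have e : size (index_enum 'I_s.+1) = s.+1.
  by rewrite -sum1_size sum1_card card_ord.
rewrite -[X in (m + X)%N]e; elim: (index_enum _) => [|i r IH]; first by rewrite big_nil mul1r addn0.
by rewrite big_cons -mulrA /= addnS => /(msize_lam_factor s0 wu) /IH.
Qed.

(** * Vanishing of tau n and n . div tau on the boundary *)

Section FaceTraces.
Variables (R : realType) (d k : nat) (v : 'I_d.+1 -> 'cV[R]_d).
Hypothesis hv : edges v \in unitmx.
Variables (tau B : 'M[{mpoly R[d]}]_d) (h : {mpoly R[d]}).
Hypotheses (k0 : (0 < k)%N) (Bk : Pmx k B) (sB : symmx B) (hh : Hpoly (k - 1) h)
  (tauE : tau = B + h *: (xvec R d *m (xvec R d)^T)).

Lemma tau_sym : symmx tau.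
Proof. by rewrite tauE /symmx /= linearD linearZ /= trmx_mul trmxK sB. Qed.

(** Only u has to be normal: one of the two linear factors of x x^T then becomes constant on the
    face. The bound thus also covers the normal-tangential components on facets. *)
Lemma msize_pull_bil s (w : 'I_s.+1 -> 'cV[R]_d) o (T : 'M[R]_(d, s)) u z :
  cartesian_frame w o T -> (edges w)^T *m u = 0 ->
  (msize (pull T o (bil tau u z)) <= k.+1)%N.
Proof.
move=> cf un; rewrite tauE bil_xx pullD !pullM (pull_frame_normal cf un).
apply: msizeD_bound.
  apply: msize_pull; apply: msize_sum_bound => a _; apply: msize_sum_bound => b _.
  exact/msizeZ_bound/Bk.
rewrite mulrCA mul_mpolyC; apply: msizeZ_bound.
have -> : k.+1 = (k - 1 + 1).+1 by rewrite subnK.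
apply: msizeM_bound; first exact/msize_pull/Hpoly_msize.
exact/msize_pull/msize_dotv_xvec.
Qed.

Variables (N : forall r : nat, {set 'I_d.+1} -> 'M[R]_(d, r))
    (o : nat -> {set 'I_d.+1} -> 'cV[R]_d)
    (T : forall r : nat, {set 'I_d.+1} -> 'M[R]_(d, d - r)).
Hypotheses (dk : (d <= k)%N)
  (hN : forall r S, (1 <= r < d)%N -> is_face r S -> normal_frame (face v r S) (N r S))
  (hT : forall r S, (1 <= r < d)%N -> is_face r S ->
     cartesian_frame (face v r S) (o r S) (T r S))
  (vertices0 : forall i : 'I_d.+1, evmx tau (v i) = 0)
  (normals0 : forall (r : nat) (S : {set 'I_d.+1}), (1 <= r < d)%N -> is_face r S ->
     forall i j : 'I_r, forall q, Ppoly (k + r - d - 1) q ->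
     simplex_int (face v r S) (fun x =>
       ((col i (N r S))^T *m evmx tau x *m col j (N r S)) 0 0 *
       ev q (coords (o r S) (T r S) x)) = 0).

Lemma normal_trace0 (S : {set 'I_d.+1}) (u z x : 'cV[R]_d) : (0 < #|S| <= d)%N -> normal_to v S u -> normal_to v S z ->
  aff_hull v S x -> ev (bil tau u z) x = 0.
Proof.
move: {2}#|S| (leqnn #|S|) => n; elim: n S x => [|n IH] S x.
  by rewrite leqn0 => /eqP ->.
move=> Sn /andP[S0 Sd] uS zS xS.
have [S1|S1] := leqP #|S| 1.
  have /cards1P[i Si] : #|S| == 1%N by rewrite eqn_leq S1.
  by rewrite ev_bil; move: xS; rewrite Si => /aff_hull1 ->; rewrite vertices0 mulmx0 mul0mx mxE.
pose r := (d - #|S|.-1)%N.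
have r1d : (1 <= r < d)%N by rewrite /r; lia.
have Sr : is_face r S by rewrite /is_face /r; apply/eqP; lia.
have sE : (d - r = #|S|.-1)%N by rewrite /r; lia.
have s0 : (0 < d - r)%N by lia.
have cf := hT r1d Sr; have free := @face_free _ _ _ hv _ _ Sr.
set w := face v r S in cf free; pose om i := coords (o r S) (T r S) (w i).
have omu : edges om \in unitmx := edges_frame_unit cf free.
pose G u z := pull (T r S) (o r S) (bil tau u z).
have evG u' z' y : ev (G u' z') y = ev (bil tau u' z') (o r S + T r S *m y) by exact: ev_pull.
suff G0 : G u z = 0.
  by have [y ->] := aff_hull_frame Sr cf xS; rewrite -evG G0 ev0.
have [p Gp] : exists p, G u z = (\prod_i lam om i) * p.
  apply: lam_prod_factor => // i y yi; rewrite evG.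
  have iS := face_idx_in Sr i.
  have SS : S :\ face_idx S i \subset S by exact: subD1set.
  apply: (IH (S :\ face_idx S i)).
  - by move: Sn; rewrite (cardsD1 (face_idx S i)) iS.
  - by move: S1 Sd; rewrite (cardsD1 (face_idx S i) S) iS add1n ltnS => -> /ltnW ->.
  - exact: normal_to_sub uS.
  - exact: normal_to_sub zS.
  - exact: (frame_aff_hull_lam hv Sr cf).
have [nn nE] := hN r1d Sr.
have un := (face_normal v Sr u).2 uS; have zn := (face_normal v Sr z).2 zS.
have pk : Ppoly (k + r - d - 1) p.
  apply: (msize_lam_prod s0 omu); rewrite -Gp.
  (* Dividing by d - r + 1 barycentric coordinates takes degree k to k + r - d - 1, a nonnegative
     number as d <= k and 1 <= r. *)
  have -> : ((k + r - d - 1).+1 + (d - r).+1 = k.+1)%N by lia.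
  exact: (msize_pull_bil z cf un).
have [c c0 cE] := simplex_int_frame cf free.
have Gij i j : SInt om (G (col i (N r S)) (col j (N r S)) * p) = 0.
  apply: (mulfI c0); rewrite mulr0 -[RHS](normals0 r1d Sr i j pk).
  symmetry; apply: cE => y; rewrite evM evG ev_bil.
  by rewrite (coords_frame cf).
have [cu uE] := (nE u).1 un; have [cz zE] := (nE z).1 zn.
have Gp0 : SInt om (G u z * p) = 0.
  have -> : G u z = \sum_i \sum_j (cu i 0 * cz j 0) *: G (col i (N r S)) (col j (N r S)).
    rewrite /G uE bil_suml pull_sum; apply: eq_bigr => i _.
    rewrite pullZ zE bil_sym ?bil_suml; last exact: tau_sym.
    rewrite pull_sum scaler_sumr; apply: eq_bigr => j _.
    by rewrite pullZ scalerA bil_sym //; exact: tau_sym.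
  rewrite mulr_suml linear_sum big1 // => i _; rewrite mulr_suml linear_sum big1 // => j _.
  by rewrite -scalerAl linearZ /= Gij mulr0.
(* The tested quantity G p is the product of the barycentric coordinates times p^2, nonnegative on
   the face. *)
have /eqP : (\prod_i lam om i) * (p * p) = 0.
  apply: (SInt_eq0 omu) => [y y0|]; last by rewrite mulrA -Gp.
  rewrite evM ev_prod; apply: mulr_ge0; first by apply: prodr_ge0 => i _; exact: y0.
  by rewrite evM -expr2 sqr_ge0.
rewrite Gp !mulf_eq0 orbb => /orP[] /eqP ->; by rewrite ?mul0r ?mulr0.
Qed.

Hypotheses (hd : (2 <= d)%N) (k3 : (3 <= k)%N)
  (tangential0 : forall S : {set 'I_d.+1}, is_face 1 S ->
     let n : 'cV[R]_d := N 1%N S in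
     forall q, ND (k - 2) q ->
     simplex_int (face v 1 S) (fun x =>
       frobdot ((1%:M - n *m n^T) *m (evmx tau x *m n))
             (T 1%N S *m evmx q (coords (o 1%N S) (T 1%N S) x))) = 0)
  (div_normal0 : forall S : {set 'I_d.+1}, is_face 1 S ->
     let n : 'cV[R]_d := N 1%N S in
     forall p, Ppoly (k - 1) p ->
     simplex_int (face v 1 S) (fun x =>
       frobdot n (evmx (divmx tau) x) *
       ev p (coords (o 1%N S) (T 1%N S) x)) = 0).

Section Facet.
Variable S : {set 'I_d.+1}.
Hypothesis S1 : is_face 1 S.
Let n : 'cV[R]_d := N 1%N S.
Let w := face v 1 S.
Let TS := T 1%N S.
Let oS := o 1%N S.
Let om i := coords oS TS (w i).

Let d1 : (1 <= 1 < d)%N. Proof. by rewrite hd. Qed.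
Let cf : cartesian_frame w oS TS. Proof. exact: hT. Qed.
Let free := @face_free _ _ _ hv _ _ S1.
Let omu : edges om \in unitmx. Proof. exact: (edges_frame_unit cf free). Qed.
Let s0 : (0 < d - 1)%N. Proof. by lia. Qed.

Let En : (edges w)^T *m n = 0.
Proof. by have [_ nE] := hN d1 S1; apply/(nE n).2; exists 1%:M; rewrite mulmx1. Qed.

Let nS : normal_to v S n. Proof. exact: (face_normal v S1 n).1 En. Qed.

Let cardS : #|S| = d.
Proof. by move/eqP: S1 => ->; lia. Qed.

(** The coordinates of Pi_F tau n in the tangent frame of the facet, as polynomials in d - 1
    variables. *)
Definition tangential_trace : 'cV[{mpoly R[d - 1]}]_(d - 1) :=
  \col_j pull TS oS (bil tau (col j TS) n).

Let V := tangential_trace.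

Let evV j y : ev (V j 0) y = ((col j TS)^T *m evmx tau (oS + TS *m y) *m n) 0 0.
Proof. by rewrite mxE ev_pull ev_bil. Qed.

Let bubble_V : bubble om V.
Proof.
move=> i y yi.
have -> : ev (dotv (glam om i) V) y = ev (bil tau (TS *m glam om i) n) (oS + TS *m y).
  rewrite bil_suml /dotv !ev_sum; apply: eq_bigr => j _.
  by rewrite !evZ evV ev_bil.
have iS := face_idx_in S1 i.
have SS : S :\ face_idx S i \subset S by exact: subD1set.
apply: (@normal_trace0 (S :\ face_idx S i)).
- move: (cardsD1 (face_idx S i) S); rewrite iS cardS add1n => e.
  by rewrite -ltnS -e hd; apply: ltnW; rewrite -e.
- exact: (frame_glam_normal hv S1 cf).
- exact: normal_to_sub nS.
- exact: (frame_aff_hull_lam hv S1 cf).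
Qed.

Let Pmx_V : Pmx k V.
Proof.
move=> j b; rewrite (ord1 b) /Ppoly /= mxE bil_sym; last exact: tau_sym.
exact: (msize_pull_bil _ cf En).
Qed.

Let SInt_V q : ND (k - 2) q -> SInt om (pdot V q) = 0.
Proof.
move=> qN; have [c c0 cE] := simplex_int_frame cf free.
apply: (mulfI c0); rewrite mulr0 -[RHS](tangential0 S1 qN); symmetry; apply: cE => y.
rewrite (coords_frame cf) -/n -/TS /frobdot trace_mx11.
(* The columns of [TS] are orthogonal to n, so the projection Pi_F may be dropped against a
   tangential test field. *)
have nT : n^T *m TS = 0.
  apply/matrixP => i j; rewrite (ord1 i).
  transitivity ((TS^T *m n) j 0); last by rewrite (frame_normal cf En) !mxE.
  by rewrite !mxE; apply: eq_bigr => a _; rewrite !mxE mulrC.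
have -> : ((1%:M - n *m n^T) *m (evmx tau (oS + TS *m y) *m n))^T *m (TS *m evmx q y) =
    (evmx tau (oS + TS *m y) *m n)^T *m TS *m evmx q y.
  have nnT : (n *m n^T)^T = n *m n^T.
    by apply/matrixP => i j; rewrite !mxE; apply: eq_bigr => a _; rewrite !mxE mulrC.
  rewrite trmx_mul [(1%:M - _)^T]linearB /= trmx1 nnT -!mulmxA; congr (_ *m _).
  by rewrite mulmxBl mul1mx -mulmxA [n^T *m _]mulmxA nT mul0mx mulmx0 subr0.
rewrite mxE /pdot ev_sum; apply: eq_bigr => j _.
rewrite evM evV [evmx q y j 0]mxE; congr (_ * _).
rewrite -mulmxA; move: (evmx tau _ *m n) => W.
by rewrite !mxE; apply: eq_bigr => a _; rewrite !mxE mulrC.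
Qed.

Lemma tangential_trace_eq0 : tangential_trace = 0.
Proof.
have k1 : (k = (k - 1).+1)%N by lia.
have dV : (msize (div V) <= (k - 1).+1)%N by apply: msize_div; rewrite -k1; exact: Pmx_V.
apply: (bubble_divfree_eq0 (m := k - 1) s0 omu).
- by rewrite -k1; exact: Pmx_V.
- exact: bubble_V.
(* V has degree k, so grad (div V) has degree k - 2 and is an admissible test field. *)
- apply: (div_eq0 s0 omu bubble_V); apply: SInt_V; apply/NDE.
  have gP : Pmx (k - 2) (grad (div V)).
    by move=> i j; rewrite /Ppoly /= mxE; apply: msize_mderiv; apply: leq_trans dV _; lia.
  split; first by move=> i j; exact/leqW/gP.
  exact: msize_dotx.
(* B' x has degree k - 1, but x . (B' x) = 0, so it lies in ND_(k-2). *)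
- move=> B' Bm skB; apply: SInt_V; apply/NDE.
  have e : (k - 1 - 1 = k - 2)%N by lia.
  by have [] := (koszulE (k - 2) (B' *m xvec R _)).1; [exists B'; rewrite -e|move=> xP ->;
     split=> //; rewrite /Ppoly /= mmeasure0].
Qed.

Lemma facet_trace0 x : aff_hull v S x -> evmx tau x *m n = 0.
Proof.
move=> xS; apply/matrixP => a b; rewrite (ord1 b) {b} [RHS]mxE.
pose z : 'cV[R]_d := delta_mx a 0.
(* A coordinate vector is split into its tangential part, handled by the tangential trace, and a
   normal remainder u, handled by [normal_trace0]. *)
pose u := z - TS *m (TS^T *m z).
have Tu : TS^T *m u = 0.
  by rewrite mulmxBr [TS^T *m (TS *m _)]mulmxA; case: cf => -> _ _; rewrite mul1mx subrr.
have uS : normal_to v S u by apply: (face_normal v S1 u).1; exact: (frame_normal_edges cf Tu).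
transitivity ((z^T *m evmx tau x *m n) 0 0).
  by rewrite -mulmxA /z trmx_delta -rowE [RHS]mxE.
have -> : z = TS *m (TS^T *m z) + u by rewrite addrC subrK.
have cS : (0 < #|S| <= d)%N by rewrite cardS leqnn andbT ltnW.
rewrite linearD /= !mulmxDl mxE -!ev_bil (normal_trace0 cS uS nS xS) addr0.
rewrite bil_suml ev_sum big1 // => j _; rewrite evZ.
have [y ->] := aff_hull_frame S1 cf xS.
have := congr1 (fun W : 'cV_(d - 1) => ev (W j 0) y) tangential_trace_eq0.
by rewrite /= mxE ev_pull [X in _ = ev X _]mxE ev0 => ->; rewrite mulr0.
Qed.

(** div (h x x^T) is a multiple of h x and n . x is constant on the facet, so the trace has degree k
    - 1 there and may be tested against itself. *)
Lemma facet_div_trace0 x : aff_hull v S x -> ev (dotv n (divmx tau)) x = 0.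
Proof.
move=> xS; have [y ->] := aff_hull_frame S1 cf xS; rewrite -ev_pull.
suff -> : pull TS oS (dotv n (divmx tau)) = 0 by rewrite ev0.
apply: (SInt_sq_eq0 omu); have [c c0 cE] := simplex_int_frame cf free.
set p := pull _ _ _.
have pk : Ppoly (k - 1) p.
  rewrite /p tauE divmxD (divmx_mul_xx hh).
  have -> : dotv n (divmx B + mpolyC d (k - 1 + d.+1)%:R *: (h *: xvec R d)) =
      dotv n (divmx B) + (k - 1 + d.+1)%:R *: (h * dotv n (xvec R d)).
    rewrite /dotv mulr_sumr scaler_sumr -big_split; apply: eq_bigr => a _.
    rewrite mxE scalerDr; congr (_ + _).
    by rewrite [in LHS]mxE mul_mpolyC [in LHS]mxE -scalerAr !scalerA mulrC.
  rewrite pullD pullZ pullM (pull_frame_normal cf En) [_ * mpolyC _ _]mulrC mul_mpolyC.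
  apply: msizeD_bound; last by apply/msizeZ_bound/msizeZ_bound/msize_pull/Hpoly_msize.
  apply: msize_pull; apply: msize_sum_bound => a _; apply: msizeZ_bound.
  by apply: (@Pmx_divmx _ _ (k - 1)); rewrite (_ : (k - 1).+1 = k) //; lia.
apply: (mulfI c0); rewrite mulr0 -[RHS](div_normal0 S1 pk); symmetry; apply: cE => z.
rewrite evM (coords_frame cf) /frobdot trace_mx11; congr (_ * _).
rewrite /p ev_pull /dotv ev_sum mxE; apply: eq_bigr => a _.
by rewrite evZ !mxE.
Qed.

Lemma normal_facet_normal u : normal_to v S u -> exists c : R, u = c *: n.
Proof.
move=> /(face_normal v S1 u).2 uE; have [_ nE] := hN d1 S1.
have [c ->] := (nE u).1 uE; exists (c 0 0).
by rewrite {1}[c]mx11_scalar mul_mx_scalar.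
Qed.

End Facet.

Lemma tbubble_tau : tbubble v tau.
Proof.
move=> i a x xi; have d0 : (0 < d)%N by lia.
have Si := is_face1_setC1 i d0.
have [c gE] := normal_facet_normal Si (@glam_normal _ _ _ hv i).
have := facet_trace0 Si (lam_aff_hull hv xi) => tn.
transitivity ((evmx tau x *m glam v i) a 0).
  by rewrite /dotv ev_sum mxE; apply: eq_bigr => b _; rewrite evZ !mxE mulrC.
by rewrite gE -scalemxAr tn scaler0 mxE.
Qed.

Lemma bubble_div_tau : bubble v (divmx tau).
Proof.
move=> i x xi; have d0 : (0 < d)%N by lia.
have Si := is_face1_setC1 i d0.
have [c ->] := normal_facet_normal Si (@glam_normal _ _ _ hv i).
transitivity (c * ev (dotv (N 1%N [set~ i]) (divmx tau)) x).
  by rewrite /dotv !ev_sum mulr_sumr; apply: eq_bigr => a _; rewrite !evZ mxE mulrA.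
by rewrite (facet_div_trace0 Si (lam_aff_hull hv xi)) mulr0.
Qed.

End FaceTraces.

(** * Interior degrees of freedom *)

Section Interior.
Variables (R : realType) (d : nat) (v : 'I_d.+1 -> 'cV[R]_d).
Hypotheses (d0 : (0 < d)%N) (hv : edges v \in unitmx).
Local Notation A := {mpoly R[d]}.
Local Notation SInt := (SInt v).

Lemma simplex_int_ev : exists2 c, c != 0 &
  forall f G, (forall x, f x = ev G x) -> simplex_int v f = c * SInt G.
Proof.
exists (Num.sqrt (\det ((edges v)^T *m edges v))) => [|f G fG]; last first.
  rewrite /simplex_int; congr (_ * std_int _ _); apply/funext => t.
  by rewrite ev_pull fG.
rewrite det_mulmx det_tr -expr2 sqrtr_sqr normr_eq0.
by move: hv; rewrite unitmxE unitfE.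
Qed.

Definition scal_form (p q : A^o) : R := SInt ((p : A) * (q : A)).
Definition vec_form (u w : 'cV[A]_d) : R := SInt (pdot u w).

Lemma inK_eq0 p q : inK v p q = 0 <-> scal_form p q = 0.
Proof.
have [c c0 cE] := simplex_int_ev; rewrite /inK /scal_form (cE _ (p * q)) => [|x]; last by rewrite evM.
by split=> [/eqP|->]; rewrite ?mulr0 // mulf_eq0 (negPf c0) => /eqP.
Qed.

Lemma inKmx_vec_eq0 u w : inKmx v u w = 0 <-> vec_form u w = 0.
Proof.
have [c c0 cE] := simplex_int_ev; rewrite /inKmx /vec_form (cE _ (pdot u w)) => [|x].
  by split=> [/eqP|->]; rewrite ?mulr0 // mulf_eq0 (negPf c0) => /eqP.
rewrite /frobdot trace_mx11 mxE /pdot ev_sum; apply: eq_bigr => a _.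
by rewrite evM !mxE.
Qed.

Lemma inKmx_mx_eq0 (M M' : 'M[A]_d) : inKmx v M M' = 0 -> SInt (mdot M M') = 0.
Proof.
have [c c0 cE] := simplex_int_ev; rewrite /inKmx (cE _ (mdot M M')) => [/eqP|x].
  by rewrite mulf_eq0 (negPf c0) => /eqP.
rewrite /frobdot /mxtrace /mdot exchange_big ev_sum; apply: eq_bigr => b _.
rewrite mxE ev_sum; apply: eq_bigr => a _.
by rewrite evM !mxE.
Qed.

Lemma scal_form_linear (w : A^o) c u u' :
  scal_form (rscale c u + u') w = c * scal_form u w + scal_form u' w.
Proof. by rewrite /scal_form rscale_reg mulrDl -scalerAl linearP. Qed.

Lemma scal_form_sym u w : scal_form u w = scal_form w u.
Proof. by rewrite /scal_form mulrC. Qed.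

Lemma scal_form_def u : scal_form u u = 0 -> u = 0.
Proof. exact: SInt_sq_eq0. Qed.

Lemma vec_form_linear w c u u' :
  vec_form (rscale c u + u') w = c * vec_form u w + vec_form u' w.
Proof.
rewrite /vec_form -linearP; congr SInt; rewrite /pdot scaler_sumr -big_split.
by apply: eq_bigr => a _; rewrite mxE rscale_mxE mulrDl -scalerAl.
Qed.

Lemma vec_form_sym u w : vec_form u w = vec_form w u.
Proof. by congr SInt; apply: eq_bigr => a _; rewrite mulrC. Qed.

Lemma vec_form_def u : vec_form u u = 0 -> u = 0.
Proof.
move=> e; apply/matrixP => a b; rewrite (ord1 b) mxE.
have /eqP : u a 0 * u a 0 = 0.
  apply: (SInt_sum_eq0 hv (P := xpredT) (F := fun a => u a 0 * u a 0)) => // j _ y _.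
  by rewrite evM -expr2 sqr_ge0.
by rewrite mulf_eq0 orbb => /eqP.
Qed.

Lemma Ppoly_sub m m' : (m <= m')%N -> @Ppoly R d m `<=` @Ppoly R d m'.
Proof. by move=> mm p /leq_trans; apply. Qed.

Lemma koszul_sub m m' : (m <= m')%N -> @koszul R d m `<=` @koszul R d m'.
Proof.
move=> mm q [B [Bm sB ->]]; exists B; split=> // i j; exact: (Ppoly_sub mm) (Bm i j).
Qed.

Lemma Pquot_orth m q : Pquot v m q <->
  [set q : A^o | @Ppoly R d m q /\ forall w, @Ppoly R d 1 w -> scal_form q w = 0] q.
Proof. by split=> -[qm H]; split=> // p /H /inK_eq0. Qed.

Lemma PKxquot_orth m q : PKxquot v m q <->
  [set q | koszul m q /\ forall w, koszul 0 w -> vec_form q w = 0] q.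
Proof.
split=> -[qm H]; split=> //.
  by move=> w [B [Bm sB ->]]; apply/inKmx_vec_eq0; exact: H.
by move=> C Cm sC; apply/inKmx_vec_eq0/H; exists C.
Qed.

Lemma has_dim_Pquot m : (0 < m)%N ->
  has_dim (U := A^o) (Pquot v m) (ndim d m - ndim d 1) /\ (ndim d 1 <= ndim d m)%N.
Proof.
move=> m0; have sub := @Ppoly_sub 1 m m0.
split; last exact: has_dim_le (has_dim_Ppoly R d m) (has_dim_Ppoly R d 1) sub.
apply: (has_dim_ext (has_dim_orthogonal scal_form_linear scal_form_sym scal_form_def
  (has_dim_Ppoly R d m) (has_dim_Ppoly R d 1) sub)) => u.
by rewrite Pquot_orth.
Qed.

Lemma has_dim_PKxquot m : exists a a0, [/\ has_dim (PKxquot v m) (a - a0), (a0 <= a)%N,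
  (a + ndim d m.+2 = d * ndim d m.+1 + 1)%N & (a0 + ndim d 2 = d * ndim d 1 + 1)%N].
Proof.
have [a Ha ea] := has_dim_koszul R d m; have [a0 Ha0 ea0] := has_dim_koszul R d 0.
have sub := @koszul_sub 0 m (leq0n m).
exists a, a0; split=> //; last exact: has_dim_le Ha Ha0 sub.
apply: (has_dim_ext (has_dim_orthogonal vec_form_linear vec_form_sym vec_form_def Ha Ha0 sub)) => u.
by rewrite PKxquot_orth.
Qed.

Variables (k : nat) (tau B : 'M[A]_d) (h : A).
Hypotheses (k3 : (3 <= k)%N) (Bk : Pmx k B) (sB : symmx B) (hh : Hpoly (k - 1) h)
  (tauE : tau = B + h *: (xvec R d *m (xvec R d)^T))
  (tbub : tbubble v tau) (dbub : bubble v (divmx tau))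
  (divdiv0 : forall q, Pquot v (k - 1) q -> inK v (div (divmx tau)) q = 0)
  (div0 : forall q, PKxquot v (k - 3) q -> inKmx v (divmx tau) q = 0)
  (ker0 : forall q, kerx (k - 2) q -> inKmx v tau q = 0).

Let st : symmx tau. Proof. exact: tau_sym tauE. Qed.

(** These moments replace the ones left out by both quotients. *)
Let SInt_div_ND0 u : ND 0 u -> SInt (pdot (divmx tau) u) = 0.
Proof.
move=> /symgrad_ND0 u0; have := SInt_symgrad d0 hv u st tbub.
rewrite u0 (_ : mdot tau 0 = 0) ?raddf0 => [/esym/eqP|]; first by rewrite oppr_eq0 => /eqP.
by rewrite /mdot big1 // => a _; rewrite big1 // => b _; rewrite mxE mulr0.
Qed.

(** The factors in div (h x x^T) = c1 h x and div (h x) = c2 h, for h homogeneous of degree k -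
    1. *)
Let c1 : R := (k - 1 + d.+1)%:R.
Let c2 : R := (k - 1 + d)%:R.

Let div_tauE : divmx tau = divmx B + mpolyC d c1 *: (h *: xvec R d).
Proof. by rewrite tauE divmxD (divmx_mul_xx hh). Qed.

Let divdiv_tauE : div (divmx tau) = div (divmx B) + (c1 * c2) *: h.
Proof.
rewrite div_tauE divD; congr (_ + _).
rewrite /div; under eq_bigr do rewrite mxE mul_mpolyC mderivZ.
by rewrite -scaler_sumr -/(div _) (div_mul_xvec hh) scalerA.
Qed.

Let kS : (k = (k - 3).+3)%N. Proof. by lia. Qed.

Let Pdd : Ppoly (k - 2) (div (divmx B)).
Proof.
have -> : (k - 2 = (k - 3).+1)%N by lia.
apply: msize_sum_bound => i _; apply: msize_mderiv.
by apply: (@Pmx_divmx _ _ (k - 3).+2); rewrite -kS.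
Qed.

Let divdiv_eq0 : div (divmx tau) = 0.
Proof.
have Pd : Ppoly (k - 1) (div (divmx tau)).
  rewrite divdiv_tauE; apply: msizeD_bound; last exact/msizeZ_bound/Hpoly_msize.
  by apply: leq_trans Pdd _; lia.
(* div div tau is split into p in P_1 and a remainder in the quotient, against which it is tested by
   hypothesis. *)
have [p p1] := orthogonal_proj scal_form_linear scal_form_sym scal_form_def
  (has_dim_Ppoly R d (k - 1)) (has_dim_Ppoly R d 1) (@Ppoly_sub 1 (k - 1) ltac:(lia)) Pd.
move=> /Pquot_orth /divdiv0 /inK_eq0; rewrite /scal_form mulrBr raddfB /=.
have -> : SInt (div (divmx tau) * p) = 0; last by rewrite subr0 => /(SInt_sq_eq0 hv).
(* Against p, integrate by parts once: grad p is constant, hence in [ND 0]. *)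
rewrite mulrC; apply/eqP; rewrite -oppr_eq0 -(SInt_grad d0 hv _ dbub); apply/eqP.
apply/SInt_div_ND0/NDE; have gP : Pmx 0 (grad p).
  by move=> i j; rewrite /Ppoly /= mxE; apply: msize_mderiv.
by split; [move=> i j; exact/leqW/gP|exact: msize_dotx].
Qed.

(** div div tau = 0 equates a nonzero multiple of h, homogeneous of degree k - 1, with a polynomial
    of degree at most k - 2. *)
Let h_eq0 : h = 0.
Proof.
have c0 : c1 * c2 != 0 by rewrite mulf_neq0 // pnatr_eq0; lia.
have ch : (c1 * c2) *: h = - div (divmx B).
  by apply/eqP; rewrite -addr_eq0 addrC -divdiv_tauE divdiv_eq0.
apply: (scalerI c0); rewrite scaler0; apply: (@Hpoly_Ppoly_eq0 _ _ (k - 2)).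
  rewrite (_ : (k - 2).+1 = k - 1)%N; last by lia.
  by apply/HpolyP => q qk; rewrite mcoeffZ (HpolyP (k - 1) h).1 // mulr0.
by rewrite ch /Ppoly /= mmeasureN.
Qed.

Let tauB : tau = B. Proof. by rewrite tauE h_eq0 scale0r addr0. Qed.

Let div_eq0 : divmx tau = 0.
Proof.
apply: (bubble_divfree_eq0 (m := k - 2) d0 hv) => //.
  rewrite tauB; apply: (Pmx_divmx (m := (k - 2).+1)).
  by rewrite (_ : (k - 2).+2 = k) //; lia.
move=> C Cm sC; rewrite (_ : k - 2 - 1 = k - 3)%N in Cm; last by lia.
have Kq : koszul (k - 3) (C *m xvec R d) by exists C.
have [a Ha _] := has_dim_koszul R d (k - 3); have [a0 Ha0 _] := has_dim_koszul R d 0.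
(* C x is split likewise, its part u in P_0(K; skew) x being a rigid motion. *)
have [u u0] := orthogonal_proj vec_form_linear vec_form_sym vec_form_def Ha Ha0
  (@koszul_sub 0 (k - 3) (leq0n _)) Kq.
move=> /PKxquot_orth /div0 /inKmx_vec_eq0; rewrite vec_form_sym => e.
rewrite -/(vec_form _ _) vec_form_sym -(subrK u (C *m _)) -[_ - u]rscale1 vec_form_linear e mulr0 add0r.
rewrite vec_form_sym; apply: SInt_div_ND0; apply/NDE.
by have [um ->] := (koszulE 0 u).1 u0; split=> //; rewrite /Ppoly /= mmeasure0.
Qed.

Lemma interior_eq0 : tau = 0.
Proof.
apply: (tbubble_divfree_eq0 (m := k - 2) d0 hv) => //.
  by rewrite tauB (_ : (k - 2).+2 = k) //; lia.
by move=> q /ker0 /inKmx_mx_eq0.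
Qed.

End Interior.

(** * The dimension count *)

(** Double counting of a pair inside a subset of j + 2 elements. *)
Lemma mul_bin2 n j : ('C(n.+2, j.+2) * 'C(j.+2, 2) = 'C(n.+2, 2) * 'C(n, j))%N.
Proof.
apply/eqP; rewrite -(eqn_pmul2l (isT : (0 < 2)%N)); apply/eqP.
have e1 := mul_bin_diag n.+2 j.+1; have e2 := mul_bin_diag n.+1 j.
have e3 := mul_bin_diag j.+2 1; have e4 := mul_bin_diag n.+2 1.
rewrite /= bin1 in e3; rewrite /= bin1 in e4; rewrite /= in e1 e2.
by rewrite mulnCA -e3 mulnCA mulnA -e1 [RHS]mulnA -e4 -!mulnA e2 [(_ * j.+1)%N]mulnC.
Qed.

(** Split 'C(r+1, 2) = 'C(r, 2) + r and absorb each term into 'C(d+1, r), with d = e + 2; each sum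
    is then a Vandermonde convolution. The range includes r = d, the vertices. *)
Lemma sum_bin_faces e K :
  (\sum_(1 <= r < e.+3) 'C(e.+3, r) * ('C(r.+1, 2) * 'C(K, e.+2 - r)) =
   'C(e.+3, 2) * 'C(K + e.+1, e) + e.+3 * 'C(K + e.+2, e.+1))%N.
Proof.
have T2 : (\sum_(1 <= r < e.+3) 'C(e.+3, r) * r * 'C(K, e.+2 - r) = e.+3 * 'C(K + e.+2, e.+1))%N.
  rewrite big_add1 /= big_mkord addnC -binomial.Vandermonde big_distrr; apply: eq_bigr => j _ /=.
  by rewrite [(_ * j.+1)%N]mulnC -mul_bin_diag subSS mulnA.
have T1 : (\sum_(1 <= r < e.+3) 'C(e.+3, r) * 'C(r, 2) * 'C(K, e.+2 - r) =
    'C(e.+3, 2) * 'C(K + e.+1, e))%N.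
  rewrite big_add1 /= big_nat_recl // ['C(1, 2)]bin_small // muln0 mul0n add0n big_mkord.
  rewrite addnC -binomial.Vandermonde big_distrr; apply: eq_bigr => j _ /=.
  by rewrite !subSS mulnA mul_bin2.
rewrite -T1 -T2 -big_split; apply: eq_bigr => r _ /=.
by rewrite binS bin1 mulnDl mulnDr !mulnA.
Qed.

Lemma count_identity e k (h aN a a0 kr b : nat) :
  let d := e.+2 in let K := k.+3 in (d <= K)%N ->
  (h + ndim d (K - 2) = ndim d (K - 1))%N ->
  (aN + ndim (d - 1) K = (d - 1) * ndim (d - 1) (K - 1) + ndim (d - 1) (K - 1))%N ->
  (a + ndim d (K - 1) = d * ndim d (K - 2) + 1)%N ->
  (a0 + ndim d 2 = d * ndim d 1 + 1)%N -> (a0 <= a)%N -> (ndim d 1 <= ndim d (K - 1))%N ->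
  (kr + d * ndim d (K - 1) = 'C(d.+1, 2) * ndim d (K - 2) + b)%N ->
  (b + ndim d 2 = d * ndim d 1 + ndim d 1)%N ->
  ('C(d.+1, 2) * ndim d K + h =
   d.+1 * 'C(d.+1, 2)
   + \sum_(1 <= r < d) 'C(d.+1, (d - r).+1) * ('C(r.+1, 2) * ndim (d - r) (K + r - d - 1))
   + d.+1 * aN + d.+1 * ndim (d - 1) (K - 1) + (ndim d (K - 1) - ndim d 1) + (a - a0) + kr)%N.
Proof.
move=> d K dK eh eN ea ea0 a0a n1 ek eb.
(* The vertex values are the term r = d of the sum over faces. *)
have -> : (d.+1 * 'C(d.+1, 2) +
    \sum_(1 <= r < d) 'C(d.+1, (d - r).+1) * ('C(r.+1, 2) * ndim (d - r) (K + r - d - 1)) =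
    'C(d.+1, 2) * 'C(k.+2 + e.+1, e) + d.+1 * 'C(k.+2 + e.+2, e.+1))%N.
  rewrite -sum_bin_faces [RHS]big_nat_recr //= subnn bin0 muln1 binSn addnC; congr (_ + _)%N.
  apply: eq_big_nat => r /andP[r1 rd]; have rd' := ltnW rd.
  have -> : ((d - r).+1 = d.+1 - r)%N by rewrite subSn.
  rewrite bin_sub; last exact: leqW.
  by rewrite /ndim (_ : K + r - d - 1 + (d - r) = k.+2)%N // /K; lia.
(* By Pascal's rule every dimension that depends on k becomes a combination of 'C(n, e), 'C(n, e+1)
   and 'C(n, e+2). *)
set n := (k.+2 + e.+1)%N.
have E2 : (k.+2 + e.+2 = n.+1)%N by rewrite /n; lia.
rewrite E2; set D := 'C(d.+1, 2) in ek *.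
have D2 : (2 * D = d * d.+1)%N by rewrite /D -mul_bin_diag /= bin1 mulnC.
have n1E : ndim d 1 = d.+1 by rewrite /ndim add1n binSn.
have n2E : ndim d 2 = (D + d.+1)%N.
  by rewrite /ndim -(bin_sub (leq_addl 2 d)) addnK add2n binS bin1.
have nK : ndim d K = ('C(n, e) + 2 * 'C(n, e.+1) + 'C(n, e.+2))%N.
  by rewrite /ndim (_ : K + d = n.+2)%N ?/n ?/K ?/d; [rewrite !binS; lia|lia].
have nK1 : ndim d (K - 1) = ('C(n, e.+1) + 'C(n, e.+2))%N.
  by rewrite /ndim (_ : K - 1 + d = n.+1)%N ?/n ?/K ?/d; [rewrite !binS; lia|lia].
have nK2 : ndim d (K - 2) = 'C(n, e.+2).
  by rewrite /ndim (_ : K - 2 + d = n)%N // /n /K /d; lia.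
have mK : ndim (d - 1) K = ('C(n, e) + 'C(n, e.+1))%N.
  by rewrite /ndim subn1 (_ : K + d.-1 = n.+1)%N ?/n ?/K ?/d /=; [rewrite !binS; lia|lia].
have mK1 : ndim (d - 1) (K - 1) = 'C(n, e.+1).
  by rewrite /ndim subn1 (_ : K - 1 + d.-1 = n)%N // /n /K /d /=; lia.
rewrite binS nK nK1 mK1 n1E.
rewrite nK1 nK2 in eh; rewrite mK mK1 in eN; rewrite nK1 nK2 in ea; rewrite n1E n2E in ea0.
rewrite n1E nK1 in n1; rewrite nK1 nK2 in ek; rewrite n1E n2E in eb.
have d1 : (d - 1 + 1 = d)%N by rewrite /d; lia.
clear nK nK1 nK2 mK mK1 n1E n2E dK E2; clearbody D d.
move: ('C(n, e)) ('C(n, e.+1)) ('C(n, e.+2)) eh eN ea ek n1 => A B C eh eN ea ek n1.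
(* The product relation to be supplied by hand, from 2 D = d (d + 1); the rest is linear arithmetic
   in the products. *)
have eN' : (d.+1 * aN + d.+1 * (A + B) = 2 * (D * B))%N.
  have e' : ((d - 1) * B + B = d * B)%N by rewrite -{2}[B]mul1n -mulnDl d1.
  by rewrite -mulnDr eN e' mulnA [(d.+1 * d)%N]mulnC -D2 mulnA.
lia.
Qed.

Lemma sum_faces d r c : (\sum_(S : {set 'I_d.+1} | is_face r S) c = 'C(d.+1, (d - r).+1) * c)%N.
Proof.
rewrite big_const iter_addn_0 mulnC; congr (_ * _)%N.
have := card_draws 'I_d.+1 (d - r).+1; rewrite card_ord => <-.
by apply: eq_card => S; rewrite !inE.
Qed.

Lemma dimension_count (R : realType) (d k : nat) (v : 'I_d.+1 -> 'cV[R]_d) :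
  (2 <= d)%N -> (maxn d 3 <= k)%N -> edges v \in unitmx ->
  rdim (@Vminus R d k) =
    (d.+1 * (d * d.+1)./2
     + (\sum_(1 <= r < d) \sum_(S : {set 'I_d.+1} | is_face r S)
          \sum_(i < r) \sum_(j < r | i <= j)
             dimP (@Ppoly R (d - r) (k + r - d - 1)))
     + (\sum_(S : {set 'I_d.+1} | is_face 1 S) rdim (@ND R (d - 1) (k - 2)))
     + (\sum_(S : {set 'I_d.+1} | is_face 1 S) dimP (@Ppoly R (d - 1) (k - 1)))
     + dimP (Pquot v (k - 1))
     + rdim (PKxquot v (k - 3))
     + rdim (@kerx R d (k - 2)))%N.
Proof.
case: d v => [|[|e]] v // _; case: k => [|[|[|k]]]; rewrite geq_max ?andbF // => /andP[dk _] hv.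
have d0 : (0 < e.+2)%N by [].
have [h Vh eh] := has_dim_Vminus R k.+1 d0.
have [aN HN eN] := has_dim_ND R (e.+2 - 1) (k.+3 - 2).
have [HQ n1] := @has_dim_Pquot R e.+2 v hv (k.+3 - 1) isT.
have [a [a0 [HK a0a ea ea0]]] := has_dim_PKxquot hv (k.+3 - 3).
have [kr [b [Hr Hb ek]]] := has_dim_kerx R e.+2 (k.+3 - 2).
have [b' Hb' eb] := has_dim_ND R e.+2 0.
rewrite -(has_dim_uniq Hb Hb') in eb.
rewrite (rdimE Vh) (rdimE HN) /dimP (rdimE HQ) (rdimE HK) (rdimE Hr).
rewrite (rdimE (has_dim_Ppoly _ _ _)).
have bin2E : ((e.+2 * e.+3)./2 = 'C(e.+3, 2))%N by rewrite bin2 [in RHS]mulnC.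
have facets : 'C(e.+3, (e.+2 - 1).+1) = e.+3 by rewrite subn1 binSn.
rewrite bin2E !sum_faces facets; rewrite !subSS !subn0 in ea.
rewrite (count_identity dk eh eN ea ea0 a0a n1 ek eb).
congr (_ + _ + _ + _ + _ + _ + _)%N.
apply: eq_bigr => r _; rewrite sum_faces (rdimE (has_dim_Ppoly _ _ _)).
congr (_ * _)%N; rewrite -sum_ordered_pairs big_distrl; apply: eq_bigr => i _.
by rewrite big_distrl; apply: eq_bigr => j _ /=; rewrite mul1n.
Qed.

Theorem theorem5p8 (R : realType) (d k : nat) (hd : (2 <= d)%N)
    (hk : (maxn d 3 <= k)%N)
    (v : 'I_d.+1 -> 'cV[R]_d) (hv : edges v \in unitmx)
    (h0 : conv_hull v 0)
    (N : forall r : nat, {set 'I_d.+1} -> 'M[R]_(d, r))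
    (o : nat -> {set 'I_d.+1} -> 'cV[R]_d)
    (T : forall r : nat, {set 'I_d.+1} -> 'M[R]_(d, d - r))
    (hN : forall r S, (1 <= r < d)%N -> is_face r S ->
       normal_frame (face v r S) (N r S))
    (hT : forall r S, (1 <= r < d)%N -> is_face r S ->
       cartesian_frame (face v r S) (o r S) (T r S)) :
  (forall tau : 'M[{mpoly R[d]}]_d, Vminus k tau ->
     (forall i : 'I_d.+1, evmx tau (v i) = 0) ->
     (forall (r : nat) (S : {set 'I_d.+1}), (1 <= r < d)%N -> is_face r S ->
        forall i j : 'I_r, forall q, Ppoly (k + r - d - 1) q ->
        simplex_int (face v r S) (fun x =>
          ((col i (N r S))^T *m evmx tau x *m col j (N r S)) 0 0 *
          ev q (coords (o r S) (T r S) x)) = 0) ->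
     (forall S : {set 'I_d.+1}, is_face 1 S ->
        let n : 'cV[R]_d := N 1%N S in
        forall q, ND (k - 2) q ->
        simplex_int (face v 1 S) (fun x =>
          frobdot ((1%:M - n *m n^T) *m (evmx tau x *m n))
                (T 1%N S *m evmx q (coords (o 1%N S) (T 1%N S) x))) = 0) ->
     (forall S : {set 'I_d.+1}, is_face 1 S ->
        let n : 'cV[R]_d := N 1%N S in
        forall p, Ppoly (k - 1) p ->
        simplex_int (face v 1 S) (fun x =>
          frobdot n (evmx (divmx tau) x) *
          ev p (coords (o 1%N S) (T 1%N S) x)) = 0) ->
     (forall q, Pquot v (k - 1) q -> inK v (div (divmx tau)) q = 0) ->
     (forall q, PKxquot v (k - 3) q -> inKmx v (divmx tau) q = 0) ->
     (forall q, kerx (k - 2) q -> inKmx v tau q = 0) ->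
     tau = 0)
  /\
  rdim (@Vminus R d k) =
    (d.+1 * (d * d.+1)./2
     + (\sum_(1 <= r < d) \sum_(S : {set 'I_d.+1} | is_face r S)
          \sum_(i < r) \sum_(j < r | i <= j)
             dimP (@Ppoly R (d - r) (k + r - d - 1)))
     + (\sum_(S : {set 'I_d.+1} | is_face 1 S) rdim (@ND R (d - 1) (k - 2)))
     + (\sum_(S : {set 'I_d.+1} | is_face 1 S) dimP (@Ppoly R (d - 1) (k - 1)))
     + dimP (Pquot v (k - 1))
     + rdim (PKxquot v (k - 3))
     + rdim (@kerx R d (k - 2)))%N.
Proof.
split; last exact: dimension_count.
move=> tau [B [h [Bk sB hh tauE]]] vert normals tangential divn divdiv dvk kr.
move: (hk); rewrite geq_max => /andP[dk k3].
have d0 : (0 < d)%N by exact: ltnW.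
have k0 : (0 < k)%N by exact: leq_trans d0 dk.
apply: (interior_eq0 d0 hv k3 Bk sB hh tauE) => //.
  exact: (tbubble_tau hv k0 Bk sB hh tauE dk hN hT vert normals hd k3 tangential).
exact: (bubble_div_tau hv k0 Bk hh tauE dk hN hT hd k3 divn).
Qed.
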